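(* Let $a,b\in\mathbb D$ with $a\ne b$. For $\varepsilon\in\mathbb C\setminus\{0\}$ let $L^\varepsilon_{a0bV}$ denote Coman's Lempert function on $\mathbb D^2$ with the three poles $(a,0),(b,0),(b,\varepsilon)$, all of weight $1$. Then for every $z\in\mathbb D^2$, $$\lim_{\varepsilon\to0}L^\varepsilon_{a0bV}(z)=\min\{L_{a0bV}(z),L_{a0b0}(z)\}.$$
   Context: $\mathbb D$ is the open unit disc; maps $\varphi=(\varphi_1,\varphi_2)$ are holomorphic $\mathbb D\to\mathbb D^2$. Coman's Lempert function with poles $p_1,\dots,p_k$ of weight 1: $\inf\{\sum_{j}\log|\zeta_j|:\varphi(0)=z,\ \zeta_j\in\mathbb D,\ \varphi(\zeta_j)=p_j\}$. $L_{a0b0}(z)=\inf\{\log|\zeta_1|+\log|\zeta_2|:\varphi(0)=z,\varphi(\zeta_1)=(a,0),\varphi(\zeta_2)=(b,0)\}$. $L_{a0bV}(z)=\inf\{\log|\zeta_1|+2\log|\zeta_2|:\varphi(0)=z,\varphi(\zeta_1)=(a,0),\varphi(\zeta_2)=(b,0),\varphi_1'(\zeta_2)=0\}$. *)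

(* Defs.v *)
From Stdlib Require Import Reals.
From Coquelicot Require Import Coquelicot.
Open Scope R_scope.

Definition inD (z : C) : Prop := Cmod z < 1.

Definition C_has_deriv (f : C -> C) (z l : C) : Prop :=
  @is_derive C_AbsRing C_NormedModule f z l.

Definition holo_on_D (f : C -> C) : Prop :=
  forall z, inD z -> exists l, C_has_deriv f z l.

(* phi = (phi1, phi2) : D -> D^2 holomorphic (values outside D are irrelevant) *)
Definition hol_disc (phi1 phi2 : C -> C) : Prop :=
  holo_on_D phi1 /\ holo_on_D phi2 /\
  forall z, inD z -> inD (phi1 z) /\ inD (phi2 z).

Definition logabs (z : C) : Rbar :=
  if Req_EM_T (Cmod z) 0 then m_infty else Finite (ln (Cmod z)).

Definition inD2 (z : C * C) : Prop := inD (fst z) /\ inD (snd z).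

Definition coman3 (p1 p2 p3 z : C * C) : Rbar :=
  Rbar_glb (fun v => exists (phi1 phi2 : C -> C) (s1 s2 s3 : C),
    hol_disc phi1 phi2 /\ phi1 0 = fst z /\ phi2 0 = snd z /\
    inD s1 /\ inD s2 /\ inD s3 /\
    (phi1 s1, phi2 s1) = p1 /\ (phi1 s2, phi2 s2) = p2 /\
    (phi1 s3, phi2 s3) = p3 /\
    v = Rbar_plus (Rbar_plus (logabs s1) (logabs s2)) (logabs s3)).

Definition L_a0b0 (a b : C) (z : C * C) : Rbar :=
  Rbar_glb (fun v => exists (phi1 phi2 : C -> C) (s1 s2 : C),
    hol_disc phi1 phi2 /\ phi1 0 = fst z /\ phi2 0 = snd z /\
    inD s1 /\ inD s2 /\
    phi1 s1 = a /\ phi2 s1 = 0 /\ phi1 s2 = b /\ phi2 s2 = 0 /\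
    v = Rbar_plus (logabs s1) (logabs s2)).

Definition L_a0bV (a b : C) (z : C * C) : Rbar :=
  Rbar_glb (fun v => exists (phi1 phi2 : C -> C) (s1 s2 : C),
    hol_disc phi1 phi2 /\ phi1 0 = fst z /\ phi2 0 = snd z /\
    inD s1 /\ inD s2 /\
    phi1 s1 = a /\ phi2 s1 = 0 /\ phi1 s2 = b /\ phi2 s2 = 0 /\
    C_has_deriv phi1 s2 0 /\
    v = Rbar_plus (logabs s1) (Rbar_plus (logabs s2) (logabs s2))).

Definition Rbar_nbhs (l : Rbar) (P : Rbar -> Prop) : Prop :=
  match l with
  | Finite x => exists eps : posreal, forall y : R, Rabs (y - x) < eps -> P (Finite y)
  | p_infty => exists M : R, forall y : Rbar, Rbar_lt (Finite M) y -> P y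
  | m_infty => exists M : R, forall y : Rbar, Rbar_lt y (Finite M) -> P y
  end.

Definition C_punct_lim (F : C -> Rbar) (l : Rbar) : Prop :=
  forall P, Rbar_nbhs l P -> locally' (0 : C) (fun e => P (F e)).

(* Main.v *)
Require Import Defs.
From Stdlib Require Import Reals Lra Lia Classical ClassicalEpsilon FunctionalExtensionality.
From Coquelicot Require Import Coquelicot.
Open Scope R_scope.

(** The automorphism [mob b] moves [b] to 0: put [Z = mob b z1], [A = mob b a].  Dividing the two
    components of an analytic disc by the Blaschke factors of their prescribed zeros, and using the
    Schwarz-Pick lemma, a triple of parameters is admissible for one of the three extremal problems iff
    two-point Pick conditions hold; these are explicit inequalities between the parameters.

    For the poles [(a,0)], [(b,0)] they give [L_a0b0 = ln M] with
    [M = max (|z2|, |Z| |mob A Z|)], and discs almost attaining it can be bent to pass through [(b,e)]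
    at a third parameter close to the unit circle, at no cost in the limit.  A competitor for [L_a0bV]
    is perturbed by splitting the double parameter in two.  Conversely, if three parameters have product
    smaller than some [c < M], then the Schwarz-Pick lemma for the second component forces the two
    parameters sent to [b] to collide as [e] tends to 0, so a cluster point of such triples satisfies the
    conditions of the problem [L_a0bV].

    Since [holo_on_D] requires no continuity of the derivative, the maximum principle is proved from
    Goursat's theorem, for the function [f (exp w)] on a rectangle. *)

(** * Limits and complex derivatives *)

(** Two obstacles shape the proof. A quotient by Blaschke factors is known only away from the zeros
    divided out, and division by 0 gives it the value 0 there; instead of removing singularities,
    the Schwarz-Pick lemma is proved for bounded functions that may be irregular at two points. And
    a limit of admissible parameters satisfies only non-strict inequalities, possibly with a
    parameter on the unit circle, whereas perturbation needs strict ones; dilating the nodes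
    recovers strictness at arbitrarily small cost. The same openness allows nodes to be placed on
    the circle first, where a prescribed value is constrained only in modulus, and then moved
    inside. The mass is the right threshold because three parameters always satisfy
    [|Z| |mob A Z| <= |s1 s2 s3|]. A product below [c] therefore means [|s1 s2 s3| < c < |z2|]: the
    second component divided by [mob s1] and [mob s2] has modulus above [|s3|] at 0, so it stays
    away from 0 at [s3], and a small [e] can only come from the factors [mob s1 s3] and [mob s2 s3].
    The first of these is kept away from 0 by [a <> b]. *)

Definition cder (f : C -> C) (z l : C) : Prop :=
  forall eps, 0 < eps -> exists d, 0 < d /\
    forall w, Cmod (w - z) < d -> Cmod (f w - f z - l * (w - z)) <= eps * Cmod (w - z).

Lemma C_has_deriv_cder (f : C -> C) (z l : C) : C_has_deriv f z l <-> cder f z l.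
Proof.
  unfold C_has_deriv, is_derive, filterdiff. split.
  - intros [_ H] eps He.
    destruct (H z (fun P HP => HP) (mkposreal eps He)) as [d Hd].
    exists d. split; [apply d|]. intros w Hw.
    rewrite (Cmult_comm l). exact (Hd w Hw).
  - intros H. split.
    + apply (is_linear_scal_l (K := C_AbsRing) (V := C_NormedModule)).
    + intros x Hx eps.
      apply (is_filter_lim_locally_unique (K := C_AbsRing) (V := AbsRing_NormedModule C_AbsRing)) in Hx.
      subst x. destruct (H eps (cond_pos eps)) as [d [Hd Hw]].
      exists (mkposreal d Hd). intros w Hwd. specialize (Hw w Hwd).
      rewrite (Cmult_comm l) in Hw. exact Hw.
Qed.

Section Limits.
Context {T : Type} (F : (T -> Prop) -> Prop) {FF : Filter F}.
(** Over an arbitrary filter, so that the same rules serve limits at a complex point ([nearC]),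
    one-sided limits of a real parameter ([at_left 1]) and sequences ([eventually]). *)
Definition clim (u : T -> C) (l : C) : Prop :=
  forall eps, 0 < eps -> F (fun x => Cmod (u x - l) < eps).
Definition rlim (u : T -> R) (l : R) : Prop :=
  forall eps, 0 < eps -> F (fun x => Rabs (u x - l) < eps).

Lemma clim_const (c : C) : clim (fun _ => c) c.
Proof.
  intros e He. apply filter_forall. intros _.
  replace (c - c)%C with (RtoC 0) by ring. rewrite Cmod_0. exact He.
Qed.

Lemma clim_ext (u v : T -> C) l : F (fun x => u x = v x) -> clim u l -> clim v l.
Proof.
  intros H Hu e He. generalize (@filter_and T F FF _ _ H (Hu e He)).
  apply filter_imp. intros x [E Hx]. rewrite <- E. exact Hx.
Qed.

Lemma clim_plus u v a b : clim u a -> clim v b -> clim (fun x => u x + v x)%C (a + b)%C.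
Proof.
  intros Hu Hv e He.
  generalize (@filter_and T F FF _ _ (Hu (e/2) ltac:(lra)) (Hv (e/2) ltac:(lra))).
  apply filter_imp. intros x [H1 H2].
  replace (u x + v x - (a + b))%C with ((u x - a) + (v x - b))%C by ring.
  eapply Rle_lt_trans; [apply Cmod_triangle|]. lra.
Qed.

Lemma clim_opp u a : clim u a -> clim (fun x => - u x)%C (- a)%C.
Proof.
  intros Hu e He. generalize (Hu e He). apply filter_imp. intros x H.
  replace (- u x - - a)%C with (- (u x - a))%C by ring. rewrite Cmod_opp. exact H.
Qed.

Lemma clim_minus u v a b : clim u a -> clim v b -> clim (fun x => u x - v x)%C (a - b)%C.
Proof. intros Hu Hv. apply clim_plus; [exact Hu | apply clim_opp, Hv]. Qed.

Lemma clim_conj u a : clim u a -> clim (fun x => Cconj (u x)) (Cconj a).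
Proof.
  intros Hu e He. generalize (Hu e He). apply filter_imp. intros x H.
  rewrite <- Cminus_conj, Cmod_conj. exact H.
Qed.

Lemma clim_mult u v a b : clim u a -> clim v b -> clim (fun x => u x * v x)%C (a * b)%C.
Proof.
  intros Hu Hv e He.
  pose proof (Cmod_ge_0 a). pose proof (Cmod_ge_0 b).
  set (K := Cmod a + Cmod b + 1).
  assert (HK : 0 < K) by (unfold K; lra).
  set (d := Rmin 1 (e / (2 * K))).
  assert (Hd : 0 < d). { unfold d. apply Rmin_glb_lt; [lra|]. apply Rdiv_lt_0_compat; lra. }
  generalize (@filter_and T F FF _ _ (Hu d Hd) (Hv d Hd)).
  apply filter_imp. intros x [H1 H2].
  replace (u x * v x - a * b)%C with ((u x - a) * (v x - b) + ((u x - a) * b + a * (v x - b)))%C by ring.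
  assert (d1 : d <= 1) by apply Rmin_l. assert (d2 : d <= e / (2 * K)) by apply Rmin_r.
  assert (d3 : d * K <= e / 2).
  { apply Rle_trans with (e / (2 * K) * K); [apply Rmult_le_compat_r; lra|]. right. field. lra. }
  eapply Rle_lt_trans; [apply Cmod_triangle|].
  assert (Cmod ((u x - a) * b + a * (v x - b)) <= d * Cmod b + Cmod a * d).
  { eapply Rle_trans; [apply Cmod_triangle|]. rewrite !Cmod_mult.
    apply Rplus_le_compat; [apply Rmult_le_compat_r|apply Rmult_le_compat_l]; lra. }
  rewrite Cmod_mult.
  pose proof (Cmod_ge_0 (u x - a)). pose proof (Cmod_ge_0 (v x - b)).
  assert (Cmod (u x - a) * Cmod (v x - b) <= d * 1).
  { apply Rmult_le_compat; lra. }
  unfold K in d3. nra.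
Qed.

Lemma clim_inv u (a : C) : a <> 0 -> clim u a -> clim (fun x => / u x)%C (/ a)%C.
Proof.
  intros Ha Hu e He.
  assert (Hm : 0 < Cmod a) by now apply Cmod_gt_0.
  set (m := Cmod a) in *.
  set (d := Rmin (m/2) (e * m * m / 4)).
  assert (Hd : 0 < d).
  { unfold d. apply Rmin_glb_lt; [lra|]. apply Rdiv_lt_0_compat; [|lra].
    repeat apply Rmult_lt_0_compat; lra. }
  generalize (Hu d Hd). apply filter_imp. intros x H.
  assert (d1 : d <= m/2) by apply Rmin_l. assert (d2 : d <= e * m * m / 4) by apply Rmin_r.
  assert (Hx : m / 2 < Cmod (u x)).
  { assert (m <= Cmod (u x) + Cmod (u x - a)).
    { unfold m. replace a with (u x + - (u x - a))%C at 1 by ring.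
      eapply Rle_trans; [apply Cmod_triangle|]. rewrite Cmod_opp. lra. }
    lra. }
  assert (Hx0 : u x <> 0). { apply Cmod_gt_0. lra. }
  replace (/ u x - / a)%C with (- (u x - a) / (u x * a))%C by (field; split; assumption).
  rewrite Cmod_div by now apply Cmult_neq_0.
  rewrite Cmod_opp, Cmod_mult. fold m.
  apply Rmult_lt_reg_r with (Cmod (u x) * m); [apply Rmult_lt_0_compat; lra|].
  unfold Rdiv. rewrite Rmult_assoc, Rinv_l, Rmult_1_r
    by (apply Rgt_not_eq, Rmult_lt_0_compat; lra).
  apply Rlt_le_trans with (e * m * m / 2); [|].
  - apply Rlt_le_trans with d; [exact H|]. assert (0 < e * m * m) by (repeat apply Rmult_lt_0_compat; lra). lra.
  - replace (e * m * m / 2) with (e * m * (m / 2)) by field.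
    replace (e * (Cmod (u x) * m)) with (e * m * Cmod (u x)) by ring.
    apply Rmult_le_compat_l; [|lra]. apply Rmult_le_pos; lra.
Qed.

Lemma clim_div u v a (b : C) : b <> 0 -> clim u a -> clim v b -> clim (fun x => u x / v x)%C (a / b)%C.
Proof. intros Hb Hu Hv. apply clim_mult; [exact Hu | now apply clim_inv]. Qed.

Lemma clim_pow u a n : clim u a -> clim (fun x => u x ^ n)%C (a ^ n)%C.
Proof.
  intros Hu. induction n as [|n IH]; simpl; [apply clim_const | now apply clim_mult].
Qed.

Lemma rlim_Cmod u a : clim u a -> rlim (fun x => Cmod (u x)) (Cmod a).
Proof.
  intros Hu e He. generalize (Hu e He). apply filter_imp. intros x H.
  eapply Rle_lt_trans; [|exact H].
  assert (Cmod a <= Cmod (u x) + Cmod (u x - a)).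
  { replace a with (u x + - (u x - a))%C at 1 by ring.
    eapply Rle_trans; [apply Cmod_triangle|]. rewrite Cmod_opp. lra. }
  assert (Cmod (u x) <= Cmod a + Cmod (u x - a)).
  { replace (u x) with (a + (u x - a))%C at 1 by ring. apply Cmod_triangle. }
  apply Rabs_le. lra.
Qed.

Lemma rlim_const c : rlim (fun _ => c) c.
Proof.
  intros e He. apply filter_forall. intros _. rewrite Rminus_diag, Rabs_R0. exact He.
Qed.

Lemma rlim_mult u v a b : rlim u a -> rlim v b -> rlim (fun x => u x * v x) (a * b).
Proof.
  intros Hu Hv.
  assert (HC : forall w c, rlim w c -> clim (fun x => RtoC (w x)) (RtoC c)).
  { intros w c Hw e He. generalize (Hw e He). apply filter_imp. intros x Hx.
    rewrite <- RtoC_minus, Cmod_R. exact Hx. }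
  intros e He. generalize (clim_mult _ _ _ _ (HC _ _ Hu) (HC _ _ Hv) e He).
  apply filter_imp. intros x. rewrite <- !RtoC_mult, <- RtoC_minus, Cmod_R. auto.
Qed.

Lemma rlim_lt u v a b : rlim u a -> rlim v b -> a < b -> F (fun x => u x < v x).
Proof.
  intros Hu Hv Hab.
  generalize (@filter_and T F FF _ _ (Hu ((b-a)/2) ltac:(lra)) (Hv ((b-a)/2) ltac:(lra))).
  apply filter_imp. intros x [H1 H2].
  apply Rabs_lt_between in H1. apply Rabs_lt_between in H2. lra.
Qed.
End Limits.

Lemma rlim_le {T} (F : (T -> Prop) -> Prop) {FF : ProperFilter F} u v a b :
  rlim F u a -> rlim F v b -> F (fun x => u x <= v x) -> a <= b.
Proof.
  intros Hu Hv H. apply Rnot_lt_le. intros Hlt.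
  destruct (filter_ex (F := F) _ (@filter_and T F _ _ _ H (rlim_lt F v u b a Hv Hu Hlt))) as [x [H1 H2]].
  lra.
Qed.

Definition nearC (z : C) (P : C -> Prop) : Prop :=
  exists d, 0 < d /\ forall w, Cmod (w - z) < d -> P w.

Lemma nearC_self (z : C) (P : C -> Prop) : nearC z P -> P z.
Proof.
  intros [d [Hd H]]. apply H. replace (z - z)%C with (RtoC 0) by ring. now rewrite Cmod_0.
Qed.

Global Instance nearC_filter z : ProperFilter (nearC z).
Proof.
  constructor.
  - intros P HP. exists z. now apply nearC_self.
  - constructor.
    + exists 1. split; [lra | auto].
    + intros P Q [d1 [H1 P1]] [d2 [H2 P2]]. exists (Rmin d1 d2).
      split; [now apply Rmin_glb_lt|]. intros w Hw. split.
      * apply P1. eapply Rlt_le_trans; [exact Hw | apply Rmin_l].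
      * apply P2. eapply Rlt_le_trans; [exact Hw | apply Rmin_r].
    + intros P Q HPQ [d [Hd H]]. exists d. split; [exact Hd | auto].
Qed.

Lemma clim_id z : clim (nearC z) (fun w => w) z.
Proof. intros e He. exists e. split; auto. Qed.

Lemma clim_comp {T} (F : (T -> Prop) -> Prop) {FF : Filter F} (u : T -> C) (g : C -> C) a b :
  clim F u a -> clim (nearC a) g b -> clim F (fun x => g (u x)) b.
Proof.
  intros Hu Hg e He. destruct (Hg e He) as [d [Hd H]].
  generalize (Hu d Hd). apply filter_imp. intros x. apply H.
Qed.

(* Caratheodory's form of differentiability, which reduces the rules of calculus to limits. *)
Lemma cder_slope (f : C -> C) (z l : C) :
  cder f z l <-> exists q : C -> C,
    (forall w, f w - f z = q w * (w - z))%C /\ clim (nearC z) q l /\ q z = l.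
Proof.
  split.
  - intros H.
    exists (fun w => if excluded_middle_informative (w = z) then l else (f w - f z) / (w - z))%C.
    split; [|split].
    + intros w. destruct (excluded_middle_informative (w = z)) as [->|Hw]; [ring|].
      field. now apply Cminus_eq_contra.
    + intros e He. destruct (H (e/2) ltac:(lra)) as [d [Hd Hw]].
      exists d. split; [exact Hd|]. intros w Hwd.
      destruct (excluded_middle_informative (w = z)) as [->|Hwz].
      * replace (l - l)%C with (RtoC 0) by ring. now rewrite Cmod_0.
      * specialize (Hw w Hwd). assert (w - z <> 0)%C by now apply Cminus_eq_contra.
        replace ((f w - f z) / (w - z) - l)%C with ((f w - f z - l * (w - z)) / (w - z))%C by (field; assumption).
        rewrite Cmod_div by assumption.
        assert (0 < Cmod (w - z)) by now apply Cmod_gt_0.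
        apply Rle_lt_trans with (e/2); [|lra].
        apply Rmult_le_reg_r with (Cmod (w - z)); [assumption|].
        unfold Rdiv at 1. rewrite Rmult_assoc, Rinv_l, Rmult_1_r by lra. exact Hw.
    + destruct (excluded_middle_informative (z = z)); [reflexivity | congruence].
  - intros [q [Hq [Hl _]]] e He. destruct (Hl e He) as [d [Hd H]].
    exists d. split; [exact Hd|]. intros w Hw. rewrite Hq.
    replace (q w * (w - z) - l * (w - z))%C with ((q w - l) * (w - z))%C by ring.
    rewrite Cmod_mult. apply Rmult_le_compat_r; [apply Cmod_ge_0|]. left. now apply H.
Qed.

Lemma cder_continuous f z l : cder f z l -> clim (nearC z) f (f z).
Proof.
  intros H. apply cder_slope in H. destruct H as [q [Hq [Hl _]]].
  apply clim_ext with (fun w => q w * (w - z) + f z)%C.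
  - typeclasses eauto.
  - apply filter_forall. intros w. rewrite <- Hq. ring.
  - cut (clim (nearC z) (fun w => q w * (w - z) + f z)%C (l * (z - z) + f z)%C).
    { now replace (l * (z - z) + f z)%C with (f z) by ring. }
    apply clim_plus; [typeclasses eauto| |apply clim_const; typeclasses eauto].
    apply clim_mult; [typeclasses eauto|exact Hl|].
    apply clim_minus; [typeclasses eauto|apply clim_id | apply clim_const; typeclasses eauto].
Qed.

Lemma cder_id z : cder (fun w => w) z 1.
Proof.
  intros e He. exists 1. split; [lra|]. intros w _.
  replace (w - z - 1 * (w - z))%C with (RtoC 0) by ring. rewrite Cmod_0.
  apply Rmult_le_pos; [lra | apply Cmod_ge_0].
Qed.

Lemma cder_const c z : cder (fun _ => c) z 0.
Proof.
  intros e He. exists 1. split; [lra|]. intros w _.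
  replace (c - c - 0 * (w - z))%C with (RtoC 0) by ring. rewrite Cmod_0.
  apply Rmult_le_pos; [lra | apply Cmod_ge_0].
Qed.

Lemma cder_ext f g z l : (forall w, f w = g w) -> cder f z l -> cder g z l.
Proof.
  intros E H e He. destruct (H e He) as [d [Hd Hw]]. exists d. split; [exact Hd|].
  intros w. rewrite <- !E. apply Hw.
Qed.

Lemma cder_plus f g z l m : cder f z l -> cder g z m -> cder (fun w => f w + g w)%C z (l + m)%C.
Proof.
  rewrite !cder_slope. intros [q [Hq [Hl E]]] [p [Hp [Hm E']]].
  exists (fun w => q w + p w)%C. split; [|split].
  - intros w. replace (f w + g w - (f z + g z))%C with ((f w - f z) + (g w - g z))%C by ring.
    rewrite Hq, Hp. ring.
  - apply clim_plus; [typeclasses eauto|..]; assumption.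
  - now rewrite E, E'.
Qed.

Lemma cder_mult f g z l m :
  cder f z l -> cder g z m -> cder (fun w => f w * g w)%C z (l * g z + f z * m)%C.
Proof.
  intros Hf Hg. pose proof (cder_continuous _ _ _ Hg) as Hc. revert Hf Hg.
  rewrite !cder_slope. intros [q [Hq [Hl E]]] [p [Hp [Hm E']]].
  exists (fun w => q w * g w + f z * p w)%C. split; [|split].
  - intros w. replace (f w * g w - f z * g z)%C with ((f w - f z) * g w + f z * (g w - g z))%C by ring.
    rewrite Hq, Hp. ring.
  - apply clim_plus; [typeclasses eauto|..]; apply clim_mult; try typeclasses eauto; try assumption.
    apply clim_const; typeclasses eauto.
  - now rewrite E, E'.
Qed.

Lemma cder_comp f g z l m : cder g z m -> cder f (g z) l -> cder (fun w => f (g w)) z (l * m)%C.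
Proof.
  intros Hg Hf. pose proof (cder_continuous _ _ _ Hg) as Hc. revert Hf Hg.
  rewrite !cder_slope. intros [q [Hq [Hl E]]] [p [Hp [Hm E']]].
  exists (fun w => q (g w) * p w)%C. split; [|split].
  - intros w. rewrite Hq, Hp. ring.
  - apply clim_mult; [typeclasses eauto| |exact Hm]. apply clim_comp with (g z); [typeclasses eauto|..]; assumption.
  - now rewrite E, E'.
Qed.

Lemma cder_inv (z : C) : z <> 0 -> cder (fun w => / w)%C z (- (/ z * / z))%C.
Proof.
  intros Hz. 
  assert (Hc : clim (nearC z) (fun w => / w)%C (/ z)%C) by (apply clim_inv; [typeclasses eauto|assumption|apply clim_id]).
  intros e He.
  destruct (@filter_and C (nearC z) _ _ _ (clim_opp _ _ _ (clim_mult _ _ _ _ _ Hc (clim_const _ (/ z)%C)) e He)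
     (clim_id z (Cmod z) (proj1 (Cmod_gt_0 z) Hz))) as [d [Hd H]].
  exists d. split; [exact Hd|]. intros w Hw. destruct (H w Hw) as [H1 H2].
  assert (Hw0 : w <> 0).
  { intros ->. replace (0 - z)%C with (- z)%C in H2 by ring. rewrite Cmod_opp in H2. lra. }
  replace (/ w - / z - - (/ z * / z) * (w - z))%C with ((- (/ w * / z) - - (/ z * / z)) * (w - z))%C by (field; split; assumption).
  rewrite Cmod_mult. apply Rmult_le_compat_r; [apply Cmod_ge_0|]. left. exact H1.
Qed.

Lemma cder_square_bound (f : C -> C) z K r :
  0 < r -> f z = 0 -> (forall w, Cmod (w - z) < r -> Cmod (f w) <= K * Cmod (w - z) ^ 2) -> cder f z 0.
Proof.
  intros Hr Hz H e He.
  pose proof (Rabs_pos K). 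
  set (d := Rmin r (e / (Rabs K + 1))).
  exists d. split. { unfold d. apply Rmin_glb_lt; [exact Hr|]. apply Rdiv_lt_0_compat; lra. }
  intros w Hw. rewrite Hz. replace (f w - 0 - 0 * (w - z))%C with (f w) by ring.
  assert (H1 : Cmod (w - z) < r) by (eapply Rlt_le_trans; [exact Hw | apply Rmin_l]).
  assert (H2 : Cmod (w - z) < e / (Rabs K + 1)) by (eapply Rlt_le_trans; [exact Hw | apply Rmin_r]).
  eapply Rle_trans; [now apply H|]. pose proof (Cmod_ge_0 (w - z)).
  replace (K * Cmod (w - z) ^ 2) with (K * Cmod (w - z) * Cmod (w - z)) by ring.
  apply Rmult_le_compat_r; [assumption|].
  assert (Cmod (w - z) * (Rabs K + 1) < e).
  { apply Rmult_lt_compat_r with (r := Rabs K + 1) in H2; [|lra].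
    unfold Rdiv in H2. rewrite Rmult_assoc, Rinv_l, Rmult_1_r in H2; lra. }
  pose proof (Rle_abs K). nra.
Qed.

(** * Goursat's theorem *)

(* Complex differentiability of [F] at [x0 + i y0], with [F] a function of the real and imaginary parts. *)
Definition cder2 (F : R -> R -> C) (x0 y0 : R) (L : C) : Prop :=
  forall eps, 0 < eps -> exists d, 0 < d /\ forall x y,
    Rabs (x - x0) < d -> Rabs (y - y0) < d ->
    Cmod (F x y - F x0 y0 - L * (RtoC (x - x0) + Ci * RtoC (y - y0)))
      <= eps * (Rabs (x - x0) + Rabs (y - y0)).

Lemma Cmod_RI (x y : R) : Cmod (RtoC x + Ci * RtoC y) <= Rabs x + Rabs y.
Proof.
  eapply Rle_trans; [apply Cmod_triangle|]. rewrite Cmod_mult, Cmod_Ci, !Cmod_R. lra.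
Qed.

Lemma cder2_continuous F x0 y0 L :
  cder2 F x0 y0 L -> forall eps, 0 < eps -> exists d, 0 < d /\ forall x y,
    Rabs (x - x0) < d -> Rabs (y - y0) < d -> Cmod (F x y - F x0 y0) < eps.
Proof.
  intros H eps He. destruct (H 1 ltac:(lra)) as [d [Hd Hx]].
  pose proof (Cmod_ge_0 L).
  set (e := eps / (2 * (Cmod L + 2))).
  assert (He' : 0 < e) by (unfold e; apply Rdiv_lt_0_compat; lra).
  assert (He2 : 2 * e * (Cmod L + 2) = eps) by (unfold e; field; lra).
  exists (Rmin d e). split; [now apply Rmin_glb_lt|]. intros x y H1 H2.
  assert (H3 := Rlt_le_trans _ _ _ H1 (Rmin_l _ _)). assert (H4 := Rlt_le_trans _ _ _ H2 (Rmin_l _ _)).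
  assert (H5 := Rlt_le_trans _ _ _ H1 (Rmin_r _ _)). assert (H6 := Rlt_le_trans _ _ _ H2 (Rmin_r _ _)).
  specialize (Hx x y H3 H4).
  replace (F x y - F x0 y0)%C with ((F x y - F x0 y0 - L * (RtoC (x - x0) + Ci * RtoC (y - y0)))
    + L * (RtoC (x - x0) + Ci * RtoC (y - y0)))%C by ring.
  eapply Rle_lt_trans; [apply Cmod_triangle|]. rewrite (Cmod_mult L).
  pose proof (Cmod_RI (x - x0) (y - y0)).
  assert (Cmod L * Cmod (RtoC (x - x0) + Ci * RtoC (y - y0)) <= Cmod L * (2 * e)).
  { apply Rmult_le_compat_l; lra. }
  nra.
Qed.

Lemma continuous_C_R (g : R -> C) (x0 : R) :
  (forall eps, 0 < eps -> exists d, 0 < d /\ forall x, Rabs (x - x0) < d -> Cmod (g x - g x0) < eps) ->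
  @continuous R_UniformSpace C_R_CompleteNormedModule g x0.
Proof.
  intros H. apply (filterlim_locally (U := C_R_CompleteNormedModule)). intros eps.
  destruct (H eps (cond_pos eps)) as [d [Hd Hx]].
  exists (mkposreal d Hd). intros x Hxd. specialize (Hx x Hxd).
  pose proof (Rmax_Cmod (g x - g x0)%C) as Hm.
  split.
  - eapply Rle_lt_trans; [|exact Hx]. eapply Rle_trans; [|exact Hm]. apply Rmax_l.
  - eapply Rle_lt_trans; [|exact Hx]. eapply Rle_trans; [|exact Hm]. apply Rmax_r.
Qed.

Notation CInt := (@RInt C_R_CompleteNormedModule).
Notation ex_CInt := (@ex_RInt C_R_CompleteNormedModule).

Lemma CInt_bound (g : R -> C) a b M :
  a <= b -> ex_CInt g a b -> (forall x, a <= x <= b -> Cmod (g x) <= M) -> Cmod (CInt g a b) <= (b - a) * M.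
Proof.
  intros Hab Hex H. rewrite Cmod_norm.
  apply (norm_RInt_le_const (V := C_R_NormedModule) g a b); [exact Hab| |].
  - intros x Hx. pose proof (H x Hx) as HM. rewrite Cmod_norm in HM. exact HM.
  - apply (RInt_correct (V := C_R_CompleteNormedModule)). exact Hex.
Qed.

(** The contour integral along the boundary of [[a, b] x [c, d]], counterclockwise; [Ci] comes from
    [dz = i dy] on the vertical sides. *)
Definition bdry (F : R -> R -> C) (a b c d : R) : C :=
  (CInt (fun x => F x c) a b + Ci * CInt (fun y => F b y) c d
   - CInt (fun x => F x d) a b - Ci * CInt (fun y => F a y) c d)%C.

Definition cdiff_on (F : R -> R -> C) (a b c d : R) : Prop :=
  forall x y, a <= x <= b -> c <= y <= d -> exists L, cder2 F x y L.

Lemma cdiff_on_sub F a b c d a' b' c' d' :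
  a <= a' -> b' <= b -> c <= c' -> d' <= d -> cdiff_on F a b c d -> cdiff_on F a' b' c' d'.
Proof. intros ? ? ? ? H x y Hx Hy. apply H; lra. Qed.

Lemma cdiff_on_ex_h F a b c d y : cdiff_on F a b c d -> a <= b -> c <= y <= d -> ex_CInt (fun x => F x y) a b.
Proof.
  intros H Hab Hy. apply (ex_RInt_continuous (V := C_R_CompleteNormedModule)).
  intros x Hx. rewrite Rmin_left, Rmax_right in Hx by lra.
  apply (continuous_C_R (fun x => F x y)). intros eps He. destruct (H x y Hx Hy) as [L HL].
  destruct (cder2_continuous _ _ _ _ HL eps He) as [e [He' Hc]]. exists e. split; [exact He'|].
  intros x' Hx'. apply Hc; [exact Hx'|]. now rewrite Rminus_diag, Rabs_R0.
Qed.

Lemma cdiff_on_ex_v F a b c d x : cdiff_on F a b c d -> c <= d -> a <= x <= b -> ex_CInt (fun y => F x y) c d.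
Proof.
  intros H Hcd Hx. apply (ex_RInt_continuous (V := C_R_CompleteNormedModule)).
  intros y Hy. rewrite Rmin_left, Rmax_right in Hy by lra.
  apply (continuous_C_R (fun y => F x y)). intros eps He. destruct (H x y Hx Hy) as [L HL].
  destruct (cder2_continuous _ _ _ _ HL eps He) as [e [He' Hc]]. exists e. split; [exact He'|].
  intros y' Hy'. apply Hc; [|exact Hy']. now rewrite Rminus_diag, Rabs_R0.
Qed.

Lemma CInt_Chasles g a b c : ex_CInt g a b -> ex_CInt g b c -> CInt g a c = (CInt g a b + CInt g b c)%C.
Proof. intros H1 H2. symmetry. exact (RInt_Chasles (V := C_R_CompleteNormedModule) g a b c H1 H2). Qed.

Lemma CInt_minus g h a b : ex_CInt g a b -> ex_CInt h a b ->
  CInt (fun x => g x - h x)%C a b = (CInt g a b - CInt h a b)%C.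
Proof. intros H1 H2. exact (RInt_minus (V := C_R_CompleteNormedModule) g h a b H1 H2). Qed.

Lemma ex_CInt_minus g h a b : ex_CInt g a b -> ex_CInt h a b -> ex_CInt (fun x => g x - h x)%C a b.
Proof. intros H1 H2. exact (ex_RInt_minus (V := C_R_NormedModule) g h a b H1 H2). Qed.

Lemma CInt_const c a b : CInt (fun _ => c) a b = (RtoC (b - a) * c)%C.
Proof.
  rewrite (RInt_const (V := C_R_CompleteNormedModule)).
  destruct c as [u v]. unfold Cmult, RtoC; simpl. apply injective_projections; simpl; unfold scal; simpl; unfold mult; simpl; ring.
Qed.

Lemma ex_CInt_const c a b : ex_CInt (fun _ => c) a b.
Proof. apply (ex_RInt_const (V := C_R_NormedModule)). Qed.

Lemma bdry_split_h F a m b c d : a <= m <= b -> c <= d -> cdiff_on F a b c d ->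
  bdry F a b c d = (bdry F a m c d + bdry F m b c d)%C.
Proof.
  intros Hm Hcd H. unfold bdry.
  assert (H1 : cdiff_on F a m c d) by (revert H; apply cdiff_on_sub; lra).
  assert (H2 : cdiff_on F m b c d) by (revert H; apply cdiff_on_sub; lra).
  rewrite (CInt_Chasles (fun x => F x c) a m b), (CInt_Chasles (fun x => F x d) a m b);
    try (eapply cdiff_on_ex_h; [eassumption|lra|lra]).
  ring.
Qed.

Lemma bdry_split_v F a b c m d : a <= b -> c <= m <= d -> cdiff_on F a b c d ->
  bdry F a b c d = (bdry F a b c m + bdry F a b m d)%C.
Proof.
  intros Hab Hm H. unfold bdry.
  assert (H1 : cdiff_on F a b c m) by (revert H; apply cdiff_on_sub; lra).
  assert (H2 : cdiff_on F a b m d) by (revert H; apply cdiff_on_sub; lra).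
  rewrite (CInt_Chasles (fun y => F b y) c m d), (CInt_Chasles (fun y => F a y) c m d);
    try (eapply cdiff_on_ex_v; [eassumption|lra|lra]).
  ring.
Qed.

(** The affine part of [F] has contour integral 0. For the rest, opposite sides are paired: each
    difference is at most [2 eps D], with [D] the half perimeter, and is integrated over a total
    length [D]. *)
Lemma bdry_small F a b c d x0 y0 L eps :
  a <= b -> c <= d -> a <= x0 <= b -> c <= y0 <= d -> 0 <= eps -> cdiff_on F a b c d ->
  (forall x y, a <= x <= b -> c <= y <= d ->
    Cmod (F x y - F x0 y0 - L * (RtoC (x - x0) + Ci * RtoC (y - y0)))
      <= eps * (Rabs (x - x0) + Rabs (y - y0))) ->
  Cmod (bdry F a b c d) <= 2 * eps * (b - a + (d - c)) ^ 2.
Proof.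
  intros Hab Hcd Hx0 Hy0 He HF H.
  set (D := b - a + (d - c)).
  set (E := fun x y => (F x y - F x0 y0 - L * (RtoC (x - x0) + Ci * RtoC (y - y0)))%C).
  assert (HE : forall x y, a <= x <= b -> c <= y <= d -> Cmod (E x y) <= eps * D).
  { intros x y Hx Hy. eapply Rle_trans; [now apply H|]. apply Rmult_le_compat_l; [exact He|].
    unfold D. apply Rplus_le_compat; apply Rabs_le; lra. }
  assert (HE2 : forall x y x' y', a <= x <= b -> c <= y <= d -> a <= x' <= b -> c <= y' <= d ->
     Cmod (E x y - E x' y') <= 2 * (eps * D)).
  { intros x y x' y' Hx Hy Hx' Hy'. eapply Rle_trans; [apply Cmod_triangle|].
    rewrite Cmod_opp. pose proof (HE x y Hx Hy). pose proof (HE x' y' Hx' Hy'). lra. }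
  assert (E1 := cdiff_on_ex_h F a b c d c HF Hab ltac:(lra)).
  assert (E2 := cdiff_on_ex_h F a b c d d HF Hab ltac:(lra)).
  assert (E3 := cdiff_on_ex_v F a b c d a HF Hcd ltac:(lra)).
  assert (E4 := cdiff_on_ex_v F a b c d b HF Hcd ltac:(lra)).
  (* The differences of the affine part between opposite sides; they are constant, and their two
     contributions to the contour cancel. *)
  set (k1 := (- (L * Ci * RtoC (d - c)))%C). set (k2 := (L * RtoC (b - a))%C).
  assert (J : bdry F a b c d =
    (CInt (fun x => (F x c - F x d) - k1)%C a b + Ci * CInt (fun y => (F b y - F a y) - k2)%C c d)%C).
  { assert (E5 := ex_CInt_minus _ _ _ _ E1 E2). assert (E6 := ex_CInt_minus _ _ _ _ E4 E3).
    rewrite (CInt_minus _ _ _ _ E5 (ex_CInt_const k1 a b)), (CInt_minus _ _ _ _ E6 (ex_CInt_const k2 c d)).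
    rewrite (CInt_minus _ _ _ _ E1 E2), (CInt_minus _ _ _ _ E4 E3).
    rewrite !CInt_const. unfold bdry, k1, k2. ring. }
  rewrite J. eapply Rle_trans; [apply Cmod_triangle|]. rewrite Cmod_mult, Cmod_Ci, Rmult_1_l.
  assert (B1 : Cmod (CInt (fun x => (F x c - F x d) - k1)%C a b) <= (b - a) * (2 * (eps * D))).
  { apply CInt_bound; [exact Hab| |].
    - apply ex_CInt_minus; [apply ex_CInt_minus; assumption | apply ex_CInt_const].
    - intros x Hx. replace (F x c - F x d - k1)%C with (E x c - E x d)%C; [apply HE2; lra|].
      unfold E, k1. rewrite !RtoC_minus. ring. }
  assert (B2 : Cmod (CInt (fun y => (F b y - F a y) - k2)%C c d) <= (d - c) * (2 * (eps * D))).
  { apply CInt_bound; [exact Hcd| |].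
    - apply ex_CInt_minus; [apply ex_CInt_minus; assumption | apply ex_CInt_const].
    - intros y Hy. replace (F b y - F a y - k2)%C with (E b y - E a y)%C; [apply HE2; lra|].
      unfold E, k2. rewrite !RtoC_minus. ring. }
  unfold D in *. nra.
Qed.

Lemma nested_intervals (u v : nat -> R) :
  (forall n, u n <= u (S n)) -> (forall n, v (S n) <= v n) -> (forall n, u n <= v n) ->
  exists l, forall n, u n <= l <= v n.
Proof.
  intros Hu Hv Huv.
  assert (Mu : forall n k, u n <= u (n + k)%nat).
  { intros n k. induction k as [|k IH]; [rewrite Nat.add_0_r; lra|]. rewrite Nat.add_succ_r.
    specialize (Hu (n + k)%nat). lra. }
  assert (Mv : forall n k, v (n + k)%nat <= v n).
  { intros n k. induction k as [|k IH]; [rewrite Nat.add_0_r; lra|]. rewrite Nat.add_succ_r.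
    specialize (Hv (n + k)%nat). lra. }
  assert (Muv : forall n m, u n <= v m).
  { intros n m. specialize (Mu n m). specialize (Mv m n). rewrite Nat.add_comm in Mv.
    specialize (Huv (n + m)%nat). lra. }
  destruct (completeness (fun x => exists n, x = u n)) as [l [H1 H2]].
  - exists (v 0%nat). intros x [n ->]. apply Muv.
  - exists (u 0%nat), 0%nat. reflexivity.
  - exists l. intros n. split; [apply H1; now exists n|]. apply H2. intros x [m ->]. apply Muv.
Qed.

(** The contour integral is the sum of those of the four quarters, so they cannot all have modulus
    below a quarter of it. *)
Lemma bdry_quarter F x y h k K : 0 <= h -> 0 <= k -> cdiff_on F x (x + h) y (y + k) ->
  4 * K <= Cmod (bdry F x (x + h) y (y + k)) ->
  exists x' y', x <= x' /\ x' + h / 2 <= x + h /\ y <= y' /\ y' + k / 2 <= y + k /\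
    K <= Cmod (bdry F x' (x' + h / 2) y' (y' + k / 2)).
Proof.
  intros Hh Hk HF HK. apply NNPP. intros Hn.
  assert (Hlt : forall x' y', x <= x' -> x' + h / 2 <= x + h -> y <= y' -> y' + k / 2 <= y + k ->
    Cmod (bdry F x' (x' + h / 2) y' (y' + k / 2)) < K).
  { intros x' y' H1 H2 H3 H4. apply Rnot_le_lt. intros H5. apply Hn. exists x', y'. tauto. }
  assert (A1 := Hlt x y ltac:(lra) ltac:(lra) ltac:(lra) ltac:(lra)).
  assert (A2 := Hlt (x + h/2) y ltac:(lra) ltac:(lra) ltac:(lra) ltac:(lra)).
  assert (A3 := Hlt x (y + k/2) ltac:(lra) ltac:(lra) ltac:(lra) ltac:(lra)).
  assert (A4 := Hlt (x + h/2) (y + k/2) ltac:(lra) ltac:(lra) ltac:(lra) ltac:(lra)).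
  replace (x + h / 2 + h / 2) with (x + h) in * by field.
  replace (y + k / 2 + k / 2) with (y + k) in * by field.
  rewrite (bdry_split_h F x (x + h/2) (x + h)) in HK by (assumption || lra).
  rewrite (bdry_split_v F x (x + h/2) y (y + k/2) (y + k)) in HK
    by (lra || (revert HF; apply cdiff_on_sub; lra)).
  rewrite (bdry_split_v F (x + h/2) (x + h) y (y + k/2) (y + k)) in HK
    by (lra || (revert HF; apply cdiff_on_sub; lra)).
  pose proof (Cmod_triangle (bdry F x (x + h / 2) y (y + k / 2)) (bdry F x (x + h / 2) (y + k / 2) (y + k))).
  pose proof (Cmod_triangle (bdry F (x + h / 2) (x + h) y (y + k / 2)) (bdry F (x + h / 2) (x + h) (y + k / 2) (y + k))).
  match type of HK with _ <= Cmod (?u + ?v) => pose proof (Cmod_triangle u v) end.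
  lra.
Qed.

Lemma dependent_choice {T} (P : nat -> T -> Prop) (Q : nat -> T -> T -> Prop) (x0 : T) :
  P 0%nat x0 -> (forall n x, P n x -> exists y, P (S n) y /\ Q n x y) ->
  exists u : nat -> T, forall n, P n (u n) /\ Q n (u n) (u (S n)).
Proof.
  intros H0 H.
  set (step n (p : {x | P n x}) :=
    constructive_indefinite_description _ (H n (proj1_sig p) (proj2_sig p))).
  set (s := fix s n : {x | P n x} := match n with
    | O => exist _ x0 H0
    | S n => exist _ (proj1_sig (step n (s n))) (proj1 (proj2_sig (step n (s n))))
    end).
  exists (fun n => proj1_sig (s n)). intros n. split.
  - apply (proj2_sig (s n)).
  - exact (proj2 (proj2_sig (step n (s n)))).
Qed.

Theorem goursat F a b c d : a <= b -> c <= d -> cdiff_on F a b c d -> bdry F a b c d = 0.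
Proof.
  intros Hab Hcd HF. set (K := Cmod (bdry F a b c d)).
  set (small (n : nat) (p : R * R) :=
    a <= fst p /\ fst p + (b - a) / 2 ^ n <= b /\ c <= snd p /\ snd p + (d - c) / 2 ^ n <= d /\
    K / 4 ^ n <= Cmod (bdry F (fst p) (fst p + (b - a) / 2 ^ n) (snd p) (snd p + (d - c) / 2 ^ n))).
  set (inside (n : nat) (p q : R * R) :=
    fst p <= fst q /\ fst q + (b - a) / 2 ^ S n <= fst p + (b - a) / 2 ^ n /\
    snd p <= snd q /\ snd q + (d - c) / 2 ^ S n <= snd p + (d - c) / 2 ^ n).
  destruct (dependent_choice small inside (a, c)) as [p Hpp].
  { unfold small; simpl. unfold Rdiv. rewrite Rinv_1, !Rmult_1_r.
    replace (a + (b - a)) with b by ring. replace (c + (d - c)) with d by ring. unfold K. lra. }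
  { intros n p [H1 [H2 [H3 [H4 H5]]]].
    assert (P2 : 0 < 2 ^ n) by (apply pow_lt; lra). assert (P4 : 0 < 4 ^ n) by (apply pow_lt; lra).
    assert (E1 : (b - a) / 2 ^ S n = (b - a) / 2 ^ n / 2) by (simpl; field; lra).
    assert (E2 : (d - c) / 2 ^ S n = (d - c) / 2 ^ n / 2) by (simpl; field; lra).
    assert (E4 : K / 4 ^ n = 4 * (K / 4 ^ S n)) by (simpl; field; lra).
    assert (Q1 : 0 <= (b - a) / 2 ^ n) by (apply Rdiv_le_0_compat; lra).
    assert (Q2 : 0 <= (d - c) / 2 ^ n) by (apply Rdiv_le_0_compat; lra).
    rewrite E4 in H5. apply bdry_quarter in H5; [|exact Q1|exact Q2|revert HF; apply cdiff_on_sub; lra].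
    destruct H5 as [x' [y' [G1 [G2 [G3 [G4 G5]]]]]]. exists (x', y').
    unfold small, inside. simpl fst; simpl snd. rewrite E1, E2. repeat split; lra. }
  assert (Hp : forall n, small n (p n)) by (intros n; apply (Hpp n)).
  assert (Hin : forall n, inside n (p n) (p (S n))) by (intros n; apply (Hpp n)).
  assert (P2 : forall n, 0 < 2 ^ n) by (intros n; apply pow_lt; lra).
  destruct (nested_intervals (fun n => fst (p n)) (fun n => fst (p n) + (b - a) / 2 ^ n)) as [x0 Hx0].
  { intros n. apply (Hin n). } { intros n. apply (Hin n). }
  { intros n. assert (0 <= (b - a) / 2 ^ n) by (apply Rdiv_le_0_compat; [lra|apply P2]). lra. }
  destruct (nested_intervals (fun n => snd (p n)) (fun n => snd (p n) + (d - c) / 2 ^ n)) as [y0 Hy0].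
  { intros n. apply (Hin n). } { intros n. apply (Hin n). }
  { intros n. assert (0 <= (d - c) / 2 ^ n) by (apply Rdiv_le_0_compat; [lra|apply P2]). lra. }
  destruct (HF x0 y0) as [L HL].
  { specialize (Hx0 0%nat). destruct (Hp 0%nat) as [? [? _]]. simpl in *. lra. }
  { specialize (Hy0 0%nat). destruct (Hp 0%nat) as [_ [_ [? [? _]]]]. simpl in *. lra. }
  apply Cmod_eq_0. apply Rle_antisym; [|apply Cmod_ge_0].
  apply le_epsilon. intros e0 He0. rewrite Rplus_0_l.
  set (D := b - a + (d - c)). assert (HD : 0 <= D) by (unfold D; lra).
  (* Chosen so that [2 e D^2 <= e0]; [D + 1] rather than [D] because the rectangle may be
     degenerate. *)
  set (e := e0 / (2 * (D + 1) ^ 2)).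
  assert (He : 0 < e) by (unfold e; apply Rdiv_lt_0_compat; nra).
  destruct (HL e He) as [del [Hdel HLd]].
  (* The [n]-th rectangle has half perimeter [D / 2^n < del], so differentiability at [(x0, y0)]
     applies on all of it; the factors [4^n] in the lower and the upper bound then cancel. *)
  destruct (pow_lt_1_zero (1/2) ltac:(rewrite Rabs_pos_eq; lra) (del / (D + 1)) ltac:(apply Rdiv_lt_0_compat; lra)) as [n Hn].
  specialize (Hn n (Nat.le_refl n)). rewrite Rabs_pos_eq in Hn by (apply pow_le; lra).
  assert (E2 : (1/2) ^ n = / 2 ^ n) by (unfold Rdiv; rewrite Rmult_1_l, pow_inv; reflexivity).
  assert (HDn : D / 2 ^ n < del).
  { rewrite E2 in Hn. apply Rmult_lt_compat_r with (r := D + 1) in Hn; [|lra].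
    unfold Rdiv in Hn. rewrite (Rmult_assoc del), Rinv_l, Rmult_1_r in Hn by lra.
    assert (0 < / 2 ^ n) by (apply Rinv_0_lt_compat, P2). unfold Rdiv. nra. }
  destruct (Hp n) as [H1 [H2 [H3 [H4 H5]]]]. specialize (Hx0 n). specialize (Hy0 n). simpl in Hx0, Hy0.
  assert (Q1 : 0 <= (b - a) / 2 ^ n) by (apply Rdiv_le_0_compat; [lra|apply P2]).
  assert (Q2 : 0 <= (d - c) / 2 ^ n) by (apply Rdiv_le_0_compat; [lra|apply P2]).
  assert (QD : D / 2 ^ n = (b - a) / 2 ^ n + (d - c) / 2 ^ n) by (unfold D; field; apply Rgt_not_eq, P2).
  assert (B : Cmod (bdry F (fst (p n)) (fst (p n) + (b - a) / 2 ^ n) (snd (p n)) (snd (p n) + (d - c) / 2 ^ n))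
     <= 2 * e * (D / 2 ^ n) ^ 2).
  { eapply Rle_trans.
    - apply (bdry_small F _ _ _ _ x0 y0 L e); try lra.
      + revert HF. apply cdiff_on_sub; lra.
      + intros x y Hx Hy. apply HLd; apply Rabs_def1; lra.
    - right. rewrite QD. ring. }
  assert (P4 : 4 ^ n = 2 ^ n * 2 ^ n) by (rewrite <- Rpow_mult_distr; f_equal; lra).
  assert (P := P2 n).
  assert (B2 : K / 4 ^ n <= 2 * e * (D / 2 ^ n) ^ 2) by (eapply Rle_trans; eassumption).
  rewrite P4 in B2.
  apply Rmult_le_compat_r with (r := 2 ^ n * 2 ^ n) in B2; [|nra].
  replace (K / (2 ^ n * 2 ^ n) * (2 ^ n * 2 ^ n)) with K in B2 by (field; lra).
  replace (2 * e * (D / 2 ^ n) ^ 2 * (2 ^ n * 2 ^ n)) with (2 * e * D ^ 2) in B2 by (field; lra).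
  fold K. apply Rle_trans with (1 := B2).
  replace e0 with (2 * e * (D + 1) ^ 2) by (unfold e; field; lra).
  apply Rmult_le_compat_l; [lra|]. nra.
Qed.

(** * The maximum principle at the centre *)

Lemma cder2_comp f G x0 y0 l L :
  cder2 G x0 y0 L -> cder f (G x0 y0) l -> cder2 (fun x y => f (G x y)) x0 y0 (l * L).
Proof.
  intros HG Hf eps He.
  pose proof (Cmod_ge_0 l). pose proof (Cmod_ge_0 L).
  set (e2 := eps / (2 * (Cmod l + 1))).
  assert (He2 : 0 < e2) by (apply Rdiv_lt_0_compat; lra).
  assert (E2 : e2 * (Cmod l + 1) = eps / 2) by (unfold e2; field; lra).
  set (e1 := eps / (2 * (Cmod L + 1))).
  assert (He1 : 0 < e1) by (apply Rdiv_lt_0_compat; lra).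
  assert (E1 : e1 * (Cmod L + 1) = eps / 2) by (unfold e1; field; lra).
  destruct (Hf e1 He1) as [d1 [Hd1 H1]].
  (* The bound 1 makes the increment of [G] at most [(|L| + 1) N], which enters the error of [f];
     the bound [e2] controls the error of [G] after multiplication by [l]. *)
  destruct (HG (Rmin 1 e2) ltac:(apply Rmin_glb_lt; lra)) as [d2 [Hd2 H2]].
  destruct (cder2_continuous _ _ _ _ HG d1 Hd1) as [d3 [Hd3 H3]].
  exists (Rmin d2 d3). split; [now apply Rmin_glb_lt|]. intros x y Hx Hy.
  specialize (H2 x y (Rlt_le_trans _ _ _ Hx (Rmin_l _ _)) (Rlt_le_trans _ _ _ Hy (Rmin_l _ _))).
  specialize (H3 x y (Rlt_le_trans _ _ _ Hx (Rmin_r _ _)) (Rlt_le_trans _ _ _ Hy (Rmin_r _ _))).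
  specialize (H1 _ H3).
  pose proof (Cmod_RI (x - x0) (y - y0)) as HRI.
  set (w := (RtoC (x - x0) + Ci * RtoC (y - y0))%C) in *.
  set (N := Rabs (x - x0) + Rabs (y - y0)) in *.
  assert (HN : 0 <= N) by (unfold N; pose proof (Rabs_pos (x-x0)); pose proof (Rabs_pos (y-y0)); lra).
  assert (m1 : Rmin 1 e2 <= 1) by apply Rmin_l. assert (m2 : Rmin 1 e2 <= e2) by apply Rmin_r.
  assert (H2a : Cmod (G x y - G x0 y0 - L * w) <= e2 * N) by nra.
  assert (HG1 : Cmod (G x y - G x0 y0) <= (Cmod L + 1) * N).
  { replace (G x y - G x0 y0)%C with ((G x y - G x0 y0 - L * w) + L * w)%C by ring.
    eapply Rle_trans; [apply Cmod_triangle|]. rewrite (Cmod_mult L). nra. }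
  replace (f (G x y) - f (G x0 y0) - l * L * w)%C with
    ((f (G x y) - f (G x0 y0) - l * (G x y - G x0 y0)) + l * (G x y - G x0 y0 - L * w))%C by ring.
  eapply Rle_trans; [apply Cmod_triangle|]. rewrite (Cmod_mult l).
  assert (Cmod l * Cmod (G x y - G x0 y0 - L * w) <= Cmod l * (e2 * N)) by (apply Rmult_le_compat_l; lra).
  assert (e1 * Cmod (G x y - G x0 y0) <= e1 * ((Cmod L + 1) * N)) by (apply Rmult_le_compat_l; lra).
  assert (e1 * ((Cmod L + 1) * N) = eps / 2 * N) by (rewrite <- E1; ring).
  assert (Cmod l * (e2 * N) <= eps / 2 * N) by (rewrite <- E2; nra).
  lra.
Qed.

Definition cexp (x y : R) : C := (RtoC (exp x) * (cos y, sin y))%C.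

Lemma Cmod_cexp x y : Cmod (cexp x y) = exp x.
Proof.
  unfold cexp. rewrite Cmod_mult, Cmod_R, Rabs_pos_eq by (left; apply exp_pos).
  unfold Cmod; simpl fst; simpl snd. pose proof (sin2_cos2 y) as H. unfold Rsqr in H.
  replace (cos y ^ 2 + sin y ^ 2) with 1 by (rewrite <- H; ring). rewrite sqrt_1. ring.
Qed.

Lemma derivable_pt_lim_affine f l : derivable_pt_lim f 0 l -> forall eps, 0 < eps ->
  exists d, 0 < d /\ forall h, Rabs h < d -> Rabs (f h - f 0 - l * h) <= eps * Rabs h.
Proof.
  intros H eps He. destruct (H eps He) as [d Hd]. exists d. split; [apply d|].
  intros h Hh. destruct (Req_dec h 0) as [->|Hh0].
  - replace (f 0 - f 0 - l * 0) with 0 by ring. rewrite Rabs_R0. lra.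
  - specialize (Hd h Hh0 Hh). rewrite Rplus_0_l in Hd.
    replace (f h - f 0 - l * h) with (((f h - f 0) / h - l) * h) by (field; assumption).
    rewrite Rabs_mult. apply Rmult_le_compat_r; [apply Rabs_pos | lra].
Qed.

Lemma cder2_cexp x0 y0 : cder2 cexp x0 y0 (cexp x0 y0).
Proof.
  intros eps He. pose proof (exp_pos x0) as HE.
  (* The errors [B1] and [B2] below add up to at most [e (|h| + 5 |k|)]; 8 is a comfortable bound
     for 5. *)
  set (e := Rmin 1 (eps / (8 * exp x0))).
  assert (He1 : 0 < e) by (apply Rmin_glb_lt; [lra|]; apply Rdiv_lt_0_compat; lra).
  assert (He2 : e * (8 * exp x0) <= eps).
  { apply Rle_trans with (eps / (8 * exp x0) * (8 * exp x0)).
    - apply Rmult_le_compat_r; [lra|apply Rmin_r].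
    - right. field. lra. }
  assert (He3 : e <= 1) by apply Rmin_l.
  destruct (derivable_pt_lim_affine _ _ (derivable_pt_lim_exp 0) e He1) as [d1 [Hd1 H1]].
  destruct (derivable_pt_lim_affine _ _ (derivable_pt_lim_cos 0) e He1) as [d2 [Hd2 H2]].
  destruct (derivable_pt_lim_affine _ _ (derivable_pt_lim_sin 0) e He1) as [d3 [Hd3 H3]].
  exists (Rmin (Rmin d1 (e / 2)) (Rmin d2 d3)).
  split. { repeat apply Rmin_glb_lt; lra. }
  intros x y Hx Hy.
  assert (Ha1 : Rabs (x - x0) < d1) by (eapply Rlt_le_trans; [exact Hx|]; eapply Rle_trans; [apply Rmin_l|apply Rmin_l]).
  assert (Ha2 : Rabs (x - x0) < e / 2) by (eapply Rlt_le_trans; [exact Hx|]; eapply Rle_trans; [apply Rmin_l|apply Rmin_r]).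
  assert (Hb1 : Rabs (y - y0) < d2) by (eapply Rlt_le_trans; [exact Hy|]; eapply Rle_trans; [apply Rmin_r|apply Rmin_l]).
  assert (Hb2 : Rabs (y - y0) < d3) by (eapply Rlt_le_trans; [exact Hy|]; eapply Rle_trans; [apply Rmin_r|apply Rmin_r]).
  specialize (H1 _ Ha1). specialize (H2 _ Hb1). specialize (H3 _ Hb2).
  rewrite exp_0 in H1. rewrite cos_0, sin_0 in *.
  set (h := x - x0) in *. set (k := y - y0) in *.
  (* The functional equation factors out [cexp x0 y0], which leaves the derivative at 0. *)
  assert (E : (cexp x y - cexp x0 y0 - cexp x0 y0 * (RtoC h + Ci * RtoC k))%C =
    (cexp x0 y0 * (RtoC (exp h * cos k - 1 - h) + Ci * RtoC (exp h * sin k - k)))%C).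
  { unfold cexp. replace x with (x0 + h) by (unfold h; ring). replace y with (y0 + k) by (unfold k; ring).
    rewrite exp_plus, cos_plus, sin_plus.
    unfold Cminus, Cplus, Copp, Cmult, RtoC, Ci; simpl. apply injective_projections; simpl; ring. }
  rewrite E, Cmod_mult, Cmod_cexp.
  eapply Rle_trans; [apply Rmult_le_compat_l; [lra|apply Cmod_RI]|].
  pose proof (Rabs_pos h). pose proof (Rabs_pos k).
  assert (H4 : Rabs (exp h - 1) <= e).
  { replace (exp h - 1) with ((exp h - 1 - 1 * h) + h) by ring.
    eapply Rle_trans; [apply Rabs_triang|]. nra. }
  assert (H5 : exp h <= 2) by (pose proof (Rle_abs (exp h - 1)); lra).
  pose proof (exp_pos h).
  assert (B1 : Rabs (exp h * cos k - 1 - h) <= e * Rabs h + 2 * (e * Rabs k)).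
  { replace (exp h * cos k - 1 - h) with ((exp h - 1 - 1 * h) + exp h * (cos k - 1 - - 0 * k)) by ring.
    eapply Rle_trans; [apply Rabs_triang|]. apply Rplus_le_compat; [exact H1|].
    rewrite Rabs_mult, (Rabs_pos_eq (exp h)) by lra. apply Rmult_le_compat; try lra. apply Rabs_pos. }
  assert (B2 : Rabs (exp h * sin k - k) <= 2 * (e * Rabs k) + e * Rabs k).
  { replace (exp h * sin k - k) with (exp h * (sin k - 0 - 1 * k) + (exp h - 1) * k) by ring.
    eapply Rle_trans; [apply Rabs_triang|]. rewrite !Rabs_mult, (Rabs_pos_eq (exp h)) by lra.
    apply Rplus_le_compat; [apply Rmult_le_compat; try lra; apply Rabs_pos|].
    apply Rmult_le_compat_r; lra. }
  apply Rle_trans with (e * (8 * exp x0) * (Rabs h + Rabs k)).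
  - replace (e * (8 * exp x0) * (Rabs h + Rabs k)) with (exp x0 * (8 * (e * Rabs h) + 8 * (e * Rabs k))) by ring.
    apply Rmult_le_compat_l; [lra|].
    assert (0 <= e * Rabs h) by (apply Rmult_le_pos; lra).
    assert (0 <= e * Rabs k) by (apply Rmult_le_pos; lra). lra.
  - apply Rmult_le_compat_r; lra.
Qed.

Definition holo (f : C -> C) : Prop := forall z, inD z -> exists l, cder f z l.

(** Periodicity cancels the two horizontal sides of [[x1, x2] x [0, 2 pi]]. Hence the mean of [h] on
    the circle of radius [r] equals its mean on a circle so small that [h] is within [eps] of [h 0]
    there. *)
Lemma max_principle_0 (h : C -> C) r M :
  holo h -> 0 < r < 1 -> (forall z, Cmod z = r -> Cmod (h z) <= M) -> Cmod (h 0) <= M.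
Proof.
  intros Hh Hr HM.
  set (F := fun x y => h (cexp x y)).
  pose proof PI_RGT_0 as Hpi.
  apply le_epsilon. intros eps He.
  destruct (Hh 0) as [l Hl]. { unfold inD. rewrite Cmod_0. lra. }
  destruct (cder_continuous _ _ _ Hl eps He) as [d [Hd Hc]].
  set (x2 := ln r). set (x1 := Rmin (ln d - 1) x2).
  assert (H12 : x1 <= x2) by apply Rmin_r.
  assert (Ex2 : exp x2 = r) by (apply exp_ln; lra).
  assert (Ex1 : exp x1 < d).
  { rewrite <- (exp_ln d) by assumption. apply exp_increasing.
    assert (x1 <= ln d - 1) by apply Rmin_l. lra. }
  assert (HF : cdiff_on F x1 x2 0 (2 * PI)).
  { intros x y Hx _. destruct (Hh (cexp x y)) as [m Hm].
    - unfold inD. rewrite Cmod_cexp. apply Rle_lt_trans with r; [|lra]. rewrite <- Ex2.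
      destruct (proj2 Hx) as [Hlt| ->]; [left; now apply exp_increasing | lra].
    - exists (m * cexp x y)%C. apply (cder2_comp h cexp); [apply cder2_cexp | exact Hm]. }
  pose proof (goursat F x1 x2 0 (2 * PI) H12 ltac:(lra) HF) as G. unfold bdry in G.
  assert (Eper : (fun x => F x (2 * PI)) = (fun x => F x 0)).
  { apply FunctionalExtensionality.functional_extensionality. intros x. unfold F, cexp.
    now rewrite cos_2PI, sin_2PI, cos_0, sin_0. }
  rewrite Eper in G.
  assert (E1 := cdiff_on_ex_v F _ _ _ _ x1 HF ltac:(lra) ltac:(lra)).
  assert (E2 := cdiff_on_ex_v F _ _ _ _ x2 HF ltac:(lra) ltac:(lra)).
  assert (EQ : @eq C (CInt (fun y => F x1 y) 0 (2 * PI)) (CInt (fun y => F x2 y) 0 (2 * PI))).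
  { set (I1 := CInt (fun y => F x1 y) 0 (2 * PI)) in *. set (I2 := CInt (fun y => F x2 y) 0 (2 * PI)) in *.
    set (I0 := CInt (fun x => F x 0) x1 x2) in *.
    assert (HCi : Ci <> 0). { apply Cmod_gt_0. rewrite Cmod_Ci. lra. }
    replace I1 with (I2 - (I0 + Ci * I2 - I0 - Ci * I1) / Ci)%C by (field; assumption).
    rewrite G. field. assumption. }
  assert (B1 : Cmod (CInt (fun y => F x1 y - h 0)%C 0 (2 * PI)) <= (2 * PI - 0) * eps).
  { apply CInt_bound; [lra| apply ex_CInt_minus; [exact E1 | apply ex_CInt_const]|].
    intros y _. left. apply Hc. replace (cexp x1 y - 0)%C with (cexp x1 y) by ring. now rewrite Cmod_cexp. }
  assert (B2 : Cmod (CInt (fun y => F x2 y) 0 (2 * PI)) <= (2 * PI - 0) * M).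
  { apply CInt_bound; [lra | exact E2|]. intros y _. apply HM. now rewrite Cmod_cexp. }
  rewrite (CInt_minus _ _ _ _ E1 (ex_CInt_const _ _ _)), CInt_const, EQ in B1.
  set (I2 := CInt (fun y => F x2 y) 0 (2 * PI)) in *.
  assert (B3 : Cmod (RtoC (2 * PI - 0) * h 0) <= (2 * PI - 0) * M + (2 * PI - 0) * eps).
  { replace (RtoC (2 * PI - 0) * h 0)%C with (I2 + - (I2 - RtoC (2 * PI - 0) * h 0))%C by ring.
    eapply Rle_trans; [apply Cmod_triangle|]. rewrite Cmod_opp. lra. }
  rewrite Cmod_mult, Cmod_R, Rabs_pos_eq in B3 by lra.
  apply Rmult_le_reg_l with (2 * PI - 0); [lra|]. lra.
Qed.

(** * Automorphisms of the disc *)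

Definition mob (s z : C) : C := ((z - s) / (1 - Cconj s * z))%C.

Lemma Cmod_sqr (z : C) : Cmod z ^ 2 = fst z ^ 2 + snd z ^ 2.
Proof. exact (Cmod2_alt z). Qed.

Lemma Cmod_lt_sqr (u v : C) : Cmod u ^ 2 < Cmod v ^ 2 -> Cmod u < Cmod v.
Proof. intros H. apply Rnot_le_lt. intros Hlt. pose proof (Cmod_ge_0 u). pose proof (Cmod_ge_0 v). nra. Qed.

(** The homogeneous form of [mob_identity]. It makes the Pick inequality with [m = 1] a consequence
    of the two bounds on the moduli, see [spick_bdry]. *)
Lemma pick_identity (x y z w : C) :
  Cmod (Cconj x * w - Cconj z * y) ^ 2 - Cmod (z * w - y * x) ^ 2
  = (Cmod x ^ 2 - Cmod z ^ 2) * (Cmod w ^ 2 - Cmod y ^ 2).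
Proof. rewrite !Cmod_sqr. destruct x, y, z, w. simpl. ring. Qed.

Lemma mob_identity (s z : C) :
  Cmod (1 - Cconj s * z) ^ 2 - Cmod (z - s) ^ 2 = (1 - Cmod s ^ 2) * (1 - Cmod z ^ 2).
Proof. rewrite !Cmod_sqr. destruct s, z. simpl. ring. Qed.

Lemma mob_den (s z : C) : inD s -> Cmod z <= 1 -> (1 - Cconj s * z)%C <> 0.
Proof.
  unfold inD. intros Hs Hz E. 
  assert (H : Cmod (Cconj s * z) = 1).
  { replace (Cconj s * z)%C with (1 - (1 - Cconj s * z))%C by ring. rewrite E.
    replace (1 - 0)%C with (RtoC 1) by ring. apply Cmod_1. }
  rewrite Cmod_mult, Cmod_conj in H. pose proof (Cmod_ge_0 s). pose proof (Cmod_ge_0 z). nra.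
Qed.

Lemma mob_den_pos (s z : C) : inD s -> Cmod z <= 1 -> 0 < Cmod (1 - Cconj s * z).
Proof. intros Hs Hz. apply Cmod_gt_0. now apply mob_den. Qed.

Lemma Cmod_mob (s z : C) : inD s -> Cmod z <= 1 ->
  Cmod (mob s z) * Cmod (1 - Cconj s * z) = Cmod (z - s).
Proof.
  intros Hs Hz. pose proof (mob_den_pos s z Hs Hz). unfold mob. rewrite Cmod_div by now apply mob_den.
  field. lra.
Qed.

Lemma inD_mob (s z : C) : inD s -> inD z -> inD (mob s z).
Proof.
  unfold inD. intros Hs Hz. pose proof (mob_den_pos s z Hs (Rlt_le _ _ Hz)) as Hd.
  pose proof (Cmod_mob s z Hs (Rlt_le _ _ Hz)) as E. pose proof (mob_identity s z) as I.
  pose proof (Cmod_ge_0 s). pose proof (Cmod_ge_0 z). pose proof (Cmod_ge_0 (mob s z)).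
  apply Rnot_le_lt. intros Hge.
  assert (0 < (1 - Cmod s ^ 2) * (1 - Cmod z ^ 2)) by (apply Rmult_lt_0_compat; nra).
  assert (Cmod (1 - Cconj s * z) <= Cmod (z - s)) by nra.
  nra.
Qed.

Lemma Cmod_mob_bdry (s z : C) : inD s -> Cmod z = 1 -> Cmod (mob s z) = 1.
Proof.
  intros Hs Hz. pose proof (mob_den_pos s z Hs ltac:(lra)) as Hd.
  pose proof (Cmod_mob s z Hs ltac:(lra)) as E. pose proof (mob_identity s z) as I.
  rewrite Hz in I. pose proof (Cmod_ge_0 (z - s)).
  assert (Cmod (1 - Cconj s * z) = Cmod (z - s)) by nra.
  apply Rmult_eq_reg_r with (Cmod (1 - Cconj s * z)); lra.
Qed.

Lemma inD_opp (s : C) : inD s -> inD (- s)%C.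
Proof. unfold inD. now rewrite Cmod_opp. Qed.

Lemma mobK (s z : C) : inD s -> Cmod z <= 1 -> mob (- s) (mob s z) = z.
Proof.
  intros Hs Hz. unfold mob.
  pose proof (mob_den s z Hs Hz). pose proof (mob_den s s Hs (Rlt_le _ _ Hs)).
  rewrite Copp_conj. field. split; [assumption|].
  replace (1 - Cconj s * z - - Cconj s * (z - s))%C with (1 - Cconj s * s)%C by ring. assumption.
Qed.

Lemma mobVK (s z : C) : inD s -> Cmod z <= 1 -> mob s (mob (- s) z) = z.
Proof.
  intros Hs Hz. pose proof (mobK (- s) z (inD_opp s Hs) Hz) as H.
  now replace (- - s)%C with s in H by ring.
Qed.

Lemma mob_self (s : C) : mob s s = 0.
Proof. unfold mob, Cdiv. replace (s - s)%C with (RtoC 0) by ring. ring. Qed.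

Lemma mob_at_0 (s : C) : mob s 0 = (- s)%C.
Proof. unfold mob. replace (1 - Cconj s * 0)%C with (RtoC 1) by ring. field. Qed.

Lemma mob_neq0 (s z : C) : inD s -> Cmod z <= 1 -> z <> s -> mob s z <> 0.
Proof.
  intros Hs Hz Hne E. apply Hne. rewrite <- (mobK s z Hs Hz), E, mob_at_0. ring.
Qed.

Lemma Cmod_mob_sym (s z : C) : inD s -> inD z -> Cmod (mob s z) = Cmod (mob z s).
Proof.
  intros Hs Hz. unfold mob. rewrite !Cmod_div by (apply mob_den; (assumption || (now left))).
  f_equal.
  - rewrite <- Cmod_opp. f_equal. ring.
  - rewrite <- Cmod_conj. f_equal. rewrite Cminus_conj, Cmult_conj, Cconj_conj.
    replace (Cconj 1) with (RtoC 1); [ring|]. apply injective_projections; simpl; ring.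
Qed.

Lemma cder_mob (s z : C) : (1 - Cconj s * z)%C <> 0 -> exists l, cder (mob s) z l.
Proof.
  intros H. eexists. unfold mob, Cdiv. apply cder_mult.
  - apply cder_plus; [apply cder_id | apply cder_const].
  - apply (cder_comp (fun w => / w)%C (fun w => 1 - Cconj s * w)%C).
    + apply (cder_ext (fun w => 1 + (- Cconj s) * w)%C).
      { intros w. ring. }
      apply cder_plus; [apply cder_const|]. apply cder_mult; [apply cder_const | apply cder_id].
    + now apply cder_inv.
Qed.

Lemma cder_mob_D (s z : C) : inD s -> inD z -> exists l, cder (mob s) z l.
Proof. intros Hs Hz. apply cder_mob. apply mob_den; [exact Hs | now left]. Qed.

(** Functions here live in the open disc only, so the fact that [mob s] is unimodular on the circle
    is used through circles of radius slightly below 1. *)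
Lemma mob_near_bdry (s : C) (mu : R) : inD s -> 0 <= mu < 1 ->
  exists r0, 0 <= r0 < 1 /\ forall z, r0 < Cmod z < 1 -> mu < Cmod (mob s z).
Proof.
  intros Hs Hmu. unfold inD in Hs. pose proof (Cmod_ge_0 s).
  (* By [mob_identity], [1 - |mob s z|^2 <= (1 - |z|^2) / (1 - |s|)^2], and [1 - |z|^2 < 2 del] as
     soon as [|z| > 1 - del]. *)
  set (del := (1 - mu ^ 2) * (1 - Cmod s) ^ 2 / 2).
  assert (Hdel : 0 < del) by (unfold del; apply Rdiv_lt_0_compat; [apply Rmult_lt_0_compat; nra|lra]).
  assert (E : 2 * del = (1 - mu ^ 2) * (1 - Cmod s) ^ 2) by (unfold del; field).
  exists (1 - Rmin 1 del). 
  assert (M1 : Rmin 1 del <= 1) by apply Rmin_l. assert (M2 : Rmin 1 del <= del) by apply Rmin_r.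
  assert (M3 : 0 < Rmin 1 del) by (apply Rmin_glb_lt; lra).
  split; [lra|]. intros z Hz.
  assert (Hz1 : Cmod z <= 1) by lra.
  pose proof (Cmod_mob s z Hs Hz1) as EM. pose proof (mob_identity s z) as I.
  assert (D : 1 - Cmod s <= Cmod (1 - Cconj s * z)).
  { assert (1 <= Cmod (1 - Cconj s * z) + Cmod (Cconj s * z)).
    { rewrite <- Cmod_1 at 1. replace (RtoC 1) with ((1 - Cconj s * z) + Cconj s * z)%C at 1 by ring.
      apply Cmod_triangle. }
    rewrite Cmod_mult, Cmod_conj in *. nra. }
  set (X := Cmod (1 - Cconj s * z)) in *. set (B := Cmod (mob s z)) in *.
  assert (HB : 0 <= B) by apply Cmod_ge_0.
  rewrite <- EM in I.
  assert (I1 : X ^ 2 * (1 - B ^ 2) <= 1 - Cmod z ^ 2).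
  { replace (X ^ 2 * (1 - B ^ 2)) with ((1 - Cmod s ^ 2) * (1 - Cmod z ^ 2)) by (rewrite <- I; ring).
    assert (0 <= 1 - Cmod z ^ 2) by nra. assert (0 <= Cmod s ^ 2) by nra. nra. }
  assert (I2 : 1 - Cmod z ^ 2 < 2 * del) by nra.
  assert (I3 : (1 - Cmod s) ^ 2 <= X ^ 2) by nra.
  apply Rnot_le_lt. intros Hle.
  assert (1 - mu ^ 2 <= 1 - B ^ 2) by nra.
  assert ((1 - mu ^ 2) * (1 - Cmod s) ^ 2 <= (1 - B ^ 2) * X ^ 2) by (apply Rmult_le_compat; nra).
  lra.
Qed.

(** * The Schwarz-Pick lemma with exceptional points *)

Lemma clim_bounded {T} (F : (T -> Prop) -> Prop) {FF : Filter F} (u : T -> C) l :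
  clim F u l -> F (fun x => Cmod (u x) <= Cmod l + 1).
Proof.
  intros H. generalize (H 1 ltac:(lra)). apply filter_imp. intros x Hx.
  replace (u x) with (l + (u x - l))%C by ring.
  eapply Rle_trans; [apply Cmod_triangle|]. lra.
Qed.

Lemma clim_at_left (c : R) : clim (at_left c) (fun t => RtoC t) (RtoC c).
Proof.
  intros e He. exists (mkposreal e He). intros t Ht _. rewrite <- RtoC_minus, Cmod_R. exact Ht.
Qed.

Lemma at_left_lt (c : R) : at_left c (fun t => t < c).
Proof. exists (mkposreal 1 Rlt_0_1). auto. Qed.

Lemma at_left_gt (b c : R) : b < c -> at_left c (fun t => b < t).
Proof.
  intros H. exists (mkposreal (c - b) ltac:(lra)). intros t Ht _.
  apply Rabs_lt_between in Ht. unfold minus, plus, opp in Ht; simpl in Ht. lra.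
Qed.

Lemma inD_0 : inD 0.
Proof. unfold inD. rewrite Cmod_0. lra. Qed.

Lemma holo_near (P : C -> Prop) z : inD z -> (forall w, inD w -> P w) -> nearC z P.
Proof.
  unfold inD. intros Hz H. exists (1 - Cmod z). split; [lra|]. intros w Hw. apply H.
  replace w with (z + (w - z))%C by ring. eapply Rle_lt_trans; [apply Cmod_triangle|]. lra.
Qed.

(** A double factor absorbs every bounded irregularity of [g]: this is how [damped] becomes
    differentiable at its exceptional points. *)
Lemma cder_vanish (f g : C -> C) z K :
  nearC z (fun w => f w = g w * (w - z) ^ 2)%C -> nearC z (fun w => Cmod (g w) <= K) -> cder f z 0.
Proof.
  intros H1 H2. destruct (@filter_and C (nearC z) _ _ _ H1 H2) as [d [Hd H]].
  apply cder_square_bound with K d; [exact Hd| |].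
  - rewrite (nearC_self _ _ H1). ring.
  - intros w Hw. destruct (H w Hw) as [E Hg]. rewrite E, Cmod_mult, Cmod_pow.
    apply Rmult_le_compat_r; [|exact Hg]. apply pow_le, Cmod_ge_0.
Qed.

Lemma cder_pow f z l n : cder f z l -> exists m, cder (fun w => f w ^ n)%C z m.
Proof.
  intros H. induction n as [|n [m Hm]]; simpl.
  - exists 0. apply cder_const.
  - eexists. apply cder_mult; eassumption.
Qed.

Lemma Cpow_0_l n : n <> 0%nat -> (RtoC 0 ^ n)%C = 0.
Proof. intros H. destruct n; [easy|]. simpl. ring. Qed.

Lemma Cmod_Cinv_le (z : C) mu : 0 < mu -> mu <= Cmod z -> Cmod (/ z) <= / mu.
Proof.
  intros Hmu H. rewrite Cmod_inv by (apply Cmod_gt_0; lra). apply Rinv_le_contravar; lra.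
Qed.

Lemma Cmod_mob_le (q z : C) : inD q -> inD z -> Cmod (mob q z) <= 1.
Proof. intros Hq Hz. left. now apply inD_mob. Qed.

Lemma cder_exists_mult f g z : (exists l, cder f z l) -> (exists l, cder g z l) ->
  exists l, cder (fun w => f w * g w)%C z l.
Proof. intros [l Hl] [m Hm]. eexists. apply cder_mult; eassumption. Qed.

Lemma cder_exists_pow f z n : (exists l, cder f z l) -> exists l, cder (fun w => f w ^ n)%C z l.
Proof. intros [l Hl]. eapply cder_pow, Hl. Qed.

Lemma cder_exists_inv (f : C -> C) z : f z <> 0 -> (exists l, cder f z l) -> exists l, cder (fun w => / f w)%C z l.
Proof.
  intros Hz [l Hl]. eexists. apply (cder_comp (fun w => / w)%C f); [exact Hl | now apply cder_inv].
Qed.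

Lemma cder_exists_lim f z : (exists l, cder f z l) -> clim (nearC z) f (f z).
Proof. intros [l Hl]. eapply cder_continuous, Hl. Qed.

(** Models a quotient by Blaschke factors with zeros [s] and [t]. The bound is required at these
    points too, where the value is that of a division by 0. A single exceptional point is expressed
    by [s = t]. *)
Definition exc_disc (f : C -> C) (s t : C) : Prop :=
  (forall z, inD z -> Cmod (f z) <= 1) /\
  forall z, inD z -> z <> s -> z <> t -> exists l, cder f z l.

Lemma exc_disc_sym f s t : exc_disc f s t -> exc_disc f t s.
Proof. intros [H1 H2]. split; auto. Qed.

(* The factors at [s] and [t] make this holomorphic in the whole disc whatever [k] does there; being
   independent of [n], they disappear from the bound on [k / mob p] after taking n-th roots. *)
Definition damped (k : C -> C) (s t p : C) (n : nat) (z : C) : C :=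
  (k z ^ (n + 2) * (/ mob p z) ^ n * (mob s z ^ 2 * mob t z ^ 2))%C.

Lemma damped_cder_exc k s t p n : inD s -> inD t -> inD p -> p <> s -> exc_disc k s t ->
  cder (damped k s t p n) s 0.
Proof.
  intros Hs Ht Hp Hps [Hk _].
  (* The factors that are regular at [s], once [(w - s)^2] is taken out of [mob s w ^ 2]; the
     remaining [k w ^ (n + 2)] is merely bounded. *)
  set (Q := fun w => ((/ mob p w) ^ n * ((/ (1 - Cconj s * w)) ^ 2 * mob t w ^ 2))%C).
  assert (HQ : exists l, cder Q s l).
  { apply cder_exists_mult; [|apply cder_exists_mult]; apply cder_exists_pow.
    - apply cder_exists_inv; [|now apply cder_mob_D]. apply mob_neq0; [assumption|now left|congruence].
    - apply cder_exists_inv; [apply mob_den; [assumption|now left]|].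
      eexists. apply (cder_ext (fun w => 1 + (- Cconj s) * w)%C); [intros w; ring|].
      apply cder_plus; [apply cder_const|]. apply cder_mult; [apply cder_const | apply cder_id].
    - now apply cder_mob_D. }
  apply (cder_vanish _ (fun w => k w ^ (n + 2) * Q w)%C s (Cmod (Q s) + 1)).
  - apply filter_forall. intros w. unfold damped, Q. unfold mob at 2, Cdiv. ring.
  - generalize (@filter_and C (nearC s) _ _ _ (clim_bounded _ _ _ (cder_exists_lim _ _ HQ)) (holo_near _ _ Hs Hk)).
    apply filter_imp. intros w [H1 H2]. rewrite Cmod_mult, Cmod_pow.
    apply Rle_trans with (1 * Cmod (Q w)); [|lra].
    apply Rmult_le_compat_r; [apply Cmod_ge_0|].
    rewrite <- (pow1 (n + 2)). apply pow_incr. split; [apply Cmod_ge_0 | exact H2].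
Qed.

(** Since [k] vanishes at [p], [n] of its [n + 2] powers cancel the pole of [(/ mob p)^n], and the
    two others leave a double zero. *)
Lemma damped_cder_pole k s t p n : inD s -> inD t -> inD p -> p <> s -> p <> t -> exc_disc k s t ->
  k p = 0 -> cder (damped k s t p n) p 0.
Proof.
  intros Hs Ht Hp Hps Hpt [_ Hk] Hkp.
  destruct (Hk p Hp Hps Hpt) as [l Hl]. apply cder_slope in Hl. destruct Hl as [q [Hq [Hl _]]].
  set (Q := fun w => ((1 - Cconj p * w) ^ n * (mob s w ^ 2 * mob t w ^ 2))%C).
  assert (HQ : exists l, cder Q p l).
  { apply cder_exists_mult; [|apply cder_exists_mult]; apply cder_exists_pow; try now apply cder_mob_D.
    eexists. apply (cder_ext (fun w => 1 + (- Cconj p) * w)%C); [intros w; ring|].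
    apply cder_plus; [apply cder_const|]. apply cder_mult; [apply cder_const | apply cder_id]. }
  apply (cder_vanish _ (fun w => q w ^ (n + 2) * Q w)%C p (Cmod (l ^ (n + 2) * Q p) + 1)).
  - apply holo_near; [exact Hp|]. intros w Hw. 
    assert (Ek : k w = (q w * (w - p))%C) by (rewrite <- Hq, Hkp; ring).
    unfold damped, Q. rewrite Ek.
    (* At [p] no cancellation is possible, but both sides are 0 whatever the value of
       [/ mob p p]. *)
    destruct (excluded_middle_informative (w = p)) as [->|Hwp].
    + replace (q p * (p - p))%C with (RtoC 0) by ring. rewrite Cpow_0_l by lia. ring.
    + assert (Hd : (1 - Cconj p * w)%C <> 0) by (apply mob_den; [assumption|now left]).
      assert (Hwp' : (w - p)%C <> 0) by now apply Cminus_eq_contra.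
      unfold mob at 1. replace (/ ((w - p) / (1 - Cconj p * w)))%C with ((1 - Cconj p * w) * / (w - p))%C
        by (field; split; assumption).
      rewrite !Cpow_mult_l, !Cpow_add_r.
      assert (E : ((w - p) ^ n * (/ (w - p)) ^ n)%C = 1).
      { rewrite <- Cpow_mult_l, Cinv_r by assumption. apply Cpow_1_l. }
      transitivity (((w - p) ^ n * (/ (w - p)) ^ n) * (q w ^ n * q w ^ 2 * ((1 - Cconj p * w) ^ n * (mob s w ^ 2 * mob t w ^ 2)) * (w - p) ^ 2))%C; [ring|].
      rewrite E. ring.
  - apply clim_bounded; [typeclasses eauto|]. apply clim_mult; [typeclasses eauto| |now apply cder_exists_lim].
    apply clim_pow; [typeclasses eauto|assumption].
Qed.

Lemma damped_holo k s t p n : inD s -> inD t -> inD p -> p <> s -> p <> t -> exc_disc k s t ->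
  k p = 0 -> holo (damped k s t p n).
Proof.
  intros Hs Ht Hp Hps Hpt Hk Hkp z Hz.
  destruct (excluded_middle_informative (z = s)) as [->|Hzs].
  { exists 0. now apply damped_cder_exc. }
  destruct (excluded_middle_informative (z = t)) as [->|Hzt].
  { exists 0. apply (cder_ext (damped k t s p n)).
    - intros w. unfold damped. ring.
    - apply damped_cder_exc; try assumption. now apply exc_disc_sym. }
  destruct (excluded_middle_informative (z = p)) as [->|Hzp].
  { exists 0. now apply damped_cder_pole. }
  unfold damped. apply cder_exists_mult; apply cder_exists_mult; apply cder_exists_pow; try now apply cder_mob_D.
  - now apply (proj2 Hk).
  - apply cder_exists_inv; [|now apply cder_mob_D]. apply mob_neq0; [assumption|now left|assumption].
Qed.

Lemma schwarz_exc k s t p : inD s -> inD t -> inD p -> p <> s -> p <> t -> s <> 0 -> t <> 0 ->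
  exc_disc k s t -> k p = 0 -> Cmod (k 0) <= Cmod p.
Proof.
  intros Hs Ht Hp Hps Hpt Hs0 Ht0 Hk Hkp.
  destruct (excluded_middle_informative (p = 0)) as [Ep|Hp0].
  { rewrite Ep in Hkp. rewrite Hkp, Cmod_0. apply Cmod_ge_0. }
  apply Rnot_lt_le. intros Hlt. assert (Hpp : 0 < Cmod p) by now apply Cmod_gt_0.
  set (x := Cmod (k 0)) in *. set (y := Cmod p) in *.
  assert (Hx1 : x <= 1) by (apply (proj1 Hk), inD_0).
  (* The midpoint of [y / x] and 1, so that [rho = x mu / y] exceeds 1. The bound on [damped] at 0
     then reads [c rho^n <= 1] for all [n], which is absurd. *)
  set (mu := (1 + y / x) / 2).
  assert (Hyx : 0 < y / x < 1).
  { split; [apply Rdiv_lt_0_compat; lra|]. apply Rmult_lt_reg_r with x; [lra|].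
    unfold Rdiv. rewrite Rmult_assoc, Rinv_l by lra. lra. }
  assert (Hmu : 0 < mu < 1) by (unfold mu; lra).
  set (rho := x * mu / y).
  assert (Hrho : 1 < rho).
  { unfold rho. apply Rmult_lt_reg_r with y; [lra|]. replace (x * mu / y * y) with (x * mu) by (field; lra).
    replace (x * mu) with ((x + y) / 2) by (unfold mu; field; lra). lra. }
  (* The part of [|damped k s t p n 0|] that does not depend on [n]; it is positive because [s] and
     [t] are not 0. *)
  set (c := x ^ 2 * (Cmod s ^ 2 * Cmod t ^ 2)).
  assert (Hc : 0 < c).
  { unfold c. apply Cmod_gt_0 in Hs0, Ht0. repeat apply Rmult_lt_0_compat; try apply pow_lt; lra. }
  destruct (mob_near_bdry p mu Hp ltac:(lra)) as [r0 [Hr0 Hr]].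
  assert (B : forall n, c * rho ^ n <= 1).
  { intros n.
    assert (H : Cmod (damped k s t p n 0) <= (/ mu) ^ n).
    { apply max_principle_0 with ((1 + r0) / 2); [now apply damped_holo|lra|].
      intros z Hz. assert (HzD : inD z) by (unfold inD; lra).
      specialize (Hr z ltac:(lra)). unfold damped. rewrite !Cmod_mult, !Cmod_pow.
      replace ((/ mu) ^ n) with (1 ^ (n + 2) * (/ mu) ^ n * (1 ^ 2 * 1 ^ 2)) by (rewrite pow1; ring).
      assert (Q : forall a b m, 0 <= a <= b -> 0 <= a ^ m <= b ^ m).
      { intros a b m Hab. split; [apply pow_le; lra | now apply pow_incr]. }
      assert (Q1 := Q _ _ (n + 2)%nat (conj (Cmod_ge_0 _) (proj1 Hk z HzD))).
      assert (Q2 := Q _ _ n (conj (Cmod_ge_0 _) (Cmod_Cinv_le (mob p z) mu ltac:(lra) ltac:(lra)))).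
      assert (Q3 := Q _ _ 2%nat (conj (Cmod_ge_0 _) (Cmod_mob_le s z Hs HzD))).
      assert (Q4 := Q _ _ 2%nat (conj (Cmod_ge_0 _) (Cmod_mob_le t z Ht HzD))).
      apply Rmult_le_compat; [apply Rmult_le_pos|apply Rmult_le_pos|apply Rmult_le_compat|apply Rmult_le_compat]; lra. }
    unfold damped in H. rewrite !Cmod_mult, !Cmod_pow, !mob_at_0 in H.
    rewrite Cmod_inv in H by (intros E; apply Hp0; replace p with (- - p)%C by ring; rewrite E; ring).
    rewrite !Cmod_opp in H. fold x y in H.
    assert (E : c * rho ^ n = x ^ (n + 2) * (/ y) ^ n * (Cmod s ^ 2 * Cmod t ^ 2) * mu ^ n).
    { unfold c, rho, Rdiv. rewrite !Rpow_mult_distr, pow_add. ring. }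
    rewrite E. replace 1 with ((/ mu) ^ n * mu ^ n).
    - apply Rmult_le_compat_r; [apply pow_le; lra | exact H].
    - rewrite <- Rpow_mult_distr, Rinv_l, pow1 by lra. reflexivity. }
  destruct (Pow_x_infinity rho ltac:(rewrite Rabs_pos_eq; lra) (2 / c)) as [N HN].
  specialize (HN N (Nat.le_refl N)). rewrite Rabs_pos_eq in HN by (apply pow_le; lra).
  specialize (B N).
  assert (c * (2 / c) <= c * rho ^ N) by (apply Rmult_le_compat_l; lra).
  replace (c * (2 / c)) with 2 in * by (field; lra). lra.
Qed.

Lemma Cmod_mob_eq (w v : C) : inD w -> Cmod v <= 1 ->
  Cmod (v - w) = Cmod (mob w v) * Cmod (1 - Cconj w * v).
Proof. intros Hw Hv. symmetry. now apply Cmod_mob. Qed.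

Lemma schwarz_pick_0 f s t p : inD s -> inD t -> inD p -> p <> s -> p <> t -> s <> 0 -> t <> 0 ->
  exc_disc f s t -> Cmod (f 0 - f p) <= Cmod p * Cmod (1 - Cconj (f p) * f 0).
Proof.
  intros Hs Ht Hp Hps Hpt Hs0 Ht0 [Hf1 Hf2].
  (* The values of [f] may have modulus 1, where [mob] is degenerate: scale [f] by [rho < 1]. *)
  assert (H : forall rho, 0 <= rho < 1 ->
    Cmod (RtoC rho * f 0 - RtoC rho * f p) <= Cmod p * Cmod (1 - Cconj (RtoC rho * f p) * (RtoC rho * f 0))).
  { intros rho Hrho.
    assert (Hin : forall z, inD z -> inD (RtoC rho * f z)).
    { intros z Hz. unfold inD. rewrite Cmod_mult, Cmod_R, Rabs_pos_eq by lra.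
      specialize (Hf1 z Hz). pose proof (Cmod_ge_0 (f z)). nra. }
    set (w := (RtoC rho * f p)%C).
    rewrite (Cmod_mob_eq w) by (try apply Hin; try assumption; left; apply Hin, inD_0).
    apply Rmult_le_compat_r; [apply Cmod_ge_0|].
    apply (schwarz_exc (fun z => mob w (RtoC rho * f z)) s t p); try assumption.
    - split.
      + intros z Hz. left. apply inD_mob; apply Hin; assumption.
      + intros z Hz Hzs Hzt. destruct (Hf2 z Hz Hzs Hzt) as [l Hl].
        destruct (cder_mob_D w (RtoC rho * f z)) as [m Hm]; [now apply Hin|now apply Hin|].
        eexists. apply (cder_comp (mob w) (fun z => RtoC rho * f z)%C); [|exact Hm].
        apply cder_mult; [apply cder_const | exact Hl].
    - apply mob_self. }
  assert (L : forall c, clim (at_left 1) (fun rho => RtoC rho * c)%C c).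
  { intros c. cut (clim (at_left 1) (fun rho => RtoC rho * c)%C (1 * c)%C); [now rewrite Cmult_1_l|].
    apply clim_mult; [typeclasses eauto|apply clim_at_left|apply clim_const; typeclasses eauto]. }
  apply (rlim_le (at_left 1) (fun rho => Cmod (RtoC rho * f 0 - RtoC rho * f p))
    (fun rho => Cmod p * Cmod (1 - Cconj (RtoC rho * f p) * (RtoC rho * f 0)))).
  - apply rlim_Cmod; [typeclasses eauto|]. apply clim_minus; [typeclasses eauto|apply L|apply L].
  - apply rlim_mult; [typeclasses eauto|apply rlim_const; typeclasses eauto|].
    apply rlim_Cmod; [typeclasses eauto|]. apply clim_minus; [typeclasses eauto|apply clim_const; typeclasses eauto|].
    apply clim_mult; [typeclasses eauto| |apply L]. apply clim_conj; [typeclasses eauto|apply L].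
  - generalize (@filter_and R (at_left 1) _ _ _ (at_left_gt 0 1 Rlt_0_1) (at_left_lt 1)).
    apply filter_imp. intros rho Hrho. apply H. lra.
Qed.

(** Stated with the denominator cleared, to cover values of modulus 1. Precomposition with
    [mob (- q)] moves [q] to 0, and the exceptional points to points other than 0 since [q] is
    neither of them. *)
Theorem schwarz_pick f s t p q : inD s -> inD t -> inD p -> inD q ->
  p <> s -> p <> t -> q <> s -> q <> t -> exc_disc f s t ->
  Cmod (f q - f p) <= Cmod (mob q p) * Cmod (1 - Cconj (f p) * f q).
Proof.
  intros Hs Ht Hp Hq Hps Hpt Hqs Hqt [Hf1 Hf2].
  assert (Hq' := inD_opp q Hq).
  assert (K : forall z, inD z -> mob (- q) (mob q z) = z) by (intros z Hz; apply mobK; [assumption|now left]).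
  assert (Inj : forall x y, inD x -> inD y -> x <> y -> mob q x <> mob q y).
  { intros x y Hx Hy Hxy E. apply Hxy. now rewrite <- (K x Hx), <- (K y Hy), E. }
  pose proof (schwarz_pick_0 (fun z => f (mob (- q) z)) (mob q s) (mob q t) (mob q p)) as H.
  simpl in H. rewrite (K p Hp), mob_at_0 in H. replace (- - q)%C with q in H by ring.
  apply H; try (apply inD_mob; assumption); try (now apply Inj).
  - rewrite <- (mob_self q). apply Inj; congruence.
  - rewrite <- (mob_self q). apply Inj; congruence.
  - assert (Hne : forall z x, inD z -> inD x -> z <> mob q x -> mob (- q) z <> x).
    { intros z x Hz Hx Hzx E. apply Hzx. rewrite <- E. symmetry. apply mobVK; [assumption|now left]. }
    split.
    + intros z Hz. apply Hf1. now apply inD_mob.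
    + intros z Hz Hzs Hzt. 
      destruct (Hf2 (mob (- q) z)) as [l Hl]; [now apply inD_mob|now apply Hne|now apply Hne|].
      destruct (cder_mob_D (- q) z Hq' Hz) as [m Hm].
      eexists. apply (cder_comp f (mob (- q))); eassumption.
Qed.

(** * Two-point Pick conditions *)

(** One of 0, 1/2, 1/3 avoids both points. It serves as a dummy exceptional point in
    [schwarz_pick_holo] and as an auxiliary node in [comp2_bounds]. *)
Lemma exists_third_point (p q : C) : exists s, inD s /\ p <> s /\ q <> s.
Proof.
  assert (H : forall x : R, 0 <= x < 1 -> inD x).
  { intros x Hx. unfold inD. rewrite Cmod_R, Rabs_pos_eq; lra. }
  assert (N : forall x y : R, x <> y -> RtoC x <> RtoC y).
  { intros x y Hxy E. apply Hxy. now apply RtoC_inj. }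
  destruct (classic (p <> RtoC 0 /\ q <> RtoC 0)) as [[]|H0]; [exists (RtoC 0); split; [apply H; lra|auto]|].
  destruct (classic (p <> RtoC (1/2) /\ q <> RtoC (1/2))) as [[]|H1]; [exists (RtoC (1/2)); split; [apply H; lra|auto]|].
  exists (RtoC (1/3)). split; [apply H; lra|].
  assert (N1 := N 0 (1/2) ltac:(lra)). assert (N2 := N 0 (1/3) ltac:(lra)). assert (N3 := N (1/2) (1/3) ltac:(lra)).
  destruct (classic (p = RtoC 0)) as [->|]; destruct (classic (q = RtoC 0)) as [->|]; try tauto.
  - destruct (classic (q = RtoC (1/2))) as [->|]; tauto.
  - destruct (classic (p = RtoC (1/2))) as [->|]; tauto.
Qed.

Definition holo1 (f : C -> C) : Prop := holo f /\ forall z, inD z -> Cmod (f z) <= 1.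

Lemma schwarz_pick_holo f p q : holo1 f -> inD p -> inD q ->
  Cmod (f q - f p) <= Cmod (mob q p) * Cmod (1 - Cconj (f p) * f q).
Proof.
  intros [H1 H2] Hp Hq. destruct (exists_third_point p q) as [s [Hs [Hps Hqs]]].
  apply (schwarz_pick f s s p q); try assumption. split; auto.
Qed.

Lemma Cinv_0 : (/ RtoC 0)%C = 0.
Proof. unfold Cinv, RtoC; simpl. apply injective_projections; simpl; unfold Rdiv; ring. Qed.

Lemma Cmod_div_le (x y : C) : Cmod x <= Cmod y -> Cmod (x / y) <= 1.
Proof.
  intros H. destruct (classic (y = RtoC 0)) as [->|Hy].
  - unfold Cdiv. rewrite Cinv_0, Cmult_0_r, Cmod_0. lra.
  - rewrite Cmod_div by assumption. apply Cmod_gt_0 in Hy.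
    apply Rmult_le_reg_r with (Cmod y); [lra|]. unfold Rdiv. rewrite Rmult_assoc, Rinv_l; lra.
Qed.

Lemma cder_div_mob f s z : inD s -> inD z -> z <> s -> (exists l, cder f z l) ->
  exists l, cder (fun w => f w / mob s w)%C z l.
Proof.
  intros Hs Hz Hzs Hf. apply cder_exists_mult; [exact Hf|].
  apply cder_exists_inv; [|now apply cder_mob_D]. apply mob_neq0; [assumption|now left|assumption].
Qed.

(* At [s] the quotient is [f s / 0], which is 0. *)
Lemma exc_div f s : holo1 f -> inD s -> f s = 0 -> exc_disc (fun z => f z / mob s z)%C s s.
Proof.
  intros Hf Hs Hfs. split.
  - intros q Hq. apply Cmod_div_le.
    pose proof (schwarz_pick_holo f s q Hf Hs Hq) as H. rewrite Hfs in H.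
    replace (f q - 0)%C with (f q) in H by ring.
    replace (1 - Cconj 0 * f q)%C with (RtoC 1) in H.
    + rewrite Cmod_1, Rmult_1_r in H. now rewrite (Cmod_mob_sym s q).
    + replace (Cconj 0) with (RtoC 0) by (apply injective_projections; simpl; ring). ring.
  - intros z Hz Hzs _. apply cder_div_mob; try assumption. now apply (proj1 Hf).
Qed.

Lemma exc_div2 g s t : inD s -> inD t -> t <> s -> exc_disc g s s -> g s = 0 -> g t = 0 ->
  exc_disc (fun z => g z / mob t z)%C s t.
Proof.
  intros Hs Ht Hts Hg Hgs Hgt. split.
  - intros q Hq. apply Cmod_div_le.
    destruct (classic (q = s)) as [->|Hqs]; [rewrite Hgs, Cmod_0; apply Cmod_ge_0|].
    pose proof (schwarz_pick g s s t q Hs Hs Ht Hq Hts Hts Hqs Hqs Hg) as H. rewrite Hgt in H.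
    replace (g q - 0)%C with (g q) in H by ring.
    replace (1 - Cconj 0 * g q)%C with (RtoC 1) in H.
    + rewrite Cmod_1, Rmult_1_r in H. now rewrite (Cmod_mob_sym t q).
    + replace (Cconj 0) with (RtoC 0) by (apply injective_projections; simpl; ring). ring.
  - intros z Hz Hzs Hzt. apply cder_div_mob; try assumption. now apply (proj2 Hg).
Qed.

(** Here the zero of [g] is also its exceptional point, where the Schwarz-Pick lemma does not apply.
    It is applied at points [p t] tending to [s] in the real direction, and [g -> 0] allows passing
    to the limit. *)
Lemma exc_div_double g s : inD s -> exc_disc g s s -> g s = 0 -> clim (nearC s) g 0 ->
  exc_disc (fun z => g z / mob s z)%C s s.
Proof.
  intros Hs Hg Hgs Hlim. split.
  - intros q Hq. apply Cmod_div_le.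
    destruct (classic (q = s)) as [->|Hqs]; [rewrite Hgs, Cmod_0; apply Cmod_ge_0|].
    rewrite (Cmod_mob_sym s q Hs Hq).
    set (p := fun t : R => (s + (1 - RtoC t))%C).
    assert (Lp : clim (at_left 1) p s).
    { cut (clim (at_left 1) p (s + (1 - 1))%C). { now replace (s + (1 - 1))%C with s by ring. }
      apply clim_plus; [typeclasses eauto|apply clim_const; typeclasses eauto|].
      apply clim_minus; [typeclasses eauto|apply clim_const; typeclasses eauto|apply clim_at_left]. }
    assert (Lg : clim (at_left 1) (fun t => g (p t)) 0) by (apply (clim_comp (at_left 1) p g s); assumption).
    assert (Hd := mob_den q s Hq (Rlt_le _ _ Hs)).
    assert (Lm : clim (at_left 1) (fun t => mob q (p t)) (mob q s)).
    { unfold mob. apply clim_div; [typeclasses eauto|assumption| |].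
      - apply clim_minus; [typeclasses eauto|assumption|apply clim_const; typeclasses eauto].
      - apply clim_minus; [typeclasses eauto|apply clim_const; typeclasses eauto|].
        apply clim_mult; [typeclasses eauto|apply clim_const; typeclasses eauto|assumption]. }
    replace (Cmod (g q)) with (Cmod (g q - 0)) by (f_equal; ring).
    replace (Cmod (mob q s)) with (Cmod (mob q s) * Cmod (1 - Cconj 0 * g q)).
    2:{ replace (Cconj 0) with (RtoC 0) by (apply injective_projections; simpl; ring).
        replace (1 - 0 * g q)%C with (RtoC 1) by ring. rewrite Cmod_1. ring. }
    apply (rlim_le (at_left 1) (fun t => Cmod (g q - g (p t)))
      (fun t => Cmod (mob q (p t)) * Cmod (1 - Cconj (g (p t)) * g q))).
    + apply rlim_Cmod; [typeclasses eauto|].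
      apply clim_minus; [typeclasses eauto|apply clim_const; typeclasses eauto|assumption].
    + apply rlim_mult; [typeclasses eauto|now apply rlim_Cmod; [typeclasses eauto|]|].
      apply rlim_Cmod; [typeclasses eauto|].
      apply clim_minus; [typeclasses eauto|apply clim_const; typeclasses eauto|].
      apply clim_mult; [typeclasses eauto| |apply clim_const; typeclasses eauto].
      apply clim_conj; [typeclasses eauto|assumption].
    + generalize (@filter_and R (at_left 1) _ _ _ (at_left_lt 1) (Lp (1 - Cmod s) ltac:(unfold inD in Hs; lra))).
      apply filter_imp. intros t [Ht Hpt].
      assert (Hps : p t <> s).
      { unfold p. intros E. assert (E1 : (1 - RtoC t)%C = 0) by (replace (1 - RtoC t)%C with ((s + (1 - RtoC t)) - s)%C by ring; rewrite E; ring).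
        rewrite <- RtoC_minus in E1. apply RtoC_inj in E1. lra. }
      apply (schwarz_pick g s s); try assumption.
      unfold inD. replace (p t) with (s + (p t - s))%C by ring.
      eapply Rle_lt_trans; [apply Cmod_triangle|]. lra.
  - intros z Hz Hzs _. apply cder_div_mob; try assumption. now apply (proj2 Hg).
Qed.

Lemma clim_div_mob_double (f : C -> C) s : inD s -> f s = 0 -> cder f s 0 ->
  clim (nearC s) (fun z => f z / mob s z)%C 0.
Proof.
  intros Hs Hfs Hd eps He. destruct (Hd (eps / 4) ltac:(lra)) as [d [Hd0 H]].
  assert (N : nearC s (fun w => Cmod (w - s) < d /\ inD w)).
  { apply filter_and; [exists d; auto|]. apply holo_near; auto. }
  revert N. apply filter_imp. intros w [Hwd Hw]. specialize (H w Hwd). rewrite Hfs in H.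
  replace (f w - 0 - 0 * (w - s))%C with (f w) in H by ring.
  replace (f w / mob s w - 0)%C with (f w / mob s w)%C by ring.
  destruct (classic (w = s)) as [->|Hws].
  - rewrite mob_self. unfold Cdiv. rewrite Cinv_0, Cmult_0_r, Cmod_0. exact He.
  - assert (M0 : mob s w <> 0) by (apply mob_neq0; [assumption|now left|assumption]).
    rewrite Cmod_div by assumption. pose proof (Cmod_mob s w Hs (Rlt_le _ _ Hw)) as E.
    assert (D : Cmod (1 - Cconj s * w) <= 2).
    { eapply Rle_trans; [apply Cmod_triangle|]. rewrite Cmod_opp, Cmod_1, Cmod_mult, Cmod_conj.
      unfold inD in *.
      assert (Cmod s * Cmod w <= 1 * 1) by (apply Rmult_le_compat; try apply Cmod_ge_0; lra). lra. }
    apply Cmod_gt_0 in M0. apply Rmult_lt_reg_r with (Cmod (mob s w)); [assumption|].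
    unfold Rdiv. rewrite Rmult_assoc, Rinv_l, Rmult_1_r by lra. rewrite <- E in H.
    assert (Cmod (mob s w) * Cmod (1 - Cconj s * w) <= Cmod (mob s w) * 2) by (apply Rmult_le_compat_l; lra).
    assert (0 < eps * Cmod (mob s w)) by (apply Rmult_lt_0_compat; lra).
    assert (eps / 4 * (Cmod (mob s w) * Cmod (1 - Cconj s * w)) <= eps / 4 * (Cmod (mob s w) * 2))
      by (apply Rmult_le_compat_l; lra).
    lra.
Qed.

(* Solvability of [g 0 * S = Z], [g p * W = A] with [|p| = m] and [g] bounded by 1, with the
   denominators cleared. *)
Definition pick_cond (Z A S W : C) (m : R) : Prop :=
  Cmod Z <= Cmod S /\ Cmod A <= Cmod W /\
  Cmod (Z * W - A * S) <= m * Cmod (Cconj S * W - Cconj Z * A).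

(** The Schwarz-Pick inequality for [G], multiplied by [Cmod (S * W)]. *)
Lemma pick_of_exc G s t p q Z A S W : inD s -> inD t -> inD p -> inD q ->
  p <> s -> p <> t -> q <> s -> q <> t -> exc_disc G s t ->
  (G q * S)%C = Z -> (G p * W)%C = A -> pick_cond Z A S W (Cmod (mob q p)).
Proof.
  intros Hs Ht Hp Hq Hps Hpt Hqs Hqt HG <- <-.
  assert (B : forall z T, inD z -> Cmod (G z * T) <= Cmod T).
  { intros z T Hz. rewrite Cmod_mult. pose proof (proj1 HG z Hz). pose proof (Cmod_ge_0 T). nra. }
  split; [now apply B|split; [now apply B|]].
  pose proof (schwarz_pick G s t p q Hs Ht Hp Hq Hps Hpt Hqs Hqt HG) as H.
  replace (G q * S * W - G p * W * S)%C with ((G q - G p) * (S * W))%C by ring.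
  replace (Cmod (Cconj S * W - Cconj (G q * S) * (G p * W))) with (Cmod (1 - Cconj (G p) * G q) * Cmod (S * W)).
  - rewrite Cmod_mult, <- Rmult_assoc. apply Rmult_le_compat_r; [apply Cmod_ge_0|exact H].
  - rewrite Cmult_conj. replace (Cconj S * W - Cconj (G q) * Cconj S * (G p * W))%C with
      ((1 - Cconj (G q) * G p) * (Cconj S * W))%C by ring.
    rewrite (Cmod_mult (1 - Cconj (G q) * G p)), !(Cmod_mult _ W), Cmod_conj. f_equal.
    rewrite <- Cmod_conj. f_equal. rewrite Cminus_conj, Cmult_conj, Cconj_conj.
    replace (Cconj 1) with (RtoC 1); [ring|]. apply injective_projections; simpl; ring.
Qed.

Lemma mob_0_l z : mob 0 z = z.
Proof.
  unfold mob. replace (Cconj 0) with (RtoC 0) by (apply injective_projections; simpl; ring).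
  replace (1 - 0 * z)%C with (RtoC 1) by ring. field.
Qed.

(** Applied to [f] divided by its two Blaschke factors. Their product has the value [s * t] at 0,
    the two signs cancelling. *)
Lemma pick_of_zeros f (s t p : C) : holo1 f -> inD s -> inD t -> inD p -> s <> t ->
  s <> 0 -> t <> 0 -> p <> s -> p <> t -> f s = 0 -> f t = 0 ->
  pick_cond (f 0) (f p) (s * t) (mob s p * mob t p) (Cmod p).
Proof.
  intros Hf Hs Ht Hp Hst Hs0 Ht0 Hps Hpt Hfs Hft.
  assert (E : exc_disc (fun z => f z / mob s z / mob t z)%C s t).
  { apply exc_div2; try assumption; try congruence.
    - now apply exc_div.
    - rewrite mob_self. unfold Cdiv. rewrite Cinv_0. ring.
    - rewrite Hft. unfold Cdiv. ring. }
  rewrite <- (mob_0_l p) at 4.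
  apply (pick_of_exc (fun z => f z / mob s z / mob t z)%C s t); try assumption; try congruence.
  - apply inD_0.
  - rewrite !mob_at_0. field. split; assumption.
  - field. split; apply mob_neq0; try assumption; now left.
Qed.

Lemma pick_of_double_zero f (s p : C) : holo1 f -> inD s -> inD p -> 
  s <> 0 -> p <> s -> f s = 0 -> cder f s 0 ->
  pick_cond (f 0) (f p) (s * s) (mob s p * mob s p) (Cmod p).
Proof.
  intros Hf Hs Hp Hs0 Hps Hfs Hd.
  assert (E : exc_disc (fun z => f z / mob s z / mob s z)%C s s).
  { apply exc_div_double; try assumption.
    - now apply exc_div.
    - rewrite mob_self. unfold Cdiv. rewrite Cinv_0. ring.
    - now apply clim_div_mob_double. }
  rewrite <- (mob_0_l p) at 4.
  apply (pick_of_exc (fun z => f z / mob s z / mob s z)%C s s); try assumption; try congruence.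
  - apply inD_0.
  - rewrite !mob_at_0. field. assumption.
  - field. apply mob_neq0; try assumption; now left.
Qed.

(** With [u = Z / S] and [v = A / W] the last inequality says [|mob u v| <= |p|]. Hence [z -> tau z]
    with [|tau| <= 1] takes [p] to [mob u v], and the automorphism [mob (- u)] takes 0 to [u] and
    [mob u v] to [v]. *)
Lemma pick_solve (Z A S W p : C) : inD p -> p <> 0 -> Cmod Z < Cmod S -> Cmod A < Cmod W ->
  Cmod (Z * W - A * S) <= Cmod p * Cmod (Cconj S * W - Cconj Z * A) ->
  exists g, holo1 g /\ (g 0 * S)%C = Z /\ (g p * W)%C = A.
Proof.
  intros Hp Hp0 HZ HA H.
  pose proof (Cmod_ge_0 Z). pose proof (Cmod_ge_0 A).
  assert (HS : S <> 0) by (apply Cmod_gt_0; lra). assert (HW : W <> 0) by (apply Cmod_gt_0; lra).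
  assert (Lt : forall x y : C, y <> 0 -> Cmod x < Cmod y -> inD (x / y)).
  { intros x y Hy Hxy. unfold inD. rewrite Cmod_div by assumption. apply Cmod_gt_0 in Hy.
    apply Rmult_lt_reg_r with (Cmod y); [lra|]. unfold Rdiv. rewrite Rmult_assoc, Rinv_l; lra. }
  set (u := (Z / S)%C). set (v := (A / W)%C).
  assert (Hu : inD u) by now apply Lt. assert (Hv : inD v) by now apply Lt.
  set (tau := (mob u v / p)%C).
  assert (Htau : Cmod tau <= 1).
  { apply Cmod_div_le. pose proof (mob_den_pos u v Hu (Rlt_le _ _ Hv)) as D.
    apply Rmult_le_reg_r with (Cmod (1 - Cconj u * v)); [exact D|].
    rewrite Cmod_mob by (try assumption; now left).
    assert (HSW : 0 < Cmod (S * W)) by (apply Cmod_gt_0; now apply Cmult_neq_0).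
    apply Rmult_le_reg_r with (Cmod (S * W)); [exact HSW|].
    rewrite <- Cmod_mult. replace ((v - u) * (S * W))%C with (- (Z * W - A * S))%C by (unfold u, v; field; split; assumption).
    rewrite Cmod_opp. eapply Rle_trans; [exact H|]. rewrite Rmult_assoc. apply Rmult_le_compat_l; [apply Cmod_ge_0|].
    right. rewrite (Cmod_mult S W), <- (Cmod_conj S), <- !Cmod_mult. f_equal.
    unfold u, v. rewrite Cdiv_conj by assumption. field. split; [assumption|].
    intros E. apply HS. rewrite <- (Cconj_conj S), E. apply injective_projections; simpl; ring. }
  assert (Ht : forall z, inD z -> inD (tau * z)).
  { intros z Hz. unfold inD in *. rewrite Cmod_mult. pose proof (Cmod_ge_0 z). pose proof (Cmod_ge_0 tau). nra. }
  exists (fun z => mob (- u) (tau * z)). split; [split|split].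
  - intros z Hz. destruct (cder_mob_D (- u) (tau * z) (inD_opp _ Hu) (Ht z Hz)) as [l Hl].
    eexists. apply (cder_comp (mob (- u)) (fun z => tau * z)%C); [|exact Hl].
    apply cder_mult; [apply cder_const|apply cder_id].
  - intros z Hz. left. apply inD_mob; [now apply inD_opp | now apply Ht].
  - rewrite Cmult_0_r, mob_at_0. unfold u. field. assumption.
  - replace (tau * p)%C with (mob u v) by (unfold tau; field; assumption).
    rewrite mobK by (try assumption; now left). unfold v. field. assumption.
Qed.

(** * Competitors *)

(** Admissibility of the parameters, separated from the sum of logarithms: the infima are compared
    through products of moduli, which need no special case for a parameter equal to 0. *)
Definition comp3 (a b e z1 z2 s1 s2 s3 : C) : Prop :=
  exists phi1 phi2, hol_disc phi1 phi2 /\ phi1 0 = z1 /\ phi2 0 = z2 /\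
    inD s1 /\ inD s2 /\ inD s3 /\
    phi1 s1 = a /\ phi2 s1 = 0 /\ phi1 s2 = b /\ phi2 s2 = 0 /\ phi1 s3 = b /\ phi2 s3 = e.

Definition comp2 (a b z1 z2 s1 s2 : C) : Prop :=
  exists phi1 phi2, hol_disc phi1 phi2 /\ phi1 0 = z1 /\ phi2 0 = z2 /\
    inD s1 /\ inD s2 /\ phi1 s1 = a /\ phi2 s1 = 0 /\ phi1 s2 = b /\ phi2 s2 = 0.

Definition compV (a b z1 z2 s1 s2 : C) : Prop :=
  exists phi1 phi2, hol_disc phi1 phi2 /\ phi1 0 = z1 /\ phi2 0 = z2 /\
    inD s1 /\ inD s2 /\ phi1 s1 = a /\ phi2 s1 = 0 /\ phi1 s2 = b /\ phi2 s2 = 0 /\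
    C_has_deriv phi1 s2 0.

Lemma comp3_comp2 a b e z1 z2 s1 s2 s3 : comp3 a b e z1 z2 s1 s2 s3 -> comp2 a b z1 z2 s1 s2.
Proof. intros [p1 [p2 H]]. exists p1, p2. tauto. Qed.

Lemma holo_on_D_holo f : holo_on_D f <-> holo f.
Proof.
  split; intros H z Hz; destruct (H z Hz) as [l Hl]; exists l; now apply C_has_deriv_cder.
Qed.

Lemma holo1_mob b f : inD b -> holo f -> (forall z, inD z -> inD (f z)) -> holo1 (fun z => mob b (f z)).
Proof.
  intros Hb Hf Hin. split.
  - intros z Hz. destruct (Hf z Hz) as [l Hl]. destruct (cder_mob_D b (f z) Hb (Hin z Hz)) as [m Hm].
    eexists. eapply (cder_comp (mob b) f); eassumption.
  - intros z Hz. left. apply inD_mob; auto.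
Qed.

Lemma hol_disc_holo1 p1 p2 b : inD b -> hol_disc p1 p2 -> holo1 (fun z => mob b (p1 z)) /\ holo1 p2.
Proof.
  intros Hb [H1 [H2 H3]]. rewrite holo_on_D_holo in H1, H2. split.
  - apply holo1_mob; try assumption. intros z Hz. now apply H3.
  - split; [assumption|]. intros z Hz. left. now apply H3.
Qed.

(** The three parameters play different roles in the two components: after [mob b] the first has
    zeros [s2], [s3] and a value at [s1], the second has zeros [s1], [s2] and the value [e] at
    [s3]. *)
Lemma comp3_pick (a b e z1 z2 s1 s2 s3 : C) : inD b -> a <> b -> e <> 0 -> s1 <> 0 -> s2 <> 0 -> s3 <> 0 ->
  comp3 a b e z1 z2 s1 s2 s3 ->
  pick_cond (mob b z1) (mob b a) (s2 * s3) (mob s2 s1 * mob s3 s1) (Cmod s1) /\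
  pick_cond z2 e (s1 * s2) (mob s1 s3 * mob s2 s3) (Cmod s3).
Proof.
  intros Hb Hab He H1 H2 H3 [p1 [p2 [Hp [E1 [E2 [D1 [D2 [D3 [A1 [A2 [B1 [B2 [C1 C2]]]]]]]]]]]]].
  destruct (hol_disc_holo1 p1 p2 b Hb Hp) as [F1 F2].
  assert (N12 : s1 <> s2) by congruence. assert (N13 : s1 <> s3) by congruence.
  assert (N23 : s2 <> s3) by congruence. split.
  - rewrite <- E1, <- A1.
    apply (pick_of_zeros (fun z => mob b (p1 z))); try assumption; rewrite ?B1, ?C1; apply mob_self.
  - rewrite <- E2, <- C2. apply (pick_of_zeros p2); try assumption; congruence.
Qed.

Lemma compV_pick (a b z1 z2 s1 s2 : C) : inD b -> a <> b -> s1 <> 0 -> s2 <> 0 ->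
  compV a b z1 z2 s1 s2 ->
  inD s1 /\ inD s2 /\
  pick_cond (mob b z1) (mob b a) (s2 * s2) (mob s2 s1 * mob s2 s1) (Cmod s1).
Proof.
  intros Hb Hab H1 H2 [p1 [p2 [Hp [E1 [E2 [D1 [D2 [A1 [A2 [B1 [B2 B3]]]]]]]]]]].
  destruct (hol_disc_holo1 p1 p2 b Hb Hp) as [F1 F2].
  assert (N12 : s1 <> s2) by congruence. split; [assumption|split; [assumption|]].
  rewrite <- E1, <- A1.
  apply (pick_of_double_zero (fun z => mob b (p1 z))); try assumption.
  - rewrite B1. apply mob_self.
  - apply C_has_deriv_cder in B3.
    destruct (cder_mob_D b (p1 s2) Hb) as [l Hl]; [now apply Hp|].
    rewrite <- (Cmult_0_r l). exact (cder_comp (mob b) p1 s2 l 0 B3 Hl).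
Qed.

Lemma compV_comp2 a b z1 z2 s1 s2 : compV a b z1 z2 s1 s2 -> comp2 a b z1 z2 s1 s2.
Proof. intros [p1 [p2 H]]. exists p1, p2. tauto. Qed.

Lemma schwarz_pick_val (f : C -> C) p q : holo1 f -> inD p -> inD q -> f p = 0 -> Cmod (f q) <= Cmod (mob p q).
Proof.
  intros Hf Hp Hq Hfp. pose proof (schwarz_pick_holo f p q Hf Hp Hq) as H. rewrite Hfp in H.
  replace (f q - 0)%C with (f q) in H by ring.
  replace (1 - Cconj 0 * f q)%C with (RtoC 1) in H.
  - rewrite Cmod_1, Rmult_1_r in H. now rewrite (Cmod_mob_sym p q).
  - replace (Cconj 0) with (RtoC 0) by (apply injective_projections; simpl; ring). ring.
Qed.

(** The Schwarz lemma, for the second component with its two zeros and for the first one moved by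
    automorphisms so as to vanish at [s2], respectively at [s1]. *)
Lemma comp2_bounds a b z1 z2 s1 s2 : inD a -> inD b -> a <> b -> comp2 a b z1 z2 s1 s2 ->
  Cmod z2 <= Cmod s1 * Cmod s2 /\ Cmod (mob b z1) <= Cmod s2 /\
  Cmod (mob (mob b a) (mob b z1)) <= Cmod s1.
Proof.
  intros Ha Hb Hab [p1 [p2 [Hp [E1 [E2 [D1 [D2 [A1 [A2 [B1 B2]]]]]]]]]].
  destruct (hol_disc_holo1 p1 p2 b Hb Hp) as [F1 F2].
  assert (F3 : holo1 (fun z => mob (mob b a) (mob b (p1 z)))).
  { apply (holo1_mob (mob b a) (fun z => mob b (p1 z))); [now apply inD_mob|apply F1|].
    intros z Hz. apply inD_mob; [assumption|now apply Hp]. }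
  assert (N12 : s1 <> s2) by congruence. repeat split.
  - destruct (classic (s1 = 0)) as [->|H1].
    { assert (z2 = 0) as -> by congruence. rewrite Cmod_0. lra. }
    destruct (classic (s2 = 0)) as [->|H2].
    { assert (z2 = 0) as -> by congruence. rewrite Cmod_0. lra. }
    (* Only the bound at 0 in [pick_cond] is wanted, and it does not involve the auxiliary node
       [p]. *)
    destruct (exists_third_point s1 s2) as [p [Hpd [Hp1 Hp2]]].
    destruct (pick_of_zeros p2 s1 s2 p) as [HZ _]; try assumption; try congruence.
    now rewrite E2, Cmod_mult in HZ.
  - rewrite <- E1, <- (Cmod_opp s2), <- mob_at_0.
    apply (schwarz_pick_val (fun z => mob b (p1 z))); [assumption|assumption|apply inD_0|]. rewrite B1. apply mob_self.
  - rewrite <- E1, <- (Cmod_opp s1), <- mob_at_0.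
    apply (schwarz_pick_val (fun z => mob (mob b a) (mob b (p1 z)))); [assumption|assumption|apply inD_0|]. rewrite A1. apply mob_self.
Qed.

(** The open counterpart of [pick_cond]: stable under perturbation ([spick_lim]) and sufficient for
    [pick_solve]. *)
Definition spick (Z A S W : C) (m : R) : Prop :=
  Cmod Z < Cmod S /\ Cmod A < Cmod W /\
  Cmod (Z * W - A * S) < m * Cmod (Cconj S * W - Cconj Z * A).

Lemma inD_mult_l u v : inD u -> Cmod v <= 1 -> inD (u * v).
Proof.
  unfold inD. intros Hu Hv. rewrite Cmod_mult. pose proof (Cmod_ge_0 u). pose proof (Cmod_ge_0 v). nra.
Qed.

Lemma blaschke2 g s t : inD s -> inD t -> holo1 g ->
  holo (fun z => mob s z * (mob t z * g z))%C /\ (forall z, inD z -> inD (mob s z * (mob t z * g z))).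
Proof.
  intros Hs Ht [Hg1 Hg2]. split.
  - intros z Hz. apply cder_exists_mult; [now apply cder_mob_D|]. apply cder_exists_mult; [now apply cder_mob_D|].
    now apply Hg1.
  - intros z Hz. apply inD_mult_l; [now apply inD_mob|]. left. apply inD_mult_l; [now apply inD_mob|]. now apply Hg2.
Qed.

Lemma holo_mob_comp b f : inD b -> holo f -> (forall z, inD z -> inD (f z)) ->
  holo (fun z => mob b (f z)) /\ (forall z, inD z -> inD (mob b (f z))).
Proof.
  intros Hb Hf Hin. split; [apply holo1_mob; assumption|]. intros z Hz. apply inD_mob; auto.
Qed.

(** Undoes the divisions of [comp3_pick]: the solutions of the two Pick problems are multiplied by
    the Blaschke factors, and [mob (- b)] moves the zeros of the first component back to [b]. *)
Lemma pick_comp3 (a b e z1 z2 s1 s2 s3 : C) : inD a -> inD b -> inD z1 -> inD s1 -> inD s2 -> inD s3 ->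
  s1 <> 0 -> s3 <> 0 ->
  spick (mob b z1) (mob b a) (s2 * s3) (mob s2 s1 * mob s3 s1) (Cmod s1) ->
  spick z2 e (s1 * s2) (mob s1 s3 * mob s2 s3) (Cmod s3) ->
  comp3 a b e z1 z2 s1 s2 s3.
Proof.
  intros Ha Hb Hz1 D1 D2 D3 N1 N3 [P1 [P2 P3]] [Q1 [Q2 Q3]].
  destruct (pick_solve _ _ _ _ s1 D1 N1 P1 P2 (Rlt_le _ _ P3)) as [g [Hg [G0 G1]]].
  destruct (pick_solve _ _ _ _ s3 D3 N3 Q1 Q2 (Rlt_le _ _ Q3)) as [h [Hh [K0 K3]]].
  destruct (blaschke2 g s2 s3 D2 D3 Hg) as [F1 F2].
  destruct (blaschke2 h s1 s2 D1 D2 Hh) as [F3 F4].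
  destruct (holo_mob_comp (- b) _ (inD_opp b Hb) F1 F2) as [F5 F6].
  assert (Kb : forall x, inD x -> mob (- b) (mob b x) = x) by (intros x Hx; apply mobK; [assumption|now left]).
  assert (M0 : mob (- b) 0 = b) by (rewrite mob_at_0; ring).
  exists (fun z => mob (- b) (mob s2 z * (mob s3 z * g z))), (fun z => (mob s1 z * (mob s2 z * h z))%C).
  split; [split; [|split]|].
  - now apply holo_on_D_holo.
  - now apply holo_on_D_holo.
  - intros z Hz. split; [now apply F6 | now apply F4].
  - repeat split; try assumption.
    + rewrite !mob_at_0. replace (- s2 * (- s3 * g 0))%C with (g 0 * (s2 * s3))%C by ring. rewrite G0. now apply Kb.
    + rewrite !mob_at_0. replace (- s1 * (- s2 * h 0))%C with (h 0 * (s1 * s2))%C by ring. exact K0.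
    + replace (mob s2 s1 * (mob s3 s1 * g s1))%C with (g s1 * (mob s2 s1 * mob s3 s1))%C by ring. rewrite G1. now apply Kb.
    + rewrite mob_self. ring.
    + rewrite mob_self, Cmult_0_l. exact M0.
    + rewrite mob_self. ring.
    + rewrite mob_self, Cmult_0_l, Cmult_0_r. exact M0.
    + replace (mob s1 s3 * (mob s2 s3 * h s3))%C with (h s3 * (mob s1 s3 * mob s2 s3))%C by ring. exact K3.
Qed.

Lemma pick_compV (a b z1 z2 s1 s2 : C) : inD a -> inD b -> inD z1 -> inD s1 -> inD s2 -> s1 <> 0 ->
  spick (mob b z1) (mob b a) (s2 * s2) (mob s2 s1 * mob s2 s1) (Cmod s1) ->
  Cmod z2 < Cmod (s1 * s2) ->
  compV a b z1 z2 s1 s2.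
Proof.
  intros Ha Hb Hz1 D1 D2 N1 [P1 [P2 P3]] Q.
  destruct (pick_solve _ _ _ _ s1 D1 N1 P1 P2 (Rlt_le _ _ P3)) as [g [Hg [G0 G1]]].
  (* The second component has no value to take besides [z2] and its zeros, so a constant multiple of
     the Blaschke product suffices. *)
  set (c := (z2 / (s1 * s2))%C).
  assert (N12 : (s1 * s2)%C <> 0) by (apply Cmod_gt_0; pose proof (Cmod_ge_0 z2); lra).
  assert (Hc : holo1 (fun _ => c)).
  { split; [intros z Hz; exists 0; apply cder_const|]. intros z Hz. apply Cmod_div_le. lra. }
  destruct (blaschke2 g s2 s2 D2 D2 Hg) as [F1 F2].
  destruct (blaschke2 (fun _ => c) s1 s2 D1 D2 Hc) as [F3 F4].
  destruct (holo_mob_comp (- b) _ (inD_opp b Hb) F1 F2) as [F5 F6].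
  assert (Kb : forall x, inD x -> mob (- b) (mob b x) = x) by (intros x Hx; apply mobK; [assumption|now left]).
  assert (M0 : mob (- b) 0 = b) by (rewrite mob_at_0; ring).
  exists (fun z => mob (- b) (mob s2 z * (mob s2 z * g z))), (fun z => (mob s1 z * (mob s2 z * c))%C).
  split; [split; [|split]|].
  - now apply holo_on_D_holo.
  - now apply holo_on_D_holo.
  - intros z Hz. split; [now apply F6 | now apply F4].
  - split; [|split; [|split; [assumption|split; [assumption|split; [|split; [|split; [|split]]]]]]].
    + rewrite !mob_at_0. replace (- s2 * (- s2 * g 0))%C with (g 0 * (s2 * s2))%C by ring. rewrite G0. now apply Kb.
    + rewrite !mob_at_0. unfold c. field. split; intros E; apply N12; rewrite E; ring.
    + replace (mob s2 s1 * (mob s2 s1 * g s1))%C with (g s1 * (mob s2 s1 * mob s2 s1))%C by ring. rewrite G1. now apply Kb.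
    + rewrite mob_self. ring.
    + rewrite mob_self, Cmult_0_l. exact M0.
    + rewrite mob_self. ring.
    + apply C_has_deriv_cder.
      destruct (proj1 Hg s2 D2) as [l Hl]. destruct (cder_mob_D s2 s2 D2 D2) as [m Hm].
      destruct (cder_mob_D (- b) 0 (inD_opp b Hb) inD_0) as [k Hk].
      set (u := fun z => (mob s2 z * (mob s2 z * g z))%C).
      (* Both factors [mob s2] vanish at [s2], so every term of the product rule is 0. *)
      assert (Hu : cder u s2 0).
      { pose proof (cder_mult _ _ _ _ _ Hm (cder_mult _ _ _ _ _ Hm Hl)) as P. simpl in P.
        rewrite mob_self in P.
        match type of P with cder _ _ ?x => replace x with (RtoC 0) in P by ring end. exact P. }
      assert (u0 : u s2 = 0) by (unfold u; rewrite mob_self; ring).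
      rewrite <- u0 in Hk. rewrite <- (Cmult_0_r k). exact (cder_comp (mob (- b)) u s2 k 0 Hu Hk).
Qed.

(** * Three-pole competitors near L_a0b0 *)

Lemma spick_lim {T} (F : (T -> Prop) -> Prop) {FF : Filter F} z a s w (m : T -> R) Z A S W M :
  clim F z Z -> clim F a A -> clim F s S -> clim F w W -> rlim F m M ->
  spick Z A S W M -> F (fun x => spick (z x) (a x) (s x) (w x) (m x)).
Proof.
  intros Hz Ha Hs Hw Hm [H1 [H2 H3]]. unfold spick.
  repeat apply filter_and.
  - apply rlim_lt with (Cmod Z) (Cmod S); try apply rlim_Cmod; assumption.
  - apply rlim_lt with (Cmod A) (Cmod W); try apply rlim_Cmod; assumption.
  - refine (rlim_lt F _ _ _ _ _ _ H3).
    + apply rlim_Cmod; [assumption|]. apply clim_minus; try apply clim_mult; assumption.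
    + apply rlim_mult; [assumption|assumption|]. apply rlim_Cmod; [assumption|].
      apply clim_minus; try apply clim_mult; try apply clim_conj; assumption.
Qed.

(** A value prescribed at a node on the unit circle is constrained only by the bounds on the
    moduli. *)
Lemma spick_bdry Z A S W : Cmod Z < Cmod S -> Cmod A < Cmod W -> spick Z A S W 1.
Proof.
  intros H1 H2. split; [assumption|split; [assumption|]]. rewrite Rmult_1_l. apply Cmod_lt_sqr.
  pose proof (pick_identity S A Z W) as I. pose proof (Cmod_ge_0 Z). pose proof (Cmod_ge_0 A).
  assert (0 < (Cmod S ^ 2 - Cmod Z ^ 2) * (Cmod W ^ 2 - Cmod A ^ 2)) by (apply Rmult_lt_0_compat; nra).
  lra.
Qed.

Lemma clim_mob {T} (F : (T -> Prop) -> Prop) {FF : Filter F} s z (S Z : C) :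
  (1 - Cconj S * Z)%C <> 0 -> clim F s S -> clim F z Z -> clim F (fun x => mob (s x) (z x)) (mob S Z).
Proof.
  intros H Hs Hz. unfold mob. apply clim_div; [assumption|assumption|now apply clim_minus|].
  apply clim_minus; [assumption|now apply clim_const|]. apply clim_mult; [assumption|now apply clim_conj|assumption].
Qed.

Lemma Cconj_R (x : R) : Cconj (RtoC x) = RtoC x.
Proof. apply injective_projections; simpl; ring. Qed.

(** Common end of three constructions that place nodes on the unit circle, where Blaschke factors
    are unimodular. The strict conditions hold at the limit nodes, hence at nodes inside the disc;
    the bound by [P] is not strict and must be supplied along the way. *)
Lemma nodes_from_limit (Z A z2 : C) (P : R) (s1 s2 s3 : R -> C) (l1 l2 l3 : C) :
  clim (at_left 1) s1 l1 -> clim (at_left 1) s2 l2 -> clim (at_left 1) s3 l3 ->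
  at_left 1 (fun t => inD (s1 t) /\ inD (s2 t) /\ inD (s3 t) /\ Cmod (s1 t) * Cmod (s2 t) <= P) ->
  (1 - Cconj l2 * l1)%C <> 0 -> (1 - Cconj l3 * l1)%C <> 0 ->
  (1 - Cconj l1 * l3)%C <> 0 -> (1 - Cconj l2 * l3)%C <> 0 ->
  mob l1 l3 <> 0 -> mob l2 l3 <> 0 ->
  spick Z A (l2 * l3) (mob l2 l1 * mob l3 l1) (Cmod l1) ->
  Cmod z2 < Cmod (l1 * l2 * l3) ->
  exists x1 x2 x3, inD x1 /\ inD x2 /\ inD x3 /\ Cmod x1 * Cmod x2 <= P /\
    spick Z A (x2 * x3) (mob x2 x1 * mob x3 x1) (Cmod x1) /\
    Cmod z2 < Cmod (x1 * x2 * x3) /\ 0 < Cmod (mob x1 x3 * mob x2 x3).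
Proof.
  intros L1 L2 L3 E D21 D31 D13 D23 N13 N23 Hs Hz.
  assert (FF : Filter (at_left 1)) by typeclasses eauto.
  assert (C1 : at_left 1 (fun t => spick Z A (s2 t * s3 t) (mob (s2 t) (s1 t) * mob (s3 t) (s1 t)) (Cmod (s1 t)))).
  { refine (spick_lim (at_left 1) _ _ _ _ _ _ _ _ _ _ _ _ _ _ _ Hs).
    - now apply clim_const.
    - now apply clim_const.
    - now apply clim_mult.
    - apply clim_mult; [assumption|now apply clim_mob|now apply clim_mob].
    - now apply rlim_Cmod. }
  assert (C2 : at_left 1 (fun t => Cmod z2 < Cmod (s1 t * s2 t * s3 t))).
  { refine (rlim_lt (at_left 1) _ _ _ _ _ _ Hz); [now apply rlim_const|].
    apply rlim_Cmod; [assumption|]. apply clim_mult; [assumption|now apply clim_mult|assumption]. }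
  assert (C3 : at_left 1 (fun t => 0 < Cmod (mob (s1 t) (s3 t) * mob (s2 t) (s3 t)))).
  { apply (rlim_lt (at_left 1) _ _ 0 (Cmod (mob l1 l3 * mob l2 l3))); [now apply rlim_const| |].
    - apply rlim_Cmod; [assumption|]. apply clim_mult; [assumption|now apply clim_mob|now apply clim_mob].
    - apply Cmod_gt_0. now apply Cmult_neq_0. }
  destruct (filter_ex (F := at_left 1) _ (@filter_and R (at_left 1) _ _ _ E
    (@filter_and R (at_left 1) _ _ _ C1 (@filter_and R (at_left 1) _ _ _ C2 C3)))) as [t Ht].
  exists (s1 t), (s2 t), (s3 t). tauto.
Qed.

Lemma clim_at_left_opp c : clim (at_left c) (fun t => (- RtoC t)%C) (- RtoC c)%C.
Proof. apply clim_opp; [typeclasses eauto|apply clim_at_left]. Qed.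

Lemma inD_R (x : R) : -1 < x < 1 -> inD x.
Proof. intros H. unfold inD. rewrite Cmod_R. apply Rabs_def1; lra. Qed.

Lemma at_left_01 : at_left 1 (fun t => 0 < t < 1).
Proof. apply filter_and; [apply at_left_gt; lra | apply at_left_lt]. Qed.

Ltac creal := rewrite ?Cconj_R, <- ?RtoC_opp, <- ?RtoC_mult, <- ?RtoC_minus, <- ?RtoC_plus; intros Ecr; apply RtoC_inj in Ecr; lra.

Lemma mob_R (x y : R) : 1 - x * y <> 0 -> mob x y = RtoC ((y - x) / (1 - x * y)).
Proof.
  intros H. unfold mob. rewrite Cconj_R, <- RtoC_mult, <- !RtoC_minus, <- RtoC_div by assumption. reflexivity.
Qed.

(** Limit nodes 1, [q], -1. Both Blaschke factors at [x1 = 1] equal 1 and [m = 1], so by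
    [spick_bdry] only [|Z| < q] and [|A| < 1] remain. *)
Lemma nodes_bdry_a (Z A z2 : C) (q : R) : Cmod A < 1 -> Cmod Z < q -> Cmod z2 < q -> q < 1 ->
  exists x1 x2 x3, inD x1 /\ inD x2 /\ inD x3 /\ Cmod x1 * Cmod x2 <= q /\
    spick Z A (x2 * x3) (mob x2 x1 * mob x3 x1) (Cmod x1) /\
    Cmod z2 < Cmod (x1 * x2 * x3) /\ 0 < Cmod (mob x1 x3 * mob x2 x3).
Proof.
  intros HA HZ Hz Hq. pose proof (Cmod_ge_0 Z).
  apply (nodes_from_limit Z A z2 q (fun t => RtoC t) (fun _ => RtoC q) (fun t => RtoC (- t)) 1 q (RtoC (-1))).
  - apply clim_at_left.
  - apply clim_const; typeclasses eauto.
  - apply (clim_ext (at_left 1) (fun t => (- RtoC t)%C)).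
    + apply filter_forall. intros t. now rewrite RtoC_opp.
    + replace (RtoC (-1)) with (- RtoC 1)%C by (rewrite <- RtoC_opp; f_equal; lra). apply clim_at_left_opp.
  - generalize at_left_01. apply filter_imp. intros t Ht. repeat split; try (apply inD_R; lra).
    rewrite !Cmod_R, !Rabs_pos_eq by lra. nra.
  - creal. 
  - creal.
  - creal.
  - creal.
  - rewrite mob_R by lra. intros E. apply RtoC_inj in E. field_simplify in E. lra.
  - rewrite mob_R by lra. intros E. apply RtoC_inj in E. replace ((-1 - q) / (1 - q * -1)) with (-1) in E by (field; lra). lra.
  - rewrite !mob_R by lra. rewrite Cmod_R, Rabs_R1. apply spick_bdry.
    + rewrite <- RtoC_mult, Cmod_R, Rabs_left by lra. lra.
    + replace ((1 - q) / (1 - q * 1)) with 1 by (field; lra).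
      replace ((1 - -1) / (1 - -1 * 1)) with 1 by field.
      now rewrite Cmult_1_l, Cmod_1.
  - rewrite <- !RtoC_mult, Cmod_R, Rabs_left by lra. lra.
Qed.

Lemma Cmod_den_sym (u v : C) : Cmod (1 - Cconj u * v) = Cmod (1 - Cconj v * u).
Proof.
  rewrite <- Cmod_conj, Cminus_conj, Cmult_conj, Cconj_conj, Cconj_R. f_equal. ring.
Qed.

(** Limit nodes [q], 1, -1. Now [S = W = -1] and [m = q], so the Pick inequality becomes
    [|Z - A| < q |1 - Cconj Z * A|], that is [|mob A Z| < q]. *)
Lemma nodes_bdry_b (Z A z2 : C) (q : R) : inD A -> inD Z -> Cmod (mob A Z) < q -> Cmod z2 < q -> q < 1 ->
  exists x1 x2 x3, inD x1 /\ inD x2 /\ inD x3 /\ Cmod x1 * Cmod x2 <= q /\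
    spick Z A (x2 * x3) (mob x2 x1 * mob x3 x1) (Cmod x1) /\
    Cmod z2 < Cmod (x1 * x2 * x3) /\ 0 < Cmod (mob x1 x3 * mob x2 x3).
Proof.
  intros HA HZ Hal Hz Hq. pose proof (Cmod_ge_0 (mob A Z)).
  apply (nodes_from_limit Z A z2 q (fun _ => RtoC q) (fun t => RtoC t) (fun t => RtoC (- t)) q 1 (RtoC (-1))).
  - apply clim_const; typeclasses eauto.
  - apply clim_at_left.
  - apply (clim_ext (at_left 1) (fun t => (- RtoC t)%C)).
    + apply filter_forall. intros t. now rewrite RtoC_opp.
    + replace (RtoC (-1)) with (- RtoC 1)%C by (rewrite <- RtoC_opp; f_equal; lra). apply clim_at_left_opp.
  - generalize at_left_01. apply filter_imp. intros t Ht. repeat split; try (apply inD_R; lra).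
    rewrite !Cmod_R, !Rabs_pos_eq by lra. nra.
  - creal. 
  - creal.
  - creal.
  - creal.
  - rewrite mob_R by lra. intros E. apply RtoC_inj in E. replace ((-1 - q) / (1 - q * -1)) with (-1) in E by (field; lra). lra.
  - rewrite mob_R by lra. intros E. apply RtoC_inj in E. field_simplify in E. lra.
  - rewrite !mob_R by lra. rewrite Cmod_R, Rabs_pos_eq by lra.
    replace ((q - 1) / (1 - 1 * q)) with (-1) by (field; lra).
    replace ((q - -1) / (1 - -1 * q)) with 1 by (field; lra).
    rewrite <- !RtoC_mult. replace (1 * -1) with (-1) by ring. replace (-1 * 1) with (-1) by ring.
    unfold inD in *. split; [|split].
    + rewrite Cmod_R, Rabs_left by lra. lra.
    + rewrite Cmod_R, Rabs_left by lra. lra.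
    + replace (Z * RtoC (-1) - A * RtoC (-1))%C with (- (Z - A))%C by (replace (RtoC (-1)) with (- RtoC 1)%C by (rewrite <- RtoC_opp; f_equal; lra); ring).
      rewrite Cmod_opp, <- (Cmod_mob A Z HA (Rlt_le _ _ HZ)).
      rewrite Cconj_R, <- RtoC_mult. replace (-1 * -1) with 1 by ring.
      rewrite (Cmod_den_sym Z A). apply Rmult_lt_compat_r; [|exact Hal].
      apply mob_den_pos; [assumption|now left].
  - rewrite <- !RtoC_mult, Cmod_R, Rabs_left by lra. lra.
Qed.

Lemma mob_den_r (s z : C) : Cmod s <= 1 -> inD z -> (1 - Cconj s * z)%C <> 0.
Proof.
  intros Hs Hz. apply Cmod_gt_0. rewrite Cmod_den_sym. now apply mob_den_pos.
Qed.

(** The gain from a dilation by [1 / r]: it turns a quotient [x / (1 - r^2 c)] into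
    [(x / r) / (1 - c)], which has larger modulus when [x] is not 0. The difference of the squares
    factors as in [E]. *)
Lemma Cmod_dilate (r : R) (c : C) : 0 < r < 1 -> Cmod c <= 1 ->
  r * Cmod (1 - c) < Cmod (1 - RtoC (r ^ 2) * c).
Proof.
  intros Hr Hc. pose proof (Cmod_ge_0 c).
  replace (r * Cmod (1 - c)) with (Cmod (RtoC r * (1 - c))) by (rewrite Cmod_mult, Cmod_R, Rabs_pos_eq; lra).
  apply Cmod_lt_sqr.
  assert (E : Cmod (1 - RtoC (r ^ 2) * c) ^ 2 - Cmod (RtoC r * (1 - c)) ^ 2 = (1 - r ^ 2) * (1 - r ^ 2 * Cmod c ^ 2)).
  { rewrite !Cmod_sqr. destruct c. simpl. ring. }
  assert (0 < (1 - r ^ 2) * (1 - r ^ 2 * Cmod c ^ 2)).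
  { apply Rmult_lt_0_compat; [nra|]. assert (0 <= Cmod c ^ 2 <= 1) by nra. assert (0 < r ^ 2 < 1) by nra. nra. }
  lra.
Qed.

(* The nodes of the automorphism taking 0 to [Z], dilated so that their product has modulus [q]. *)
Lemma nodes_dilated (Z A z2 : C) (q : R) : inD A -> inD Z -> A <> 0 ->
  q <= Cmod Z -> q <= Cmod (mob A Z) -> Cmod Z * Cmod (mob A Z) < q -> Cmod z2 < q -> q < 1 ->
  exists x1 x2 x3, inD x1 /\ inD x2 /\ inD x3 /\ Cmod x1 * Cmod x2 <= q /\
    spick Z A (x2 * x3) (mob x2 x1 * mob x3 x1) (Cmod x1) /\
    Cmod z2 < Cmod (x1 * x2 * x3) /\ 0 < Cmod (mob x1 x3 * mob x2 x3).
Proof.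
  intros HA HZ HA0 HqZ Hqa HM Hz Hq.
  rewrite (Cmod_mob_sym A Z HA HZ) in *.
  assert (Hin : inD (mob Z A)) by now apply inD_mob.
  set (M := mob Z A) in *. unfold inD in HZ, Hin.
  pose proof (Cmod_ge_0 z2). set (al := Cmod M) in *. set (x := Cmod Z) in *.
  (* With this [r], the moduli [al / r] and [x / r] of the dilated nodes have product exactly
     [q]. *)
  set (r := sqrt (x * al / q)).
  assert (Hpos : 0 < x * al / q) by (apply Rdiv_lt_0_compat; nra).
  assert (Hr0 : 0 < r) by (now apply sqrt_lt_R0).
  assert (Hr2 : r ^ 2 = x * al / q) by (unfold r; rewrite pow2_sqrt; lra).
  assert (Hr2q : r ^ 2 * q = x * al) by (rewrite Hr2; field; lra).
  assert (Hq0 : 0 < q) by lra.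
  assert (Hr1 : r < 1) by (assert (r ^ 2 < 1) by (apply Rmult_lt_reg_r with q; lra); nra).
  (* [q <= al] and [x < 1] give [x q < al], which puts [s2] in the disc; symmetrically [q <= x] will
     put [s1] there. *)
  assert (Hxr : x < r).
  { apply Rnot_le_lt. intros Hle. assert (r ^ 2 <= x ^ 2) by nra. assert (x * q < al) by nra.
    assert (r ^ 2 * q <= x ^ 2 * q) by (apply Rmult_le_compat_r; lra). nra. }
  assert (Har : al < r).
  { apply Rnot_le_lt. intros Hle. assert (r ^ 2 <= al ^ 2) by nra. assert (al * q < x) by nra.
    assert (r ^ 2 * q <= al ^ 2 * q) by (apply Rmult_le_compat_r; lra). nra. }
  assert (HrC : RtoC r <> 0) by (intros E; apply RtoC_inj in E; lra).
  set (s1 := (M / RtoC r)%C). set (s2 := (- Z / RtoC r)%C).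
  assert (C1 : Cmod s1 = al / r) by (unfold s1; rewrite Cmod_div, Cmod_R, Rabs_pos_eq by (assumption || lra); reflexivity).
  assert (C2 : Cmod s2 = x / r) by (unfold s2; rewrite Cmod_div, Cmod_opp, Cmod_R, Rabs_pos_eq by (assumption || lra); reflexivity).
  assert (DL : forall u, u < r -> u / r < 1).
  { intros u Hu. apply Rmult_lt_reg_r with r; [lra|]. unfold Rdiv. rewrite Rmult_assoc, Rinv_l; lra. }
  assert (D1 : inD s1) by (unfold inD; rewrite C1; now apply DL).
  assert (D2 : inD s2) by (unfold inD; rewrite C2; now apply DL).
  assert (Cp : Cmod s1 * Cmod s2 = q).
  { rewrite C1, C2. replace (al / r * (x / r)) with (x * al / r ^ 2) by (field; lra). rewrite <- Hr2q. field. lra. }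
  assert (P1 : 0 < Cmod s1) by (rewrite C1; apply Rdiv_lt_0_compat; lra).
  assert (P2 : 0 < Cmod s2) by (rewrite C2; apply Rdiv_lt_0_compat; lra).
  set (c := (Cconj s2 * s1)%C).
  assert (Hc : Cmod c = q) by (unfold c; rewrite Cmod_mult, Cmod_conj, <- Cp; ring).
  set (k := (1 - RtoC (r ^ 2) * c)%C).
  set (B := mob s2 s1).
  assert (HB : (B * (1 - c))%C = (s1 - s2)%C).
  { unfold B, mob, c. field. apply mob_den; [assumption|now left]. }
  assert (Zr : Z = (- RtoC r * s2)%C) by (unfold s2; field; assumption).
  (* This is [A = mob (- Z) M] with its denominator [1 + Cconj Z * M], which is [k], cleared. *)
  assert (HAk : (A * k)%C = (RtoC r * (s1 - s2))%C).
  { unfold k, c, s1, s2. rewrite Cdiv_conj, Copp_conj, Cconj_R, RtoC_pow by assumption.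
    unfold M, mob. field. split; [assumption|]. apply mob_den; [assumption|now left]. }
  assert (Dil : r * Cmod (1 - c) < Cmod k) by (apply Cmod_dilate; lra).
  assert (Hk : 0 < Cmod k) by (pose proof (Cmod_ge_0 (1 - c)); nra).
  assert (HB0 : 0 < Cmod B).
  { apply Cmod_gt_0. intros E. rewrite E, Cmult_0_l in HB. rewrite <- HB, Cmult_0_r in HAk.
    revert HAk. apply Cmult_neq_0; [assumption|]. now apply Cmod_gt_0. }
  assert (HAkB : (A * k)%C = (RtoC r * B * (1 - c))%C) by (rewrite HAk, <- HB; ring).
  assert (N1 : (1 - s1)%C <> 0).
  { replace (1 - s1)%C with (1 - Cconj 1 * s1)%C by (rewrite Cconj_R; ring). apply mob_den_r; [rewrite Cmod_1; lra|assumption]. }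
  assert (M1 : mob 1 s1 = (- (1))%C) by (unfold mob; rewrite Cconj_R, Cmult_1_l; field; assumption).
  assert (T1 : Cmod 1 <= 1) by (rewrite Cmod_1; lra).
  (* The third node tends to 1: its Blaschke factor at [s1] becomes -1, and the product of the three
     moduli becomes [q]. *)
  apply (nodes_from_limit Z A z2 q (fun _ => s1) (fun _ => s2) (fun t => RtoC t) s1 s2 1).
  - apply clim_const; typeclasses eauto.
  - apply clim_const; typeclasses eauto.
  - apply clim_at_left.
  - generalize at_left_01. apply filter_imp. intros t Ht. repeat split; try assumption; [apply inD_R; lra|lra].
  - now apply mob_den; [|left].
  - now apply mob_den_r.
  - now apply mob_den.
  - now apply mob_den.
  - apply Cmod_gt_0. rewrite Cmod_mob_bdry by (try assumption; apply Cmod_1). lra.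
  - apply Cmod_gt_0. rewrite Cmod_mob_bdry by (try assumption; apply Cmod_1). lra.
  - rewrite M1. fold B. split; [|split].
    + rewrite Cmult_1_r. replace (Cmod Z) with (r * Cmod s2) by (rewrite Zr at 1; rewrite Cmod_mult, Cmod_opp, Cmod_R, Rabs_pos_eq; lra). nra.
    + rewrite Cmod_mult, Cmod_opp, Cmod_1, Rmult_1_r.
      apply Rmult_lt_reg_r with (Cmod k); [assumption|]. rewrite <- Cmod_mult, HAkB, !Cmod_mult, Cmod_R, Rabs_pos_eq by lra. nra.
    + apply Rmult_lt_reg_r with (Cmod k); [assumption|]. rewrite Rmult_assoc, <- !Cmod_mult.
      assert (r2 : RtoC (r ^ 2) = (RtoC r * RtoC r)%C) by (rewrite RtoC_pow; ring).
      (* After multiplication by [k] both sides have the factor [|s2 B (1 - r^2)|]. What remains is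
         [r q < |s1|], true because [q = |s1| |s2|]. *)
      assert (E1 : ((Z * (B * - (1)) - A * (s2 * 1)) * k)%C = (s2 * (RtoC r * B * c * (1 - RtoC (r ^ 2))))%C).
      { transitivity (s2 * (RtoC r * B * k - A * k))%C; [rewrite Zr; ring|].
        rewrite HAkB. unfold k. ring. }
      assert (E2 : ((Cconj (s2 * 1) * (B * - (1)) - Cconj Z * A) * k)%C = (Cconj s2 * (B * - (1 - RtoC (r ^ 2))))%C).
      { transitivity (Cconj s2 * (RtoC r * (A * k) - B * k))%C.
        - rewrite Zr, !Cmult_conj, Copp_conj, !Cconj_R. ring.
        - rewrite HAkB. unfold k. rewrite r2. ring. }
      rewrite E1, E2, !Cmod_mult, Cmod_opp, Cmod_conj, Hc, Cmod_R, (Rabs_pos_eq r) by lra.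
      assert (0 < Cmod (1 - RtoC (r ^ 2))).
      { apply Cmod_gt_0. rewrite <- RtoC_minus. intros E. apply RtoC_inj in E. nra. }
      set (w := Cmod (1 - RtoC (r ^ 2))) in *.
      assert (0 < Cmod s2 * (Cmod B * w)) by (repeat apply Rmult_lt_0_compat; assumption).
      assert (r * q < Cmod s1) by (rewrite <- Cp; unfold inD in D2; nra).
      replace (Cmod s2 * (r * Cmod B * q * w)) with (r * q * (Cmod s2 * (Cmod B * w))) by ring.
      apply Rmult_lt_compat_r; assumption.
  - rewrite Cmult_1_r, Cmod_mult, Cp. exact Hz.
Qed.

(* The exponential of [L_a0b0], see [L_a0b0_mass]. *)
Definition mass (Z A z2 : C) : R := Rmax (Cmod z2) (Cmod Z * Cmod (mob A Z)).

Lemma nodes_above_mass (Z A z2 : C) (P : R) : inD A -> inD Z -> A <> 0 -> mass Z A z2 < P -> P <= 1 ->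
  exists x1 x2 x3, inD x1 /\ inD x2 /\ inD x3 /\ Cmod x1 * Cmod x2 <= P /\
    spick Z A (x2 * x3) (mob x2 x1 * mob x3 x1) (Cmod x1) /\
    Cmod z2 < Cmod (x1 * x2 * x3) /\ 0 < Cmod (mob x1 x3 * mob x2 x3).
Proof.
  intros HA HZ HA0 HM HP. set (q := (mass Z A z2 + P) / 2).
  assert (M1 : Cmod z2 <= mass Z A z2) by apply Rmax_l.
  assert (M2 : Cmod Z * Cmod (mob A Z) <= mass Z A z2) by apply Rmax_r.
  assert (Hq : exists x1 x2 x3, inD x1 /\ inD x2 /\ inD x3 /\ Cmod x1 * Cmod x2 <= q /\
    spick Z A (x2 * x3) (mob x2 x1 * mob x3 x1) (Cmod x1) /\
    Cmod z2 < Cmod (x1 * x2 * x3) /\ 0 < Cmod (mob x1 x3 * mob x2 x3)).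
  { destruct (Rlt_le_dec (Cmod Z) q) as [H1|H1]; [apply nodes_bdry_a; try assumption; unfold q; lra|].
    destruct (Rlt_le_dec (Cmod (mob A Z)) q) as [H2|H2]; [apply nodes_bdry_b; try assumption; unfold q; lra|].
    apply nodes_dilated; try assumption; unfold q; lra. }
  destruct Hq as [x1 [x2 [x3 [H1 [H2 [H3 [H4 H5]]]]]]]. exists x1, x2, x3.
  split; [assumption|split; [assumption|split; [assumption|split; [unfold q in H4; lra|assumption]]]].
Qed.

(** For [e = 0] the Pick inequality reduces to [|z2| < m |S|]; being strict, it persists for small
    [e]. *)
Lemma spick_small (z2 S W : C) (m : R) : m < 1 -> Cmod z2 < m * Cmod S -> 0 < Cmod W ->
  exists d, 0 < d /\ forall e, Cmod e < d -> spick z2 e S W m.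
Proof.
  intros Hm Hz HW.
  assert (H : nearC 0 (fun e => spick z2 e S W m)).
  { apply (spick_lim (nearC 0) (fun _ => z2) (fun e => e) (fun _ => S) (fun _ => W) (fun _ => m) z2 0 S W m);
      try (apply clim_const; typeclasses eauto); [apply clim_id|apply rlim_const; typeclasses eauto|].
    pose proof (Cmod_ge_0 z2). pose proof (Cmod_ge_0 S). rewrite <- (Cmod_conj S) in *.
    split; [rewrite <- (Cmod_conj S); nra|]. split; [now rewrite Cmod_0|].
    replace (z2 * W - 0 * S)%C with (z2 * W)%C by ring.
    replace (Cconj S * W - Cconj z2 * 0)%C with (Cconj S * W)%C by ring.
    rewrite !Cmod_mult, <- Rmult_assoc. now apply Rmult_lt_compat_r. }
  destruct H as [d [Hd H]]. exists d. split; [assumption|]. intros e He. apply H.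
  now replace (e - 0)%C with e by ring.
Qed.

(** The same triple serves all small [e]. The value [e = 0] is included, which also yields the upper
    bound on [L_a0b0]. *)
Lemma comp3_above_mass (a b z1 z2 : C) (P : R) : inD a -> inD b -> a <> b -> inD z1 ->
  mass (mob b z1) (mob b a) z2 < P -> P <= 1 ->
  exists s1 s2 s3, Cmod s1 * Cmod s2 <= P /\ Cmod s3 < 1 /\ 0 < Cmod s1 /\ 0 < Cmod s2 /\ 0 < Cmod s3 /\
    exists d, 0 < d /\ forall e, Cmod e < d -> comp3 a b e z1 z2 s1 s2 s3.
Proof.
  intros Ha Hb Hab Hz1 HM HP.
  assert (HA0 : mob b a <> 0) by (apply mob_neq0; [assumption|now left|assumption]).
  destruct (nodes_above_mass (mob b z1) (mob b a) z2 P) as [s1 [s2 [s3 [D1 [D2 [D3 [H1 [H2 [H3 H4]]]]]]]]];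
    try assumption; try (apply inD_mob; assumption).
  pose proof (Cmod_ge_0 z2).
  assert (N : 0 < Cmod s1 /\ 0 < Cmod s2 /\ 0 < Cmod s3).
  { rewrite !Cmod_mult in H3. pose proof (Cmod_ge_0 s1). pose proof (Cmod_ge_0 s2). pose proof (Cmod_ge_0 s3).
    repeat split; apply Rnot_le_lt; intros Hle.
    - assert (Cmod s1 = 0) as E by lra. rewrite E in H3. lra.
    - assert (Cmod s2 = 0) as E by lra. rewrite E in H3. lra.
    - assert (Cmod s3 = 0) as E by lra. rewrite E in H3. lra. }
  destruct N as [N1 [N2 N3]].
  exists s1, s2, s3. split; [assumption|]. split; [assumption|]. split; [assumption|]. split; [assumption|]. split; [assumption|].
  destruct (spick_small z2 (s1 * s2) (mob s1 s3 * mob s2 s3) (Cmod s3) D3) as [d [Hd Hs]].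
  { rewrite <- Cmod_mult. now replace (s3 * (s1 * s2))%C with (s1 * s2 * s3)%C by ring. }
  { assumption. }
  exists d. split; [assumption|]. intros e He.
  apply pick_comp3; try assumption; [now apply Cmod_gt_0|now apply Cmod_gt_0|now apply Hs].
Qed.

(** * Three-pole competitors near L_a0bV *)

Definition strictV (Z A z2 s1 s2 : C) : Prop :=
  inD s1 /\ inD s2 /\ spick Z A (s2 * s2) (mob s2 s1 * mob s2 s1) (Cmod s1) /\ Cmod z2 < Cmod (s1 * s2).

(* [s1] is allowed on the unit circle, where limits of minimizing sequences may end. *)
Definition weakV (Z A z2 s1 s2 : C) : Prop :=
  Cmod s1 <= 1 /\ inD s2 /\ s1 <> 0 /\ s2 <> 0 /\
  pick_cond Z A (s2 * s2) (mob s2 s1 * mob s2 s1) (Cmod s1) /\ Cmod z2 <= Cmod (s1 * s2).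

Lemma clim_div_at_left (c : C) : clim (at_left 1) (fun t => c / RtoC t)%C c.
Proof.
  cut (clim (at_left 1) (fun t => c / RtoC t)%C (c / RtoC 1)%C).
  { now replace (c / RtoC 1)%C with c by field. }
  apply clim_div; [typeclasses eauto| |apply clim_const; typeclasses eauto|apply clim_at_left].
  intros E. apply RtoC_inj in E. lra.
Qed.

Lemma Cmod_div_R (c : C) (k : R) : 0 < k -> Cmod (c / RtoC k) = Cmod c / k.
Proof.
  intros Hk. rewrite Cmod_div, Cmod_R, Rabs_pos_eq by (lra || (intros E; apply RtoC_inj in E; lra)). reflexivity.
Qed.

Lemma Rdiv_gt_self (x k : R) : 0 < k < 1 -> 0 < x -> x < x / k.
Proof.
  intros Hk Hx. apply Rmult_lt_reg_r with k; [lra|]. unfold Rdiv. rewrite Rmult_assoc, Rinv_l by lra. nra.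
Qed.

Lemma Rdiv_lt_one (x k : R) : 0 < k -> x < k -> x / k < 1.
Proof. intros Hk Hx. apply Rmult_lt_reg_r with k; [lra|]. unfold Rdiv. rewrite Rmult_assoc, Rinv_l; lra. Qed.

(* Both nodes are dilated, by [1 / k], about the double zero [s2]. *)
Lemma dilateV (Z A z2 s1 s2 : C) (k : R) : A <> 0 -> inD s1 -> weakV Z A z2 s1 s2 ->
  0 < k < 1 -> Cmod s2 < k -> Cmod (mob s2 s1) < k ->
  strictV Z A z2 (mob (- (s2 / RtoC k)) (mob s2 s1 / RtoC k)) (s2 / RtoC k).
Proof.
  intros HA0 D1 [_ [D2 [N1 [N2 [[P1 [P2 P3]] Hz]]]]] Hk H2 Hw.
  set (w := mob s2 s1) in *. set (x2 := (s2 / RtoC k)%C). set (w' := (w / RtoC k)%C).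
  assert (HkC : RtoC k <> 0) by (intros E; apply RtoC_inj in E; lra).
  assert (Dx2 : inD x2) by (unfold inD, x2; rewrite Cmod_div_R by lra; apply Rdiv_lt_one; lra).
  assert (Dw' : inD w') by (unfold inD, w'; rewrite Cmod_div_R by lra; apply Rdiv_lt_one; lra).
  set (x1 := mob (- x2) w').
  assert (Dx1 : inD x1) by (apply inD_mob; [now apply inD_opp|assumption]).
  assert (Ew : mob x2 x1 = w') by (apply mobVK; [assumption|now left]).
  assert (Hw0 : 0 < Cmod w).
  { rewrite Cmod_mult in P2. apply Cmod_gt_0 in HA0. pose proof (Cmod_ge_0 w). nra. }
  assert (Hs20 : 0 < Cmod s2) by now apply Cmod_gt_0. assert (Hs10 : 0 < Cmod s1) by now apply Cmod_gt_0.
  assert (Gx2 : Cmod s2 < Cmod x2) by (unfold x2; rewrite Cmod_div_R by lra; now apply Rdiv_gt_self).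
  assert (Gw : Cmod w < Cmod w') by (unfold w'; rewrite Cmod_div_R by lra; now apply Rdiv_gt_self).
  (* The modulus of [s1] is the factor [m] on the larger side of the Pick inequality, so it must not
     decrease. Both [s1] and [x1] come from [w + s2], divided by the two denominators that
     [Cmod_dilate] compares. *)
  assert (Gx1 : Cmod s1 <= Cmod x1).
  { set (c := (- (Cconj x2 * w'))%C).
    assert (Hc : Cmod c <= 1).
    { unfold c. rewrite Cmod_opp, Cmod_mult, Cmod_conj. unfold inD in *.
      pose proof (Cmod_ge_0 x2). pose proof (Cmod_ge_0 w'). nra. }
    pose proof (Cmod_dilate k c Hk Hc) as Dil.
    assert (E1 : (x1 * (RtoC k * (1 - c)))%C = (w + s2)%C).
    { unfold x1, mob. rewrite Copp_conj. replace (w' - - x2)%C with ((w + s2) / RtoC k)%C by (unfold w', x2; field; assumption).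
      unfold c. replace (1 - - Cconj x2 * w')%C with (1 - - (Cconj x2 * w'))%C by ring.
      field. split; [assumption|]. pose proof (mob_den (- x2) w' (inD_opp _ Dx2) (Rlt_le _ _ Dw')) as Hd.
      rewrite Copp_conj in Hd. intros E. apply Hd. rewrite <- E. ring. }
    assert (E2 : (s1 * (1 - RtoC (k ^ 2) * c))%C = (w + s2)%C).
    { assert (Es1 : s1 = mob (- s2) w) by (symmetry; apply mobK; [assumption|now left]).
      assert (Hd : (1 - Cconj (- s2) * w)%C <> 0).
      { apply mob_den; [now apply inD_opp|left; now apply inD_mob]. }
      assert (Ec : (RtoC (k ^ 2) * c)%C = (Cconj (- s2) * w)%C).
      { unfold c, x2, w'. rewrite RtoC_pow, Cdiv_conj, Cconj_R, Copp_conj by assumption. field. assumption. }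
      rewrite Ec, Es1. unfold mob. field. assumption. }
    assert (E3 : Cmod x1 * (k * Cmod (1 - c)) = Cmod s1 * Cmod (1 - RtoC (k ^ 2) * c)).
    { rewrite <- Cmod_mult, E2, <- E1, !Cmod_mult, Cmod_R, Rabs_pos_eq by lra. reflexivity. }
    pose proof (Cmod_ge_0 x1). pose proof (Cmod_ge_0 (1 - c)).
    apply Rnot_lt_le. intros Hlt.
    assert (Cmod x1 * (k * Cmod (1 - c)) <= Cmod s1 * (k * Cmod (1 - c))) by (apply Rmult_le_compat_r; nra).
    assert (Cmod s1 * (k * Cmod (1 - c)) < Cmod s1 * Cmod (1 - RtoC (k ^ 2) * c)) by (apply Rmult_lt_compat_l; lra).
    lra. }
  split; [assumption|split; [assumption|split]].
  - rewrite Ew. split; [|split].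
    + eapply Rle_lt_trans; [exact P1|]. rewrite !Cmod_mult. nra.
    + eapply Rle_lt_trans; [exact P2|]. rewrite !Cmod_mult. nra.
    + set (X := (Cconj (s2 * s2) * (w * w))%C) in *. set (y := (Cconj Z * A)%C) in *.
      assert (HX : X <> 0).
      { unfold X. apply Cmult_neq_0; [|apply Cmult_neq_0; now apply Cmod_gt_0].
        apply Cmod_gt_0. rewrite Cmod_conj, Cmod_mult. nra. }
      assert (Hy : Cmod (y / X) <= 1).
      { apply Cmod_div_le. unfold X, y. rewrite !(Cmod_mult (Cconj _)), !Cmod_conj.
        apply Rmult_le_compat; try apply Cmod_ge_0; assumption. }
      (* [S] and [W] are squares of dilated quantities, whence the dilation factor [k^2] here. *)
      pose proof (Cmod_dilate (k ^ 2) (y / X) ltac:(nra) Hy) as Dil.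
      assert (K2 : RtoC (k ^ 2) = (RtoC k * RtoC k)%C) by (rewrite RtoC_pow; ring).
      assert (K4 : RtoC ((k ^ 2) ^ 2) = (RtoC k * RtoC k * (RtoC k * RtoC k))%C) by (rewrite !RtoC_pow; ring).
      set (Q := (RtoC k * RtoC k * (RtoC k * RtoC k))%C) in *.
      assert (HQ : Q <> 0) by (unfold Q; repeat apply Cmult_neq_0; assumption).
      assert (E1 : (Z * (w' * w') - A * (x2 * x2))%C = (RtoC (k ^ 2) * (Z * (w * w) - A * (s2 * s2)) / Q)%C).
      { rewrite K2. unfold Q, w', x2. field. assumption. }
      assert (E2 : (Cconj (x2 * x2) * (w' * w') - y)%C = (X * (1 - Q * (y / X)) / Q)%C).
      { transitivity (X / Q - y)%C.
        - unfold X, Q, w', x2. rewrite !Cmult_conj, Cdiv_conj, Cconj_R by assumption. field. assumption.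
        - field. split; assumption. }
      assert (E3 : (X - y)%C = (X * (1 - y / X))%C) by (field; assumption).
      rewrite E1, E2, !Cmod_div by assumption.
      assert (HQ' : 0 < Cmod Q) by now apply Cmod_gt_0.
      unfold Rdiv. rewrite <- Rmult_assoc. apply Rmult_lt_compat_r; [now apply Rinv_0_lt_compat|].
      rewrite !(Cmod_mult (RtoC (k ^ 2))), (Cmod_mult X), Cmod_R, (Rabs_pos_eq (k ^ 2)) by nra.
      rewrite E3, Cmod_mult in P3. rewrite K4 in Dil.
      assert (HX' : 0 < Cmod X) by now apply Cmod_gt_0.
      apply Rle_lt_trans with (Cmod s1 * (Cmod X * (k ^ 2 * Cmod (1 - y / X)))).
      * replace (Cmod s1 * (Cmod X * (k ^ 2 * Cmod (1 - y / X)))) with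
          (k ^ 2 * (Cmod s1 * (Cmod X * Cmod (1 - y / X)))) by ring.
        apply Rmult_le_compat_l; [nra|exact P3].
      * apply Rlt_le_trans with (Cmod s1 * (Cmod X * Cmod (1 - Q * (y / X)))).
        -- apply Rmult_lt_compat_l; [assumption|]. now apply Rmult_lt_compat_l.
        -- apply Rmult_le_compat_r; [|assumption]. apply Rmult_le_pos; [lra|apply Cmod_ge_0].
  - eapply Rle_lt_trans; [exact Hz|]. rewrite !Cmod_mult. nra.
Qed.

(** For [s1] inside the disc this is [dilateV] with [k] close to 1. For [|s1| = 1] only [s2] is
    dilated; [spick_bdry] then gives strict conditions, which survive when [s1] is pulled inside to
    [t s1]. *)
Lemma weakV_strictV (Z A z2 s1 s2 : C) (P : R) : A <> 0 -> inD A -> weakV Z A z2 s1 s2 ->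
  Cmod s1 * (Cmod s2 * Cmod s2) < P ->
  exists x1 x2, strictV Z A z2 x1 x2 /\ Cmod x1 * (Cmod x2 * Cmod x2) < P.
Proof.
  intros HA0 HA HV HP. assert (HV' := HV). destruct HV' as [L1 [D2 [N1 [N2 [[P1 [P2 P3]] Hz]]]]].
  assert (FF : Filter (at_left 1)) by typeclasses eauto.
  assert (Hs20 : 0 < Cmod s2) by now apply Cmod_gt_0.
  assert (Lx2 : clim (at_left 1) (fun k => s2 / RtoC k)%C s2) by apply clim_div_at_left.
  assert (Rx2 : rlim (at_left 1) (fun k => Cmod (s2 / RtoC k)) (Cmod s2)) by now apply rlim_Cmod.
  destruct (Rle_lt_or_eq_dec _ _ L1) as [D1|E1].
  - set (x1 := fun k => mob (- (s2 / RtoC k)) (mob s2 s1 / RtoC k)).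
    assert (Dw : inD (mob s2 s1)) by now apply inD_mob.
    assert (Lx1 : clim (at_left 1) x1 s1).
    { cut (clim (at_left 1) x1 (mob (- s2) (mob s2 s1))); [now rewrite (mobK s2 s1 D2 L1)|].
      apply clim_mob; [assumption| |now apply clim_opp|apply clim_div_at_left].
      apply mob_den; [now apply inD_opp|now left]. }
    assert (E : at_left 1 (fun k => Cmod (x1 k) * (Cmod (s2 / RtoC k) * Cmod (s2 / RtoC k)) < P)).
    { refine (rlim_lt (at_left 1) _ (fun _ => P) _ P _ (rlim_const _ P) HP).
      apply rlim_mult; [assumption|now apply rlim_Cmod|now apply rlim_mult]. }
    destruct (filter_ex (F := at_left 1) _ (@filter_and R (at_left 1) _ _ _ E (@filter_and R (at_left 1) _ _ _ at_left_01
      (@filter_and R (at_left 1) _ _ _ (at_left_gt _ _ D2) (at_left_gt _ _ Dw))))) as [k [Hk1 [Hk2 [Hk3 Hk4]]]].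
    exists (x1 k), (s2 / RtoC k)%C. split; [|assumption]. now apply dilateV.
  - assert (E : at_left 1 (fun k => Cmod (s2 / RtoC k) * Cmod (s2 / RtoC k) < P)).
    { refine (rlim_lt (at_left 1) _ (fun _ => P) _ P _ (rlim_const _ P) _); [exact (rlim_mult _ _ _ _ _ Rx2 Rx2)|]. rewrite E1 in HP. lra. }
    destruct (filter_ex (F := at_left 1) _ (@filter_and R (at_left 1) _ _ _ E (@filter_and R (at_left 1) _ _ _ at_left_01
      (at_left_gt _ _ D2)))) as [k [Hk1 [Hk2 Hk3]]].
    set (x2 := (s2 / RtoC k)%C) in *.
    assert (Dx2 : inD x2) by (unfold inD, x2; rewrite Cmod_div_R by lra; apply Rdiv_lt_one; lra).
    assert (Gx2 : Cmod s2 < Cmod x2) by (unfold x2; rewrite Cmod_div_R by lra; now apply Rdiv_gt_self).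
    assert (Lx1 : clim (at_left 1) (fun t => RtoC t * s1)%C s1).
    { cut (clim (at_left 1) (fun t => RtoC t * s1)%C (1 * s1)%C); [now rewrite Cmult_1_l|].
      apply clim_mult; [assumption|apply clim_at_left|now apply clim_const]. }
    assert (C1 : at_left 1 (fun t => spick Z A (x2 * x2) (mob x2 (RtoC t * s1) * mob x2 (RtoC t * s1)) (Cmod (RtoC t * s1)))).
    { assert (Lm : clim (at_left 1) (fun t => mob x2 (RtoC t * s1)) (mob x2 s1)).
      { apply clim_mob; [assumption|now apply mob_den|now apply clim_const|assumption]. }
      apply (spick_lim (at_left 1) _ _ _ _ _ Z A (x2 * x2) (mob x2 s1 * mob x2 s1) (Cmod s1));
        try now apply clim_const.
      - now apply clim_mult.
      - now apply rlim_Cmod.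
      - rewrite E1. apply spick_bdry.
        + eapply Rle_lt_trans; [exact P1|]. rewrite !Cmod_mult. nra.
        + rewrite Cmod_mult, Cmod_mob_bdry by assumption. unfold inD in HA. lra. }
    assert (C2 : at_left 1 (fun t => Cmod z2 < Cmod (RtoC t * s1 * x2))).
    { apply (rlim_lt (at_left 1) _ _ (Cmod z2) (Cmod (s1 * x2))); [now apply rlim_const| |].
      - apply rlim_Cmod; [assumption|]. apply clim_mult; [assumption|assumption|now apply clim_const].
      - eapply Rle_lt_trans; [exact Hz|]. rewrite !Cmod_mult, E1. lra. }
    destruct (filter_ex (F := at_left 1) _ (@filter_and R (at_left 1) _ _ _ at_left_01
      (@filter_and R (at_left 1) _ _ _ C1 C2))) as [t [Ht1 [Ht2 Ht3]]].
    assert (Ct : Cmod (RtoC t * s1) = t) by (rewrite Cmod_mult, E1, Cmod_R, Rabs_pos_eq; lra).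
    exists (RtoC t * s1)%C, x2. split.
    + split; [unfold inD; rewrite Ct; lra|]. split; [assumption|]. split; assumption.
    + rewrite Ct. pose proof (Cmod_ge_0 x2). nra.
Qed.

(** [1 / V] is to be the nonzero value, at a node of modulus [m], of a function with value [z2 / S]
    at 0. For [z2 <> 0] a constant function will do; for [z2 = 0] the modulus [m / 2] is below the
    Schwarz bound [m]. *)
Lemma spick_direction (z2 S : C) (m : R) : 0 < m < 1 -> Cmod z2 < Cmod S ->
  exists V, spick z2 1 S V m.
Proof.
  intros Hm Hz. assert (HS : 0 < Cmod S) by (pose proof (Cmod_ge_0 z2); lra).
  destruct (classic (z2 = 0)) as [->|Hz0].
  - exists (RtoC (2 / m)). assert (Hm2 : 2 < 2 / m) by (apply Rdiv_gt_self; lra).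
    assert (HV : Cmod (RtoC (2 / m)) = 2 / m) by (rewrite Cmod_R, Rabs_pos_eq; lra).
    split; [now rewrite Cmod_0|]. split; [rewrite HV, Cmod_1; lra|].
    replace (0 * RtoC (2 / m) - 1 * S)%C with (- S)%C by ring.
    rewrite (Cconj_R 0). replace (Cconj S * RtoC (2 / m) - 0 * 1)%C with (Cconj S * RtoC (2 / m))%C by ring.
    rewrite Cmod_opp, Cmod_mult, HV, Cmod_conj.
    replace (m * (Cmod S * (2 / m))) with (2 * Cmod S) by (field; lra). lra.
  - assert (Hz' : 0 < Cmod z2) by now apply Cmod_gt_0.
    exists (S / z2)%C.
    assert (Q : 1 < Cmod (S / z2)).
    { rewrite Cmod_div by assumption. apply Rmult_lt_reg_r with (Cmod z2); [assumption|].
      unfold Rdiv. rewrite Rmult_assoc, Rinv_l; lra. }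
    split; [assumption|split; [now rewrite Cmod_1|]].
    replace (z2 * (S / z2) - 1 * S)%C with (RtoC 0) by (field; assumption). rewrite Cmod_0.
    apply Rmult_lt_0_compat; [lra|].
    destruct (spick_bdry z2 1 S (S / z2) Hz) as [_ [_ H]]; [now rewrite Cmod_1|].
    rewrite Rmult_1_l in H. eapply Rle_lt_trans; [apply Cmod_ge_0|exact H].
Qed.

(** The conditions are homogeneous in the pair formed by the value and [W], so a value of order [e]
    is attainable when a zero lies at distance of order [e]. *)
Lemma spick_scale (z2 u S W e : C) (m : R) : e <> 0 -> spick z2 u S W m -> spick z2 (e * u) S (e * W) m.
Proof.
  intros He [H1 [H2 H3]]. apply Cmod_gt_0 in He. split; [assumption|]. split.
  - rewrite !Cmod_mult. now apply Rmult_lt_compat_l.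
  - replace (z2 * (e * W) - e * u * S)%C with (e * (z2 * W - u * S))%C by ring.
    replace (Cconj S * (e * W) - Cconj z2 * (e * u))%C with (e * (Cconj S * W - Cconj z2 * u))%C by ring.
    rewrite !(Cmod_mult e). replace (m * (Cmod e * Cmod (Cconj S * W - Cconj z2 * u))) with
      (Cmod e * (m * Cmod (Cconj S * W - Cconj z2 * u))) by ring. now apply Rmult_lt_compat_l.
Qed.

(* The double node [x2] splits into [x2] and [s3 e], at distance of order [e] from it; the
   coefficient [V] makes the second component take the value [e] at [s3 e]. *)
Lemma comp3_near_strictV (a b z1 z2 x1 x2 : C) (P : R) : inD a -> inD b -> a <> b -> inD z1 ->
  strictV (mob b z1) (mob b a) z2 x1 x2 -> Cmod x1 * (Cmod x2 * Cmod x2) < P ->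
  exists d, 0 < d /\ forall e : C, e <> 0 -> Cmod e < d ->
    exists s3, comp3 a b e z1 z2 x1 x2 s3 /\ 0 < Cmod x1 /\ 0 < Cmod x2 /\ 0 < Cmod s3 /\
      Cmod x1 * (Cmod x2 * Cmod s3) < P.
Proof.
  intros Ha Hb Hab Hz1 [D1 [D2 [HV Hz]]] HP.
  assert (N : 0 < Cmod x1 /\ 0 < Cmod x2).
  { rewrite Cmod_mult in Hz. pose proof (Cmod_ge_0 z2). pose proof (Cmod_ge_0 x1). pose proof (Cmod_ge_0 x2).
    split; apply Rnot_le_lt; intros Hle; nra. }
  destruct N as [N1 N2].
  assert (HA0 : mob b a <> 0) by (apply mob_neq0; [assumption|now left|assumption]).
  assert (N21 : mob x2 x1 <> 0).
  { destruct HV as [_ [H _]]. intros E. rewrite E, Cmult_0_l, Cmod_0 in H. pose proof (Cmod_ge_0 (mob b a)). lra. }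
  assert (Hm : mob x1 x2 <> 0).
  { apply Cmod_gt_0. rewrite Cmod_mob_sym by assumption. now apply Cmod_gt_0. }
  destruct (spick_direction z2 (x1 * x2) (Cmod x2) ltac:(unfold inD in D2; lra) Hz) as [V HVd].
  (* Dividing by [mob x1 x2] compensates the other Blaschke factor at the new node, so that the
     product of the two, divided by [e], tends to [V]. *)
  set (s3 := fun e : C => mob (- x2) (e * (V / mob x1 x2))).
  assert (FF : Filter (nearC 0)) by typeclasses eauto.
  assert (Lw : clim (nearC 0) (fun e => e * (V / mob x1 x2))%C 0).
  { cut (clim (nearC 0) (fun e => e * (V / mob x1 x2))%C (0 * (V / mob x1 x2))%C); [now rewrite Cmult_0_l|].
    apply clim_mult; [assumption|apply clim_id|now apply clim_const]. }
  assert (L3 : clim (nearC 0) s3 x2).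
  { cut (clim (nearC 0) s3 (mob (- x2) 0)); [rewrite mob_at_0; now replace (- - x2)%C with x2 by ring|].
    apply clim_mob; [assumption| |now apply clim_const|assumption].
    rewrite Cmult_0_r. intros E. replace (1 - 0)%C with (RtoC 1) in E by ring. apply RtoC_inj in E. lra. }
  assert (R3 : rlim (nearC 0) (fun e => Cmod (s3 e)) (Cmod x2)) by now apply rlim_Cmod.
  assert (L13 : clim (nearC 0) (fun e => mob x1 (s3 e)) (mob x1 x2)).
  { apply clim_mob; [assumption| |now apply clim_const|assumption]. apply mob_den; [assumption|now left]. }
  assert (L31 : clim (nearC 0) (fun e => mob (s3 e) x1) (mob x2 x1)).
  { apply clim_mob; [assumption| |assumption|now apply clim_const]. apply mob_den; [assumption|now left]. }
  assert (C0 : nearC 0 (fun e => Cmod (e * (V / mob x1 x2)) < 1)).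
  { apply (rlim_lt (nearC 0) _ _ (Cmod 0) 1); [now apply rlim_Cmod|now apply rlim_const|rewrite Cmod_0; lra]. }
  assert (C1 : nearC 0 (fun e => spick (mob b z1) (mob b a) (x2 * s3 e) (mob x2 x1 * mob (s3 e) x1) (Cmod x1))).
  { refine (spick_lim (nearC 0) _ _ _ _ _ _ _ _ _ _ _ _ _ _ _ HV); try now apply clim_const.
    - apply clim_mult; [assumption|now apply clim_const|assumption].
    - apply clim_mult; [assumption|now apply clim_const|assumption].
    - now apply rlim_const. }
  assert (C2 : nearC 0 (fun e => spick z2 1 (x1 * x2) (mob x1 (s3 e) * (V / mob x1 x2)) (Cmod (s3 e)))).
  { refine (spick_lim (nearC 0) _ _ _ _ _ _ _ _ _ _ _ _ _ _ _ HVd); try now apply clim_const.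
    - cut (clim (nearC 0) (fun e => mob x1 (s3 e) * (V / mob x1 x2))%C (mob x1 x2 * (V / mob x1 x2))%C).
      { now replace (mob x1 x2 * (V / mob x1 x2))%C with V by (field; assumption). }
      apply clim_mult; [assumption|assumption|now apply clim_const].
    - assumption. }
  assert (C3 : nearC 0 (fun e => 0 < Cmod (s3 e))) by exact (rlim_lt (nearC 0) _ _ _ _ (rlim_const _ 0) R3 N2).
  assert (C4 : nearC 0 (fun e => Cmod x1 * (Cmod x2 * Cmod (s3 e)) < P)).
  { refine (rlim_lt (nearC 0) _ _ _ _ _ (rlim_const _ P) HP).
    apply rlim_mult; [assumption|now apply rlim_const|]. apply rlim_mult; [assumption|now apply rlim_const|assumption]. }
  destruct (@filter_and C (nearC 0) _ _ _ C0 (@filter_and C (nearC 0) _ _ _ C1 (@filter_and C (nearC 0) _ _ _ C2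
    (@filter_and C (nearC 0) _ _ _ C3 C4)))) as [d [Hd H]].
  exists d. split; [assumption|]. intros e He Hed.
  destruct (H e) as [H0 [H1 [H2 [H3 H4]]]]; [now replace (e - 0)%C with e by ring|].
  exists (s3 e). split; [|repeat split; assumption].
  assert (D3 : inD (s3 e)) by (apply inD_mob; [now apply inD_opp|assumption]).
  apply pick_comp3; try assumption; [now apply Cmod_gt_0|now apply Cmod_gt_0|].
  assert (E3 : mob x2 (s3 e) = (e * (V / mob x1 x2))%C) by (apply mobVK; [assumption|now left]).
  rewrite E3. replace (mob x1 (s3 e) * (e * (V / mob x1 x2)))%C with (e * (mob x1 (s3 e) * (V / mob x1 x2)))%C by ring.
  rewrite <- (Cmult_1_r e) at 1. now apply spick_scale.
Qed.

(** Bolzano-Weierstrass for pairs, with a real parameter in place of an index. Without a cluster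
    point, every point of the cube [[-1, 1]^4] would have a radius [rad] free of bad pairs, and
    compactness would bound these radii below by some [d], against the existence of a pair bad for
    [d]. *)
Lemma cluster_point (bad : R -> C -> C -> Prop) :
  (forall d d' s t, d <= d' -> bad d s t -> bad d' s t) ->
  (forall d, 0 < d -> exists s t, inD s /\ inD t /\ bad d s t) ->
  exists x y, forall d, 0 < d -> exists s t, Cmod (s - x) < d /\ Cmod (t - y) < d /\ bad d s t.
Proof.
  intros Hmono Hbad. apply NNPP. intros Hno.
  assert (H : forall x y : C, exists d, 0 < d /\ forall s t, Cmod (s - x) < d -> Cmod (t - y) < d -> ~ bad d s t).
  { intros x y. apply NNPP. intros Hc. apply Hno. exists x, y. intros d Hd. apply NNPP. intros Hc'.
    apply Hc. exists d. split; [assumption|]. intros s t Hs Ht Hb. apply Hc'. now exists s, t. }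
  set (rad x y := proj1_sig (constructive_indefinite_description _ (H x y))).
  assert (Hrad : forall x y, 0 < rad x y /\ forall s t, Cmod (s - x) < rad x y -> Cmod (t - y) < rad x y -> ~ bad (rad x y) s t).
  { intros x y. exact (proj2_sig (constructive_indefinite_description _ (H x y))). }
  assert (Hpos : forall x y, 0 < rad x y / 2) by (intros x y; destruct (Hrad x y); lra).
  (* Half the radius, because a modulus is estimated by the sum of the differences of the two
     coordinates. *)
  set (delta := fun v : Compactness.Tn 4 R => let '(a, (b, (c, (d, _)))) := v in
    mkposreal (rad (a, b) (c, d) / 2) (Hpos (a, b) (c, d))).
  destruct (compactness_value 4 (-1, (-1, (-1, (-1, tt)))) (1, (1, (1, (1, tt)))) delta) as [d Hd].
  destruct (Hbad d (cond_pos d)) as [[s1 s2] [[t1 t2] [Hs [Ht Hst]]]].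
  assert (B : forall u v, inD (u, v) -> -1 <= u <= 1 /\ -1 <= v <= 1).
  { intros u v Huv. unfold inD in Huv. pose proof (Rmax_Cmod (u, v)) as Hm. simpl fst in Hm. simpl snd in Hm.
    pose proof (Rmax_l (Rabs u) (Rabs v)). pose proof (Rmax_r (Rabs u) (Rabs v)).
    split; apply Rabs_le_between; lra. }
  destruct (B _ _ Hs). destruct (B _ _ Ht).
  apply (Hd (s1, (s2, (t1, (t2, tt))))); [simpl; tauto|].
  intros [[a1 [a2 [b1 [b2 []]]]] [_ [[c1 [c2 [c3 [c4 _]]]] Hle]]]. simpl in c1, c2, c3, c4, Hle.
  destruct (Hrad (a1, a2) (b1, b2)) as [Hr Hn].
  assert (Cl : forall u v u' v' r, Rabs (u - u') < r / 2 -> Rabs (v - v') < r / 2 -> Cmod ((u, v) - (u', v')) < r).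
  { intros u v u' v' r Hu Hv. replace ((u, v) - (u', v'))%C with (RtoC (u - u') + Ci * RtoC (v - v'))%C.
    - eapply Rle_lt_trans; [apply Cmod_RI|]. lra.
    - apply injective_projections; simpl; ring. }
  apply (Hn (s1, s2) (t1, t2)); try now apply Cl. 
  apply (Hmono d); [lra|assumption].
Qed.

(** * Collision of the parameters *)

Lemma comp2_mass (a b z1 z2 s1 s2 : C) : inD a -> inD b -> a <> b -> comp2 a b z1 z2 s1 s2 ->
  mass (mob b z1) (mob b a) z2 <= Cmod s1 * Cmod s2.
Proof.
  intros Ha Hb Hab H. destruct (comp2_bounds a b z1 z2 s1 s2 Ha Hb Hab H) as [H1 [H2 H3]].
  apply Rmax_lub; [assumption|]. rewrite Rmult_comm.
  apply Rmult_le_compat; try apply Cmod_ge_0; assumption.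
Qed.

Lemma comp3_inD a b e z1 z2 s1 s2 s3 : comp3 a b e z1 z2 s1 s2 s3 -> inD s1 /\ inD s2 /\ inD s3.
Proof. intros [p1 [p2 H]]. tauto. Qed.

Lemma comp3_nonzero (a b e z1 z2 s1 s2 s3 : C) : inD a -> inD b -> a <> b ->
  comp3 a b e z1 z2 s1 s2 s3 -> Cmod e < mass (mob b z1) (mob b a) z2 ->
  s1 <> 0 /\ s2 <> 0 /\ s3 <> 0.
Proof.
  intros Ha Hb Hab H He.
  pose proof (comp2_mass _ _ _ _ _ _ Ha Hb Hab (comp3_comp2 _ _ _ _ _ _ _ _ H)) as HM.
  pose proof (Cmod_ge_0 e). repeat split; intros E.
  - rewrite E, Cmod_0 in HM. lra.
  - rewrite E, Cmod_0 in HM. lra.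
  (* [s3 = 0] would mean that the base point is [(b, e)], whose mass is [|e|]. *)
  - destruct H as [p1 [p2 [_ [E1 [E2 [_ [_ [_ [_ [_ [_ [_ [C1 C2]]]]]]]]]]]]].
    rewrite E in C1, C2. assert (Ez1 : z1 = b) by congruence. assert (Ez2 : z2 = e) by congruence.
    unfold mass in He. rewrite Ez1, Ez2, mob_self, Cmod_0, Rmult_0_l, Rmax_left in He by assumption. lra.
Qed.

(* Below the mass, the value [e] is only reached if the two nodes sent to [b] are close. *)
Lemma comp3_small_product (a b e z1 z2 s1 s2 s3 : C) (c : R) : inD a -> inD b -> a <> b -> e <> 0 ->
  comp3 a b e z1 z2 s1 s2 s3 -> Cmod e < mass (mob b z1) (mob b a) z2 ->
  Cmod s1 * (Cmod s2 * Cmod s3) < c -> c < mass (mob b z1) (mob b a) z2 ->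
  pick_cond (mob b z1) (mob b a) (s2 * s3) (mob s2 s1 * mob s3 s1) (Cmod s1) /\
  Cmod z2 <= Cmod (s1 * s2) /\ 0 < Cmod z2 /\
  Cmod s3 * mass (mob b z1) (mob b a) z2 <= c /\
  Cmod (s2 - s3) * ((mass (mob b z1) (mob b a) z2 - c) * Cmod (mob b a)) <= 4 * Cmod e.
Proof.
  intros Ha Hb Hab He H Hem HP Hc.
  destruct (comp3_nonzero _ _ _ _ _ _ _ _ Ha Hb Hab H Hem) as [N1 [N2 N3]].
  destruct (comp3_inD _ _ _ _ _ _ _ _ H) as [D1 [D2 D3]].
  destruct (comp3_pick _ _ _ _ _ _ _ _ Hb Hab He N1 N2 N3 H) as [PZ PE].
  destruct (comp2_bounds _ _ _ _ _ _ Ha Hb Hab (comp3_comp2 _ _ _ _ _ _ _ _ H)) as [Hz [_ Hal]].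
  set (M := mass (mob b z1) (mob b a) z2) in *.
  (* The first component gives [|Z| <= |s2 s3|] and [|mob A Z| <= |s1|], so a product below [c]
     excludes the other term of the maximum. *)
  assert (EM : M = Cmod z2).
  { unfold M, mass. apply Rmax_left. apply Rnot_lt_le. intros Hlt.
    assert (HM : M = Cmod (mob b z1) * Cmod (mob (mob b a) (mob b z1))) by (apply Rmax_right; lra).
    assert (M <= Cmod s1 * (Cmod s2 * Cmod s3)).
    { rewrite HM, Rmult_comm. apply Rmult_le_compat; try apply Cmod_ge_0; [assumption|].
      destruct PZ as [PZ _]. now rewrite Cmod_mult in PZ. }
    lra. }
  assert (P1 := proj1 (Cmod_gt_0 _) N1). assert (P2 := proj1 (Cmod_gt_0 _) N2).
  assert (P3 := proj1 (Cmod_gt_0 _) N3).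
  assert (P12 : 0 < Cmod s1 * (Cmod s2 * Cmod s3)) by (repeat apply Rmult_lt_0_compat; assumption).
  split; [assumption|]. split; [now rewrite Cmod_mult|]. split; [lra|]. split; [rewrite EM; nra|].
  destruct PE as [_ [_ PE]]. destruct PZ as [_ [PA _]].
  set (W := (mob s1 s3 * mob s2 s3)%C) in *.
  assert (B1 : Cmod z2 * Cmod W - Cmod e * Cmod (s1 * s2) <= Cmod (z2 * W - e * (s1 * s2))).
  { rewrite <- !Cmod_mult. pose proof (Cmod_triangle (z2 * W - e * (s1 * s2)) (e * (s1 * s2))) as T.
    replace (z2 * W - e * (s1 * s2) + e * (s1 * s2))%C with (z2 * W)%C in T by ring. lra. }
  assert (B2 : Cmod (Cconj (s1 * s2) * W - Cconj z2 * e) <= Cmod (s1 * s2) * Cmod W + Cmod z2 * Cmod e).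
  { eapply Rle_trans; [apply Cmod_triangle|]. rewrite Cmod_opp, !(Cmod_mult (Cconj _)), !Cmod_conj. lra. }
  assert (B3 : Cmod (s1 * s2) <= 1).
  { rewrite Cmod_mult. unfold inD in *. nra. }
  pose proof (Cmod_ge_0 e). pose proof (Cmod_ge_0 W).
  (* The Pick inequality of the second component gives [|z2| |W| <= |s1 s2 s3| |W| + 2 |e|], where
     each side of it contributes one [|e|]. *)
  assert (B4 : (M - c) * Cmod W <= 2 * Cmod e).
  { assert (Cmod s3 * Cmod (Cconj (s1 * s2) * W - Cconj z2 * e) <= Cmod s3 * (Cmod (s1 * s2) * Cmod W + Cmod z2 * Cmod e))
      by (apply Rmult_le_compat_l; lra).
    assert (Cmod s3 * (Cmod (s1 * s2) * Cmod W) <= c * Cmod W).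
    { rewrite <- Rmult_assoc. apply Rmult_le_compat_r; [assumption|]. rewrite Cmod_mult. lra. }
    assert (Cmod s3 * (Cmod z2 * Cmod e) <= Cmod e).
    { rewrite Cmod_mult in B3. unfold inD in D3. rewrite <- Rmult_assoc.
      assert (Cmod s3 * Cmod z2 <= 1) by nra. nra. }
    assert (Cmod e * Cmod (s1 * s2) <= Cmod e) by nra.
    rewrite EM. lra. }
  (* [|A| <= |mob s2 s1| |mob s3 s1|] bounds the factor [mob s1 s3] of [W] from below, so that the
     smallness of [W] falls on [mob s2 s3]. *)
  assert (B5 : Cmod (mob b a) * Cmod (mob s2 s3) <= Cmod W).
  { unfold W. rewrite Cmod_mult. apply Rmult_le_compat_r; [apply Cmod_ge_0|].
    rewrite Cmod_mult in PA. rewrite (Cmod_mob_sym s1 s3) by assumption.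
    pose proof (Cmod_mob_le s2 s1 D2 D1). pose proof (Cmod_ge_0 (mob s3 s1)). nra. }
  assert (B6 : Cmod (s2 - s3) <= 2 * Cmod (mob s2 s3)).
  { rewrite <- Cmod_opp. replace (- (s2 - s3))%C with (s3 - s2)%C by ring.
    rewrite <- (Cmod_mob s2 s3) by (try assumption; now left).
    assert (Cmod (1 - Cconj s2 * s3) <= 2).
    { eapply Rle_trans; [apply Cmod_triangle|]. rewrite Cmod_opp, Cmod_1, Cmod_mult, Cmod_conj.
      unfold inD in *. nra. }
    pose proof (Cmod_ge_0 (mob s2 s3)). nra. }
  pose proof (Cmod_ge_0 (mob b a)).
  apply Rle_trans with (2 * Cmod (mob s2 s3) * ((M - c) * Cmod (mob b a))).
  - apply Rmult_le_compat_r; [|assumption]. apply Rmult_le_pos; lra.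
  - replace (2 * Cmod (mob s2 s3) * ((M - c) * Cmod (mob b a))) with
      (2 * ((M - c) * (Cmod (mob b a) * Cmod (mob s2 s3)))) by ring.
    assert ((M - c) * (Cmod (mob b a) * Cmod (mob s2 s3)) <= (M - c) * Cmod W) by (apply Rmult_le_compat_l; lra).
    lra.
Qed.

Lemma clim_seq_inv (u : nat -> C) (l : C) (K : R) :
  0 < K -> (forall n, Cmod (u n - l) <= K / INR (S n)) -> clim eventually u l.
Proof.
  intros HK H e He. destruct (archimed_cor1 (e / K)) as [N [HN HN0]]; [now apply Rdiv_lt_0_compat|].
  exists N. intros n Hn. eapply Rle_lt_trans; [apply H|].
  assert (P : 0 < INR N) by (now apply lt_0_INR).
  assert (INR N <= INR (S n)) by (apply le_INR; lia).
  apply Rle_lt_trans with (K * / INR N).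
  - apply Rmult_le_compat_l; [lra|]. now apply Rinv_le_contravar.
  - apply Rmult_lt_compat_l with (r := K) in HN; [|assumption]. replace (K * (e / K)) with e in HN by (field; lra). exact HN.
Qed.

Lemma pick_cond_lim (Z A S W : C) (m : R) (s w : nat -> C) (mm : nat -> R) :
  clim eventually s S -> clim eventually w W -> rlim eventually mm m ->
  (forall n, pick_cond Z A (s n) (w n) (mm n)) -> pick_cond Z A S W m.
Proof.
  intros Hs Hw Hm H. 
  assert (FF : Filter eventually) by typeclasses eauto.
  assert (all : forall P : nat -> Prop, (forall n, P n) -> eventually P) by (intros P HP; exists 0%nat; auto).
  split; [|split].
  - apply (rlim_le eventually (fun _ => Cmod Z) (fun n => Cmod (s n))); [now apply rlim_const|now apply rlim_Cmod|].
    apply all. intros n. apply (H n).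
  - apply (rlim_le eventually (fun _ => Cmod A) (fun n => Cmod (w n))); [now apply rlim_const|now apply rlim_Cmod|].
    apply all. intros n. apply (H n).
  - apply (rlim_le eventually (fun n => Cmod (Z * w n - A * s n))
      (fun n => mm n * Cmod (Cconj (s n) * w n - Cconj Z * A))).
    + apply rlim_Cmod; [assumption|]. apply clim_minus; [assumption|..]; apply clim_mult; try assumption; now apply clim_const.
    + apply rlim_mult; [assumption|assumption|]. apply rlim_Cmod; [assumption|].
      apply clim_minus; [assumption|..]; [|now apply clim_const]. apply clim_mult; [assumption|now apply clim_conj|assumption].
    + apply all. intros n. apply (H n).
Qed.

(** Of the two limit parameters, [x2] lies in the open disc because [|s3| M <= c < M], whereas [x1]
    is only known to lie in the closed one. *)
Lemma weakV_of_small_products (a b z1 z2 : C) (c : R) : inD a -> inD b -> a <> b -> 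
  0 < c < mass (mob b z1) (mob b a) z2 ->
  (forall d, 0 < d -> exists e s1 s2 s3 : C, e <> 0 /\ Cmod e < d /\ comp3 a b e z1 z2 s1 s2 s3 /\
     Cmod s1 * (Cmod s2 * Cmod s3) < c) ->
  exists x1 x2, weakV (mob b z1) (mob b a) z2 x1 x2 /\ Cmod x1 * (Cmod x2 * Cmod x2) <= c.
Proof.
  intros Ha Hb Hab Hc Hsmall.
  (* Only [s1] and [s3] are followed to a limit; [s2] has the same limit as [s3] by the collision
     estimate. *)
  set (bad := fun d s1 s3 => exists e s2 : C, e <> 0 /\ Cmod e < d /\ comp3 a b e z1 z2 s1 s2 s3 /\
     Cmod s1 * (Cmod s2 * Cmod s3) < c).
  destruct (cluster_point bad) as [x1 [x2 Hx]].
  { intros d d' s t Hd [e [s2 [H1 [H2 H3]]]]. exists e, s2. split; [assumption|]. split; [lra|assumption]. }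
  { intros d Hd. destruct (Hsmall d Hd) as [e [s1 [s2 [s3 [H1 [H2 [H3 H4]]]]]]].
    exists s1, s3. destruct (comp3_inD _ _ _ _ _ _ _ _ H3) as [D1 [_ D3]].
    split; [assumption|]. split; [assumption|]. exists e, s2. tauto. }
  set (M := mass (mob b z1) (mob b a) z2) in *.
  assert (HA0 : 0 < Cmod (mob b a)) by (apply Cmod_gt_0, mob_neq0; [assumption|now left|assumption]).
  set (G := (M - c) * Cmod (mob b a)). assert (HG : 0 < G) by (apply Rmult_lt_0_compat; lra).
  (* At scale [M / (n + 1)], which keeps [|e| < M], the cluster point gives [M / (n + 1)] and the
     collision adds [4 |e| / G]. *)
  set (K := 4 * M / G + M). 
  assert (HK : M <= K) by (unfold K; assert (0 < 4 * M / G) by (apply Rdiv_lt_0_compat; lra); lra).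
  assert (Hn : forall n : nat, exists p : C * C * C, let '(s1, s2, s3) := p in
    inD s1 /\ inD s2 /\ inD s3 /\
    Cmod (s1 - x1) <= K / INR (S n) /\ Cmod (s2 - x2) <= K / INR (S n) /\ Cmod (s3 - x2) <= K / INR (S n) /\
    pick_cond (mob b z1) (mob b a) (s2 * s3) (mob s2 s1 * mob s3 s1) (Cmod s1) /\
    Cmod z2 <= Cmod (s1 * s2) /\ 0 < Cmod z2 /\ Cmod s3 * M <= c /\ Cmod s1 * (Cmod s2 * Cmod s3) <= c).
  { intros n. assert (Hn : 0 < INR (S n)) by (apply lt_0_INR; lia).
    assert (Hn1 : 1 <= INR (S n)) by (rewrite S_INR; pose proof (pos_INR n); lra).
    assert (Q : 0 < M / INR (S n)) by (apply Rdiv_lt_0_compat; lra).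
    assert (QK : K / INR (S n) = 4 / G * (M / INR (S n)) + M / INR (S n)) by (unfold K; field; split; lra).
    assert (Q4 : 0 < 4 / G) by (apply Rdiv_lt_0_compat; lra).
    assert (Q5 : 0 < 4 / G * (M / INR (S n))) by (apply Rmult_lt_0_compat; lra).
    destruct (Hx _ Q) as [s1 [s3 [H1 [H3 [e [s2 [He [Hed [HC HP]]]]]]]]].
    assert (HeM : Cmod e < M).
    { eapply Rlt_le_trans; [exact Hed|]. apply Rmult_le_reg_r with (INR (S n)); [assumption|].
      unfold Rdiv. rewrite Rmult_assoc, Rinv_l by lra. nra. }
    destruct (comp3_small_product a b e z1 z2 s1 s2 s3 c Ha Hb Hab He HC HeM HP (proj2 Hc)) as [P1 [P2 [P3 [P4 P5]]]].
    fold M G in P4, P5. destruct (comp3_inD _ _ _ _ _ _ _ _ HC) as [D1 [D2 D3]].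
    exists (s1, s2, s3). rewrite QK.
    assert (H2 : Cmod (s2 - s3) <= 4 / G * (M / INR (S n))).
    { apply Rmult_le_reg_r with G; [assumption|]. eapply Rle_trans; [exact P5|].
      replace (4 / G * (M / INR (S n)) * G) with (4 * (M / INR (S n))) by (field; split; lra). lra. }
    repeat split; try assumption; try lra; try apply P1.
    replace (s2 - x2)%C with ((s2 - s3) + (s3 - x2))%C by ring. eapply Rle_trans; [apply Cmod_triangle|]. lra. }
  set (p n := proj1_sig (constructive_indefinite_description _ (Hn n))).
  assert (Hp : forall n, let '(s1, s2, s3) := p n in
    inD s1 /\ inD s2 /\ inD s3 /\
    Cmod (s1 - x1) <= K / INR (S n) /\ Cmod (s2 - x2) <= K / INR (S n) /\ Cmod (s3 - x2) <= K / INR (S n) /\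
    pick_cond (mob b z1) (mob b a) (s2 * s3) (mob s2 s1 * mob s3 s1) (Cmod s1) /\
    Cmod z2 <= Cmod (s1 * s2) /\ 0 < Cmod z2 /\ Cmod s3 * M <= c /\ Cmod s1 * (Cmod s2 * Cmod s3) <= c).
  { intros n. exact (proj2_sig (constructive_indefinite_description _ (Hn n))). }
  set (s1 n := fst (fst (p n))). set (s2 n := snd (fst (p n))). set (s3 n := snd (p n)).
  assert (Hs : forall n, inD (s1 n) /\ inD (s2 n) /\ inD (s3 n) /\
    Cmod (s1 n - x1) <= K / INR (S n) /\ Cmod (s2 n - x2) <= K / INR (S n) /\ Cmod (s3 n - x2) <= K / INR (S n) /\
    pick_cond (mob b z1) (mob b a) (s2 n * s3 n) (mob (s2 n) (s1 n) * mob (s3 n) (s1 n)) (Cmod (s1 n)) /\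
    Cmod z2 <= Cmod (s1 n * s2 n) /\ 0 < Cmod z2 /\ Cmod (s3 n) * M <= c /\ Cmod (s1 n) * (Cmod (s2 n) * Cmod (s3 n)) <= c).
  { intros n. specialize (Hp n). unfold s1, s2, s3. destruct (p n) as [[u v] w]. exact Hp. }
  clearbody s1 s2 s3. clear Hp p Hn.
  assert (FF : Filter eventually) by typeclasses eauto.
  assert (all : forall P : nat -> Prop, (forall n, P n) -> eventually P) by (intros P HP; exists 0%nat; auto).
  assert (L1 : clim eventually s1 x1) by (apply (clim_seq_inv s1 x1 K); [lra|intros n; apply (Hs n)]).
  assert (L2 : clim eventually s2 x2) by (apply (clim_seq_inv s2 x2 K); [lra|intros n; apply (Hs n)]).
  assert (L3 : clim eventually s3 x2) by (apply (clim_seq_inv s3 x2 K); [lra|intros n; apply (Hs n)]).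
  assert (Bx1 : Cmod x1 <= 1).
  { apply (rlim_le eventually (fun n => Cmod (s1 n)) (fun _ => 1)); [now apply rlim_Cmod|now apply rlim_const|].
    apply all. intros n. left. apply (Hs n). }
  assert (Bx2 : Cmod x2 * M <= c).
  { apply (rlim_le eventually (fun n => Cmod (s3 n) * M) (fun _ => c)); [|now apply rlim_const|].
    - apply rlim_mult; [assumption|now apply rlim_Cmod|now apply rlim_const].
    - apply all. intros n. apply (Hs n). }
  assert (Dx2 : inD x2).
  { unfold inD. apply Rmult_lt_reg_r with M; [lra|]. lra. }
  assert (Bz : Cmod z2 <= Cmod (x1 * x2)).
  { apply (rlim_le eventually (fun _ => Cmod z2) (fun n => Cmod (s1 n * s2 n))); [now apply rlim_const| |].
    - apply rlim_Cmod; [assumption|]. now apply clim_mult.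
    - apply all. intros n. apply (Hs n). }
  assert (Hz0 : 0 < Cmod z2) by apply (Hs 0%nat).
  assert (N : (x1 * x2)%C <> 0) by (apply Cmod_gt_0; lra).
  exists x1, x2. split.
  - split; [assumption|]. split; [assumption|]. split; [|split; [|split; [|assumption]]].
    + intros E. apply N. rewrite E. ring.
    + intros E. apply N. rewrite E. ring.
    + apply (pick_cond_lim _ _ _ _ _ (fun n => s2 n * s3 n)%C (fun n => mob (s2 n) (s1 n) * mob (s3 n) (s1 n))%C (fun n => Cmod (s1 n))).
      * now apply clim_mult.
      * apply clim_mult; [assumption|apply clim_mob; try assumption; now apply mob_den|apply clim_mob; try assumption; now apply mob_den].
      * now apply rlim_Cmod.
      * intros n. apply (Hs n).
  - apply (rlim_le eventually (fun n => Cmod (s1 n) * (Cmod (s2 n) * Cmod (s3 n))) (fun _ => c)); [|now apply rlim_const|].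
    + apply rlim_mult; [assumption|now apply rlim_Cmod|]. apply rlim_mult; [assumption|now apply rlim_Cmod|now apply rlim_Cmod].
    + apply all. intros n. apply (Hs n).
Qed.

(** * The limit *)

Lemma logabs_pos (s : C) : 0 < Cmod s -> logabs s = Finite (ln (Cmod s)).
Proof. intros H. unfold logabs. destruct (Req_EM_T (Cmod s) 0); [lra|reflexivity]. Qed.

Lemma logabs3 (s1 s2 s3 : C) : 0 < Cmod s1 -> 0 < Cmod s2 -> 0 < Cmod s3 ->
  Rbar_plus (Rbar_plus (logabs s1) (logabs s2)) (logabs s3) = Finite (ln (Cmod s1 * (Cmod s2 * Cmod s3))).
Proof.
  intros H1 H2 H3. rewrite !logabs_pos by assumption. simpl.
  rewrite !ln_mult by (assumption || now apply Rmult_lt_0_compat). f_equal. ring.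
Qed.

Lemma logabs12 (s1 s2 : C) : 0 < Cmod s1 -> 0 < Cmod s2 ->
  Rbar_plus (logabs s1) (Rbar_plus (logabs s2) (logabs s2)) = Finite (ln (Cmod s1 * (Cmod s2 * Cmod s2))).
Proof.
  intros H1 H2. rewrite !logabs_pos by assumption. simpl.
  rewrite !ln_mult by (assumption || now apply Rmult_lt_0_compat). reflexivity.
Qed.

Lemma logabs2 (s1 s2 : C) : 0 < Cmod s1 -> 0 < Cmod s2 ->
  Rbar_plus (logabs s1) (logabs s2) = Finite (ln (Cmod s1 * Cmod s2)).
Proof. intros H1 H2. rewrite !logabs_pos by assumption. simpl. now rewrite ln_mult. Qed.

Lemma Rbar_glb_lb (E : Rbar -> Prop) v : E v -> Rbar_le (Rbar_glb E) v.
Proof. intros H. unfold Rbar_glb. destruct (Rbar_ex_glb E) as [l [H1 H2]]. simpl. now apply H1. Qed.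

Lemma Rbar_glb_greatest (E : Rbar -> Prop) l : (forall v, E v -> Rbar_le l v) -> Rbar_le l (Rbar_glb E).
Proof. intros H. unfold Rbar_glb. destruct (Rbar_ex_glb E) as [m [H1 H2]]. simpl. now apply H2. Qed.

Lemma Rmult_pos_factors (x y : R) : 0 <= x -> 0 <= y -> 0 < x * y -> 0 < x /\ 0 < y.
Proof.
  intros Hx Hy H. split; apply Rnot_le_lt; intros Hle.
  - assert (x = 0) as E by lra. rewrite E in H. lra.
  - assert (y = 0) as E by lra. rewrite E in H. lra.
Qed.

Lemma coman3_le (a b e : C) (z : C * C) (s1 s2 s3 : C) :
  comp3 a b e (fst z) (snd z) s1 s2 s3 -> 0 < Cmod s1 -> 0 < Cmod s2 -> 0 < Cmod s3 ->
  Rbar_le (coman3 (a, RtoC 0) (b, RtoC 0) (b, e) z) (Finite (ln (Cmod s1 * (Cmod s2 * Cmod s3)))).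
Proof.
  intros [p1 [p2 [Hp [E1 [E2 [D1 [D2 [D3 [A1 [A2 [B1 [B2 [C1 C2]]]]]]]]]]]]] P1 P2 P3.
  rewrite <- logabs3 by assumption. apply Rbar_glb_lb.
  exists p1, p2, s1, s2, s3. rewrite A1, A2, B1, B2, C1, C2. tauto.
Qed.

(** A positive lower bound on the products excludes parameters equal to 0, so every [logabs] is
    finite and the sum is the logarithm of the product. *)
Lemma coman3_ge (a b e : C) (z : C * C) (c : R) : 0 < c ->
  (forall s1 s2 s3, comp3 a b e (fst z) (snd z) s1 s2 s3 -> c <= Cmod s1 * (Cmod s2 * Cmod s3)) ->
  Rbar_le (Finite (ln c)) (coman3 (a, RtoC 0) (b, RtoC 0) (b, e) z).
Proof.
  intros Hc H. apply Rbar_glb_greatest.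
  intros v [p1 [p2 [s1 [s2 [s3 [Hp [E1 [E2 [D1 [D2 [D3 [A [B [C0 ->]]]]]]]]]]]]]].
  apply pair_equal_spec in A, B, C0. destruct A as [A1 A2], B as [B1 B2], C0 as [C1 C2].
  assert (HP : c <= Cmod s1 * (Cmod s2 * Cmod s3)) by (apply H; exists p1, p2; tauto).
  pose proof (Cmod_ge_0 s1). pose proof (Cmod_ge_0 s2). pose proof (Cmod_ge_0 s3).
  destruct (Rmult_pos_factors (Cmod s1) (Cmod s2 * Cmod s3)) as [P1 P23]; [assumption|now apply Rmult_le_pos|lra|].
  destruct (Rmult_pos_factors (Cmod s2) (Cmod s3)) as [P2 P3]; [assumption..|].
  rewrite logabs3 by assumption. simpl. apply ln_le; lra.
Qed.

Lemma L_a0b0_le (a b : C) (z : C * C) (s1 s2 : C) :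
  comp2 a b (fst z) (snd z) s1 s2 -> 0 < Cmod s1 -> 0 < Cmod s2 ->
  Rbar_le (L_a0b0 a b z) (Finite (ln (Cmod s1 * Cmod s2))).
Proof.
  intros [p1 [p2 H]] P1 P2. rewrite <- logabs2 by assumption. apply Rbar_glb_lb.
  exists p1, p2, s1, s2. tauto.
Qed.

Lemma L_a0b0_ge (a b : C) (z : C * C) (c : R) : 0 < c ->
  (forall s1 s2, comp2 a b (fst z) (snd z) s1 s2 -> c <= Cmod s1 * Cmod s2) ->
  Rbar_le (Finite (ln c)) (L_a0b0 a b z).
Proof.
  intros Hc H. apply Rbar_glb_greatest.
  intros v [p1 [p2 [s1 [s2 [Hp [E1 [E2 [D1 [D2 [A1 [A2 [B1 [B2 ->]]]]]]]]]]]]].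
  assert (HP : c <= Cmod s1 * Cmod s2) by (apply H; exists p1, p2; tauto).
  pose proof (Cmod_ge_0 s1). pose proof (Cmod_ge_0 s2).
  destruct (Rmult_pos_factors (Cmod s1) (Cmod s2)) as [P1 P2]; [assumption|assumption|lra|].
  rewrite logabs2 by assumption. simpl. apply ln_le; lra.
Qed.

Lemma L_a0bV_le (a b : C) (z : C * C) (s1 s2 : C) :
  compV a b (fst z) (snd z) s1 s2 -> 0 < Cmod s1 -> 0 < Cmod s2 ->
  Rbar_le (L_a0bV a b z) (Finite (ln (Cmod s1 * (Cmod s2 * Cmod s2)))).
Proof.
  intros [p1 [p2 H]] P1 P2. rewrite <- logabs12 by assumption. apply Rbar_glb_lb.
  exists p1, p2, s1, s2. tauto.
Qed.

Lemma L_a0bV_ge (a b : C) (z : C * C) (c : R) : 0 < c ->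
  (forall s1 s2, compV a b (fst z) (snd z) s1 s2 -> c <= Cmod s1 * (Cmod s2 * Cmod s2)) ->
  Rbar_le (Finite (ln c)) (L_a0bV a b z).
Proof.
  intros Hc H. apply Rbar_glb_greatest.
  intros v [p1 [p2 [s1 [s2 [Hp [E1 [E2 [D1 [D2 [A1 [A2 [B1 [B2 [B3 ->]]]]]]]]]]]]]].
  assert (HP : c <= Cmod s1 * (Cmod s2 * Cmod s2)) by (apply H; exists p1, p2; tauto).
  pose proof (Cmod_ge_0 s1). pose proof (Cmod_ge_0 s2).
  destruct (Rmult_pos_factors (Cmod s1) (Cmod s2 * Cmod s2)) as [P1 P22]; [assumption|now apply Rmult_le_pos|lra|].
  destruct (Rmult_pos_factors (Cmod s2) (Cmod s2)) as [P2 _]; [assumption..|].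
  rewrite logabs12 by assumption. simpl. apply ln_le; lra.
Qed.

Lemma locally'_C (P : C -> Prop) (d : R) : 0 < d ->
  (forall e : C, e <> 0 -> Cmod e < d -> P e) -> locally' (RtoC 0) P.
Proof.
  intros Hd H. exists (mkposreal (d / 2) ltac:(lra)). intros e He Hne. apply H; [assumption|].
  destruct e as [u v]. destruct He as [H1 H2]. simpl in H1, H2.
  apply Rabs_lt_between in H1. apply Rabs_lt_between in H2. unfold minus, plus, opp in H1, H2; simpl in H1, H2.
  replace (u, v) with (RtoC u + Ci * RtoC v)%C by (apply injective_projections; simpl; ring).
  eapply Rle_lt_trans; [apply Cmod_RI|].
  assert (Rabs u < d / 2) by (apply Rabs_def1; lra). assert (Rabs v < d / 2) by (apply Rabs_def1; lra). lra.
Qed.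

Section Limit.
Variables (a b : C) (z : C * C).
Hypotheses (Ha : inD a) (Hb : inD b) (Hab : a <> b) (Hz : inD2 z).
Let M := mass (mob b (fst z)) (mob b a) (snd z).

Lemma mass_lt_1 : 0 <= M < 1.
Proof using Ha Hb Hz.
  destruct Hz as [Hz1 Hz2]. pose proof (inD_mob b (fst z) Hb Hz1) as H1. pose proof (inD_mob b a Hb Ha) as H2.
  pose proof (inD_mob _ _ H2 H1) as H3. unfold inD in *. pose proof (Cmod_ge_0 (snd z)).
  pose proof (Cmod_ge_0 (mob b (fst z))). pose proof (Cmod_ge_0 (mob (mob b a) (mob b (fst z)))).
  split.
  - eapply Rle_trans; [|apply Rmax_l]. assumption.
  - apply Rmax_lub_lt; [assumption|nra].
Qed.

Lemma coman3_le_above_mass (r : R) : M < exp r ->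
  exists d, 0 < d /\ forall e, Cmod e < d -> Rbar_le (coman3 (a, RtoC 0) (b, RtoC 0) (b, e) z) (Finite r).
Proof using Ha Hb Hab Hz.
  intros Hr. destruct mass_lt_1 as [M0 M1].
  destruct (comp3_above_mass a b (fst z) (snd z) (Rmin (exp r) 1) Ha Hb Hab (proj1 Hz)) as
    [s1 [s2 [s3 [H1 [H2 [P1 [P2 [P3 [d [Hd H]]]]]]]]]]; [now apply Rmin_glb_lt|apply Rmin_r|].
  exists d. split; [assumption|]. intros e He.
  eapply Rbar_le_trans; [apply coman3_le; [now apply H|assumption|assumption|assumption]|].
  simpl. rewrite <- (ln_exp r). apply ln_le; [repeat apply Rmult_lt_0_compat; assumption|].
  pose proof (Rmin_l (exp r) 1). assert (0 < Cmod s1 * Cmod s2) by (now apply Rmult_lt_0_compat). nra.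
Qed.

Lemma L_a0b0_le_above_mass (r : R) : M < exp r -> Rbar_le (L_a0b0 a b z) (Finite r).
Proof using Ha Hb Hab Hz.
  intros Hr. destruct mass_lt_1 as [M0 M1].
  destruct (comp3_above_mass a b (fst z) (snd z) (Rmin (exp r) 1) Ha Hb Hab (proj1 Hz)) as
    [s1 [s2 [s3 [H1 [H2 [P1 [P2 [P3 [d [Hd H]]]]]]]]]]; [now apply Rmin_glb_lt|apply Rmin_r|].
  eapply Rbar_le_trans.
  - apply L_a0b0_le; [|exact P1|exact P2]. apply (comp3_comp2 a b 0 _ _ s1 s2 s3). apply H. now rewrite Cmod_0.
  - simpl. rewrite <- (ln_exp r). apply ln_le; [now apply Rmult_lt_0_compat|].
    eapply Rle_trans; [exact H1|apply Rmin_l].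
Qed.

Lemma L_a0b0_mass_0 : M = 0 -> L_a0b0 a b z = m_infty.
Proof using Ha Hb Hab Hz.
  intros E. assert (H : forall r, Rbar_le (L_a0b0 a b z) (Finite r)).
  { intros r. apply L_a0b0_le_above_mass. rewrite E. apply exp_pos. }
  destruct (L_a0b0 a b z) as [r| |]; [|exact (False_ind _ (H 0))|reflexivity].
  specialize (H (r - 1)). simpl in H. lra.
Qed.

Lemma L_a0b0_mass : 0 < M -> L_a0b0 a b z = Finite (ln M).
Proof using Ha Hb Hab Hz.
  intros HM. apply Rbar_le_antisym.
  - assert (H : forall eps, 0 < eps -> Rbar_le (L_a0b0 a b z) (Finite (ln M + eps))).
    { intros eps He. apply L_a0b0_le_above_mass. rewrite <- (exp_ln M HM) at 1. apply exp_increasing. lra. }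
    destruct (L_a0b0 a b z) as [r| |]; [|exact (H 1 Rlt_0_1)|exact I].
    apply le_epsilon. exact H.
  - apply L_a0b0_ge; [assumption|]. intros s1 s2 H. now apply comp2_mass.
Qed.

Lemma compV_mass s1 s2 : compV a b (fst z) (snd z) s1 s2 -> 
  inD s1 /\ inD s2 /\ M <= Cmod s1 * Cmod s2.
Proof using Ha Hb Hab.
  intros H. pose proof (compV_comp2 _ _ _ _ _ _ H) as H2. split; [|split].
  - destruct H2 as [p1 [p2 H2]]. tauto.
  - destruct H2 as [p1 [p2 H2]]. tauto.
  - now apply comp2_mass.
Qed.

(** Restates the minimum in terms of products: [exp x] bounds them below, and any larger [P] exceeds
    either the mass or the product of some competitor for [L_a0bV]. These alternatives select the
    construction for the upper bound. *)
Lemma min_finite : 0 < M -> exists x : R,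
  Rbar_min (L_a0bV a b z) (L_a0b0 a b z) = Finite x /\ exp x <= M /\
  (forall s1 s2, compV a b (fst z) (snd z) s1 s2 -> exp x <= Cmod s1 * (Cmod s2 * Cmod s2)) /\
  (forall P, exp x < P -> M < P \/ exists s1 s2, compV a b (fst z) (snd z) s1 s2 /\ Cmod s1 * (Cmod s2 * Cmod s2) < P).
Proof using Ha Hb Hab Hz.
  intros HM. rewrite (L_a0b0_mass HM).
  (* [M <= |s1| |s2|] and [|s1| < 1] give [M <= |s2|], whence [M^2 <= |s1| |s2|^2]: [L_a0bV] is
     bounded below. *)
  assert (Hpos : forall s1 s2, compV a b (fst z) (snd z) s1 s2 -> 0 < Cmod s1 /\ 0 < Cmod s2 /\ M * M <= Cmod s1 * (Cmod s2 * Cmod s2)).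
  { intros s1 s2 H. destruct (compV_mass s1 s2 H) as [D1 [D2 H12]]. unfold inD in *.
    pose proof (Cmod_ge_0 s1). pose proof (Cmod_ge_0 s2).
    destruct (Rmult_pos_factors (Cmod s1) (Cmod s2)) as [P1 P2]; [assumption|assumption|lra|].
    assert (M <= Cmod s2) by nra.
    split; [assumption|split; [assumption|]]. rewrite <- Rmult_assoc. apply Rmult_le_compat; lra. }
  assert (HV : Rbar_le (Finite (ln (M * M))) (L_a0bV a b z)).
  { apply L_a0bV_ge; [now apply Rmult_lt_0_compat|]. intros s1 s2 H. now apply Hpos. }
  assert (HVle : forall s1 s2, compV a b (fst z) (snd z) s1 s2 ->
    Rbar_le (L_a0bV a b z) (Finite (ln (Cmod s1 * (Cmod s2 * Cmod s2))))).
  { intros s1 s2 H. destruct (Hpos _ _ H) as [P1 [P2 _]]. now apply L_a0bV_le. }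
  assert (HVge : forall c, 0 < c ->
    ~ (exists s1 s2, compV a b (fst z) (snd z) s1 s2 /\ Cmod s1 * (Cmod s2 * Cmod s2) < c) ->
    Rbar_le (Finite (ln c)) (L_a0bV a b z)).
  { intros c Hc Hno. apply L_a0bV_ge; [assumption|]. intros s1 s2 H. apply Rnot_lt_le. intros Hlt.
    apply Hno. now exists s1, s2. }
  assert (HE : forall x s1 s2, compV a b (fst z) (snd z) s1 s2 -> x <= ln (Cmod s1 * (Cmod s2 * Cmod s2)) ->
     exp x <= Cmod s1 * (Cmod s2 * Cmod s2)).
  { intros x s1 s2 H Hx. destruct (Hpos _ _ H) as [P1 [P2 _]].
    assert (P : 0 < Cmod s1 * (Cmod s2 * Cmod s2)) by (repeat apply Rmult_lt_0_compat; assumption).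
    rewrite <- (exp_ln _ P). destruct Hx as [Hx| ->]; [left; now apply exp_increasing|right; reflexivity]. }
  assert (Hcase : (exists x, L_a0bV a b z = Finite x /\ x < ln M) \/ Rbar_le (Finite (ln M)) (L_a0bV a b z)).
  { destruct (L_a0bV a b z) as [x| |]; [|right; exact I|contradiction].
    destruct (Rlt_le_dec x (ln M)); [left; now exists x|right; assumption]. }
  destruct Hcase as [[x [Ex Hx]]|Hge].
  - exists x. rewrite Ex in *. simpl. split; [f_equal; apply Rmin_left; lra|]. split; [|split].
    + rewrite <- (exp_ln M HM). left. now apply exp_increasing.
    + intros s1 s2 H. apply HE; [assumption|]. exact (HVle _ _ H).
    + intros P HP. right. apply NNPP. intros Hno. pose proof (exp_pos x).
      pose proof (HVge P ltac:(lra) Hno) as H1. simpl in H1.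
      assert (x < ln P) by (rewrite <- (ln_exp x); now apply ln_increasing). lra.
  - exists (ln M). split; [|split; [|split]].
    + destruct (L_a0bV a b z) as [x| |]; [|reflexivity|contradiction]. simpl in *. f_equal. now apply Rmin_right.
    + rewrite exp_ln by assumption. lra.
    + intros s1 s2 H. apply HE; [assumption|]. pose proof (Rbar_le_trans _ _ _ Hge (HVle _ _ H)) as T. exact T.
    + intros P HP. left. now rewrite exp_ln in HP.
Qed.

Lemma compV_weakV s1 s2 : 0 < M -> compV a b (fst z) (snd z) s1 s2 ->
  weakV (mob b (fst z)) (mob b a) (snd z) s1 s2.
Proof using Ha Hb Hab.
  intros HM H. destruct (compV_mass s1 s2 H) as [D1 [D2 H12]].
  destruct (comp2_bounds _ _ _ _ _ _ Ha Hb Hab (compV_comp2 _ _ _ _ _ _ H)) as [Hz2 _].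
  assert (N1 : s1 <> 0) by (intros E; rewrite E, Cmod_0 in H12; lra).
  assert (N2 : s2 <> 0) by (intros E; rewrite E, Cmod_0 in H12; lra).
  destruct (compV_pick _ _ _ _ _ _ Hb Hab N1 N2 H) as [_ [_ HP]].
  split; [now left|]. rewrite Cmod_mult. tauto.
Qed.

Lemma coman3_le_above_V (r : R) s1 s2 : 0 < M -> compV a b (fst z) (snd z) s1 s2 ->
  Cmod s1 * (Cmod s2 * Cmod s2) < exp r ->
  exists d, 0 < d /\ forall e : C, e <> 0 -> Cmod e < d ->
    Rbar_le (coman3 (a, RtoC 0) (b, RtoC 0) (b, e) z) (Finite r).
Proof using Ha Hb Hab Hz.
  intros HM H HP. 
  assert (HA0 : mob b a <> 0) by (apply mob_neq0; [assumption|now left|assumption]).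
  destruct (weakV_strictV _ _ _ _ _ _ HA0 (inD_mob b a Hb Ha) (compV_weakV s1 s2 HM H) HP) as [x1 [x2 [Hx HxP]]].
  destruct (comp3_near_strictV a b (fst z) (snd z) x1 x2 (exp r) Ha Hb Hab (proj1 Hz) Hx HxP) as [d [Hd Hc]].
  exists d. split; [assumption|]. intros e He Hed. destruct (Hc e He Hed) as [s3 [H3 [P1 [P2 [P3 H4]]]]].
  eapply Rbar_le_trans; [now apply coman3_le; [exact H3| | |]|]. simpl. rewrite <- (ln_exp r).
  apply ln_le; [repeat apply Rmult_lt_0_compat; assumption|lra].
Qed.

(** Otherwise the collision yields a [weakV] pair with product at most [exp r]. The gap between
    [exp r] and [exp x] leaves room to make it strict, and [pick_compV] then gives a competitor for
    [L_a0bV] with product below [exp x]. *)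
Lemma coman3_ge_below (x r : R) : 0 < M -> exp x <= M ->
  (forall s1 s2, compV a b (fst z) (snd z) s1 s2 -> exp x <= Cmod s1 * (Cmod s2 * Cmod s2)) -> r < x ->
  exists d, 0 < d /\ forall e : C, e <> 0 -> Cmod e < d ->
    Rbar_le (Finite r) (coman3 (a, RtoC 0) (b, RtoC 0) (b, e) z).
Proof using Ha Hb Hab Hz.
  intros HM HxM HV Hr. pose proof (exp_increasing _ _ Hr) as He. pose proof (exp_pos r).
  assert (HA0 : mob b a <> 0) by (apply mob_neq0; [assumption|now left|assumption]).
  apply NNPP. intros Hno.
  destruct (weakV_of_small_products a b (fst z) (snd z) (exp r) Ha Hb Hab) as [x1 [x2 [Hx HP]]].
  { fold M. lra. }
  { intros d Hd. apply NNPP. intros Hno'. apply Hno. exists d. split; [assumption|]. intros e He0 Hed.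
    rewrite <- (ln_exp r). apply coman3_ge; [assumption|]. intros s1 s2 s3 Hc. apply Rnot_lt_le. intros Hlt.
    apply Hno'. exists e, s1, s2, s3. tauto. }
  destruct (weakV_strictV _ _ _ _ _ (exp x) HA0 (inD_mob b a Hb Ha) Hx ltac:(lra)) as [y1 [y2 [[D1 [D2 [Hs Hz2]]] HyP]]].
  assert (Hy : compV a b (fst z) (snd z) y1 y2).
  { apply pick_compV; try assumption; [apply Hz|]. intros E. rewrite E, Cmult_0_l, Cmod_0 in Hz2.
    pose proof (Cmod_ge_0 (snd z)). lra. }
  specialize (HV y1 y2 Hy). lra.
Qed.
End Limit.

Theorem mainTheorem15 (a b : C) (z : C * C) :
  inD a -> inD b -> a <> b -> inD2 z ->
  C_punct_lim (fun e => coman3 (a, RtoC 0) (b, RtoC 0) (b, e) z)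
              (Rbar_min (L_a0bV a b z) (L_a0b0 a b z)).
Proof.
  intros Ha Hb Hab Hz P HP. set (M := mass (mob b (fst z)) (mob b a) (snd z)).
  destruct (mass_lt_1 a b z Ha Hb Hz) as [M0 M1]. fold M in M0, M1.
  destruct (Rle_lt_or_eq_dec _ _ M0) as [HM|HM].
  - destruct (min_finite a b z Ha Hb Hab Hz HM) as [x [Ex [HxM [HxV Hinf]]]]. rewrite Ex in HP.
    destruct HP as [eps HP]. pose proof (cond_pos eps) as He.
    assert (Hup : exists d, 0 < d /\ forall e : C, e <> 0 -> Cmod e < d ->
      Rbar_le (coman3 (a, RtoC 0) (b, RtoC 0) (b, e) z) (Finite (x + eps / 2))).
    { destruct (Hinf (exp (x + eps / 2))) as [H|[s1 [s2 [HV HVP]]]]; [apply exp_increasing; lra| |].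
      - destruct (coman3_le_above_mass a b z Ha Hb Hab Hz _ H) as [d [Hd Hc]]. exists d. split; auto.
      - exact (coman3_le_above_V a b z Ha Hb Hab Hz _ s1 s2 HM HV HVP). }
    destruct Hup as [d1 [Hd1 H1]].
    destruct (coman3_ge_below a b z Ha Hb Hab Hz x (x - eps / 2) HM HxM HxV ltac:(lra)) as [d2 [Hd2 H2]].
    apply (locally'_C _ (Rmin d1 d2)); [now apply Rmin_glb_lt|]. intros e He0 Hed.
    specialize (H1 e He0 (Rlt_le_trans _ _ _ Hed (Rmin_l _ _))).
    specialize (H2 e He0 (Rlt_le_trans _ _ _ Hed (Rmin_r _ _))).
    destruct (coman3 (a, RtoC 0) (b, RtoC 0) (b, e) z) as [y| |]; [|contradiction|contradiction].
    simpl in H1, H2. apply HP. apply Rabs_def1; lra.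
  (* For mass 0 the minimum is [m_infty], and the upper bounds near [L_a0b0] alone give the
     limit. *)
  - rewrite (L_a0b0_mass_0 a b z Ha Hb Hab Hz (eq_sym HM)) in HP.
    assert (Em : Rbar_min (L_a0bV a b z) m_infty = m_infty) by (destruct (L_a0bV a b z); reflexivity).
    rewrite Em in HP. destruct HP as [N HP].
    destruct (coman3_le_above_mass a b z Ha Hb Hab Hz (N - 1)) as [d [Hd Hc]].
    { fold M. rewrite <- HM. apply exp_pos. }
    apply (locally'_C _ d Hd). intros e _ Hed. apply HP.
    eapply Rbar_le_lt_trans; [now apply Hc|]. simpl. lra.
Qed.
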